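(* Let $G$ be a finite simple outerplanar graph with at least one edge. Then the matching complex $\mathcal{M}(G)$ is contractible or homotopy equivalent to a wedge of spheres.
   Context: A graph is outerplanar if it has an embedding in the plane such that all of its vertices lie on the unbounded face. The graph is not assumed to be connected. A matching of a graph $G$ is a set of pairwise disjoint edges of $G$ (no two distinct edges in the set share a vertex). The matching complex $\mathcal{M}(G)$ is the simplicial complex whose vertices are the edges of $G$ and whose faces are the matchings of $G$; homotopy statements refer to its geometric realization. In ''wedge of spheres'', the spheres may have different dimensions, $0$-dimensional spheres $S^0$ (two points) are allowed, and a single sphere counts as a wedge of spheres. *)

(* Defs.v *)
From HB Require Import structures.
From mathcomp Require Import all_boot all_order all_algebra.
From mathcomp Require Import all_classical all_reals all_analysis.
From mathcomp Require Import homotopy.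
Import Order.TTheory GRing.Theory Num.Theory.
Import numFieldNormedType.Exports.

Set Implicit Arguments.
Unset Strict Implicit.
Unset Printing Implicit Defensive.

Local Open Scope classical_set_scope.
Local Open Scope ring_scope.

Record sgraph := SGraph {
  vertex :> finType;
  adj : rel vertex;
  adj_sym : symmetric adj;
  adj_irrefl : irreflexive adj
}.

Definition is_edge (G : sgraph) (s : {set G}) : bool :=
  [exists x : G, exists y : G, adj x y && (s == [set x; y]%SET)].

Definition edge (G : sgraph) : finType := {s : {set G} | is_edge s}.

Section Outerplanar.
Variables (R : realType) (G : sgraph).

(* A drawing sends vertices to points of the plane and every edge [e] to the
   arc [c e @` `[0, 1]]; the values of [c e] outside [`[0, 1]] are junk. *)
Record plane_embedding (p : G -> R * R) (c : edge G -> R -> R * R) : Prop :=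
  PlaneEmbedding {
    pe_vertex_inj : injective p;
    pe_arc_cont : forall e, {within `[0, 1], continuous (c e)};
    pe_arc_inj : forall e, {in `[0, 1] &, injective (c e)};
    pe_arc_ends : forall e, [set c e 0; c e 1] = p @` [set` val e];
    pe_arc_vertex : forall e t v, t \in `]0, 1[ -> c e t <> p v;
    pe_arc_arc : forall e f s t, e != f -> s \in `]0, 1[ -> t \in `]0, 1[ ->
      c e s <> c f t
  }.

Definition drawing (p : G -> R * R) (c : edge G -> R -> R * R) : set (R * R) :=
  range p `|` \bigcup_e (c e @` `[0, 1]).

Definition face (D F : set (R * R)) : Prop :=
  exists2 z, (~` D) z & F = connected_component (~` D) z.

(* Vertices belong to the drawing, hence to no (open) face: lying on a face
   means lying in its closure, i.e. on its boundary. *)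
Definition outerplanar : Prop :=
  exists p c, plane_embedding p c /\
    exists F, [/\ face (drawing p c) F, ~ bounded_set F
                & forall v, closure F (p v)].

End Outerplanar.

Record simplicial_complex (T : finType) := SimplicialComplex {
  faces :> {set {set T}};
  facesS : forall s t : {set T}, s \subset t -> t \in faces -> s \in faces
}.

(* Barycentric coordinates. The empty set may or may not be listed among the
   faces, but it is never the support of a point since the coordinates sum
   to 1. The topology is that of pointwise convergence, which for finite [T]
   is the Euclidean one. *)
Definition realization_set (R : realType) (T : finType)
    (K : simplicial_complex T) : set {ptws T -> R} :=
  [set x | [/\ forall t, 0 <= x t, \sum_t x t = 1
             & [set t | x t != 0]%SET \in faces K]].
Arguments realization_set R {T} K.

Definition realization (R : realType) (T : finType) (K : simplicial_complex T)
    : topologicalType :=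
  set_type (realization_set R K).
Arguments realization R {T} K.

Definition matching (G : sgraph) (M : {set edge G}) : bool :=
  [forall e in M, forall f in M, (e != f) ==> [disjoint val e & val f]].

Lemma matchingS (G : sgraph) (M N : {set edge G}) :
  M \subset N -> N \in [set M | matching M]%SET -> M \in [set M | matching M]%SET.
Proof.
move=> /fintype.subsetP MN; rewrite !finset.inE => /forall_inP mN.
apply/forall_inP => e /MN/mN/forall_inP eN.
by apply/forall_inP => f /MN; exact: eN.
Qed.

Definition matching_complex (G : sgraph) : simplicial_complex (edge G) :=
  SimplicialComplex (@matchingS G).

Section Homotopy.
Variable R : realType.

Definition homotopic (X Y : topologicalType) (f g : X -> Y) : Prop :=
  exists H : X * R -> Y,
    [/\ {within setT `*` `[0, 1], continuous H},
        forall x, H (x, 0) = f x & forall x, H (x, 1) = g x].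

Definition homotopy_equivalent (X Y : topologicalType) : Prop :=
  exists (f : X -> Y) (g : Y -> X),
    [/\ continuous f, continuous g,
        homotopic (g \o f) id & homotopic (f \o g) id].

Definition contractible (X : topologicalType) : Prop :=
  exists x0 : X, homotopic id (fun=> x0).

Definition sphere (n : nat) : set 'rV[R]_n.+1 :=
  [set x | \sum_i x 0 i ^+ 2 = 1].
Arguments sphere : clear implicits.

Lemma sphere_base_subproof n : delta_mx 0 0 \in sphere n.
Proof.
rewrite inE /sphere /= (bigD1 ord0) //= mxE !eqxx expr1n big1 ?addr0// => i i0.
by rewrite mxE (negPf i0) andbF expr0n.
Qed.

Definition sphere_base n : sphere n := SigSub (sphere_base_subproof n).

(* Finitely many spheres, at least one: the empty wedge would be a point. *)
Definition wedge_of_spheres (k : nat) (d : 'I_k.+1 -> nat) : topologicalType :=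
  wedge (fun i => sphere_base (d i)).

End Homotopy.

(* Main.v *)
Require Import Defs.
From mathcomp Require Import all_boot.

(** Outerplanarity is used only through the absence of K4 and K23 minors: such a
    minor, joined through the outer face to an extra vertex, would draw K5 or K33
    in the plane with compact connected sets as edges, against a mod 2 crossing
    argument.

    A graph without these minors falls into one of a few cases. Some edge meets
    all the others, and is then an isolated vertex of the matching complex; or the
    neighbourhoods of two edges are nested, and one of the edges can be deleted,
    up to attaching a suspension; or there is a path with three inner vertices of
    degree 2, and the complex is the suspension of one obtained from a smaller
    graph. By induction the complex reduces to a wedge of spheres, a point
    being the empty wedge. *)

Set Implicit Arguments.
Unset Strict Implicit.
Unset Printing Implicit Defensive.

(** * Flag complexes up to elementary reductions *)

(** Excluding minors, rather than keeping a drawing, gives a class closed under deletion and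
    contraction: the smaller graph of the path case may arise by contracting edges, and nothing has
    to be redrawn. The Jordan curve theorem is avoided as well. Branch sets and accesses through the
    outer face are merely compact connected sets, so they are replaced by chains of points with
    short steps, and what is used of the plane is how such chains cross horizontal rays modulo 2.

    On the side of topology, homotopy equivalence is replaced until the end by a relation on finite
    flag complexes generated by elementary moves. Suspensions and wedges respect it by induction on
    the moves, without quotient spaces or homotopy extension. The delicate point is the base point:
    a wedge depends on the components that carry the base points, and a complex of matchings may be
    disconnected. Hence the care about connectedness, the separate treatment of an edge that meets
    all others, and the positive dimensions required of the spheres that are attached. *)

(* A flag complex: the vertices are the [x] with [crel x x], the faces are the
   cliques. *)
Record cpx := Cpx { cvert :> finType; crel : rel cvert; crel_sym : symmetric crel }.
Arguments crel {c} : rename.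

(* A removed edge [u v] retracts towards its apex [a], which is joined to the
   whole link of that edge. *)
Definition shrinks (T : finType) (c c' : rel T) :=
  subrel c' c /\ forall u v, c u v -> ~~ c' u v ->
    exists a, [/\ c' a a, c' a u, c' a v
                & forall y, c y y -> c u y -> c v y -> c' a y].

(** A shrink with [u = v] removes a vertex, so folding a dominated vertex is included. A point
    without a loop lies in no face: [heq_emb] may miss such points of [Y], and [heq_same] lets the
    relation change there. One carrier type can thus serve for many complexes. *)
Inductive heq : cpx -> cpx -> Prop :=
| heq_emb (X Y : cpx) (f : X -> Y) :
    injective f -> (forall x y, crel (f x) (f y) = crel x y) ->
    (forall u : Y, crel u u -> exists x, u = f x) -> heq X Y
| heq_shrink (T : finType) (c c' : rel T) (cs : symmetric c) (cs' : symmetric c') :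
    shrinks c c' -> heq (Cpx cs) (Cpx cs')
| heq_same (T : finType) (c c' : rel T) (cs : symmetric c) (cs' : symmetric c') :
    (forall x, c x x = c' x x) -> (forall x y, c x x -> c y y -> c x y = c' x y) ->
    heq (Cpx cs) (Cpx cs')
| heq_sym X Y : heq X Y -> heq Y X
| heq_trans X Y Z : heq X Y -> heq Y Z -> heq X Z.

Lemma heq_refl X : heq X X.
Proof. by apply: (@heq_emb X X id) => // u _; exists u. Qed.

Lemma heq_eqrel (T : finType) (c c' : rel T) (cs : symmetric c) (cs' : symmetric c') :
  c =2 c' -> heq (Cpx cs) (Cpx cs').
Proof.
by move=> cc'; apply: (@heq_emb (Cpx cs) (Cpx cs') id) => //= u _; exists u.
Qed.

Lemma heq_shrinks (X : cpx) (r : rel X) (rs : symmetric r) :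
  shrinks (@crel X) r -> heq X (Cpx rs).
Proof. by case: X r rs => T c cs r rs; exact: heq_shrink. Qed.

(** * Suspension and addition of an isolated point *)

Section Ext.
Variables (U : finType) (r : rel U) (A : pred U).
Hypothesis rs : symmetric r.

Definition ext_rel (T : finType) (c : rel T) : rel (T + U) := fun p q =>
  match p, q with
  | inl x, inl y => c x y
  | inr u, inr v => r u v
  | inl _, inr u | inr u, inl _ => A u
  end.

Lemma ext_sym (T : finType) (c : rel T) : symmetric c -> symmetric (ext_rel c).
Proof. by move=> cs [x|u] [y|v] //=. Qed.

Definition ext (X : cpx) := Cpx (ext_sym (@crel_sym X)).

(** The points of [U] see all points of the base alike, so the apex of a removed edge of the base is
    also joined to every point of [U] in the link of that edge: it remains an apex. *)
Lemma ext_heq X Y : heq X Y -> heq (ext X) (ext Y).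
Proof.
elim=> {X Y} [X Y f fI fc fs|T c c' cs cs' [cc' H]|T c c' cs cs' E1 E2|X Y _ IH|X Y Z _ IH1 _ IH2].
- apply: (@heq_emb (ext X) (ext Y)
    (fun p => match p with inl x => inl (f x) | inr u => inr u end)).
  + by move=> [x|u] [y|v] //= [] => [/fI ->|->].
  + by move=> [x|u] [y|v] //=.
  + by move=> [y /= /fs[x ->]|u _]; [exists (inl x)|exists (inr u)].
- apply: heq_shrink; split=> [[x|u] [y|v] //=|]; first exact: cc'.
  move=> [x|u] [y|v] /=; last 3 first; try by move=> ->.
  move=> cxy /(H _ _ cxy)[a [aa ax ay Ha]]; exists (inl a).
  by split=> // -[z|w] //=; exact: Ha.
- by apply: heq_same => [[x|u]|[x|u] [y|v]] //=; exact: E2.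
- exact: heq_sym.
- exact: heq_trans IH1 IH2.
Qed.
End Ext.

Lemma bool_eq_sym : symmetric (fun b b' : bool => b == b').
Proof. by move=> b b'; rewrite eq_sym. Qed.
Definition susp := ext predT bool_eq_sym.
Lemma unit_sym : symmetric (fun _ _ : unit => true). Proof. by []. Qed.
Definition addpt := ext (@pred0 unit) unit_sym.

(** * Wedges and the choice of their base points *)

Section Join.
Variables (X : cpx) (e : X) (Y : cpx) (f : Y).

(* Not the simplicial link: the disjoint union of [X] and [Y] with an extra edge
   from [e] to [f]; a wedge when [X] and [Y] are connected. *)
Definition link_rel : rel (X + Y) := fun p q =>
  match p, q with
  | inl x, inl y => crel x y
  | inr u, inr v => crel u v
  | inl x, inr u | inr u, inl x => (x == e) && (u == f)
  end.

Lemma link_sym : symmetric link_rel.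
Proof. by move=> [x|u] [y|v] //=; rewrite crel_sym. Qed.

Definition link := Cpx link_sym.
End Join.
Arguments link : clear implicits.

Lemma linkC (X : cpx) e (Y : cpx) f : heq (link X e Y f) (link Y f X e).
Proof.
apply: (@heq_emb (link X e Y f) (link Y f X e)
  (fun p => match p with inl x => inr x | inr x => inl x end)).
- by move=> [x|x] [y|y] // [->].
- by move=> [x|u] [y|v] //=; rewrite andbC.
- by move=> [y|u] _; [exists (inr y)|exists (inl u)].
Qed.

Lemma link_emb (X Y : cpx) (g : X -> Y) (e : X) (Z : cpx) (f : Z) :
  injective g -> (forall x y, crel (g x) (g y) = crel x y) ->
  (forall u : Y, crel u u -> exists x, u = g x) ->
  heq (link X e Z f) (link Y (g e) Z f).
Proof.
move=> gI gc gs.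
apply: (@heq_emb (link X e Z f) (link Y (g e) Z f)
  (fun p => match p with inl x => inl (g x) | inr u => inr u end)).
- by move=> [x|u] [y|v] //= [] => [/gI ->|->].
- by move=> [x|u] [y|v] //=; rewrite (inj_eq gI).
- by move=> [y /= /gs[x ->]|u _]; [exists (inl x)|exists (inr u)].
Qed.

(** Fill in the triangle [e e' f]: of its two sides at [f], each can be removed with the other end
    of the third side as apex. *)
Lemma link_move (X : cpx) (e e' : X) (Y : cpx) (f : Y) : crel e e -> crel e' e' -> crel f f -> crel e e' ->
  heq (link X e Y f) (link X e' Y f).
Proof.
move=> ee e'e' ff ee'; pose both : rel (X + Y) := fun p q =>
  match p, q with
  | inl x, inl y => crel x y
  | inr u, inr v => crel u v
  | inl x, inr u | inr u, inl x => ((x == e) || (x == e')) && (u == f)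
  end.
have bs : symmetric both by move=> [x|u] [y|v] //=; rewrite crel_sym.
have main e1 e2 : crel e1 e1 -> crel e2 e2 -> crel e1 e2 ->
  (forall x, (x == e) || (x == e') = (x == e1) || (x == e2)) ->
  heq (Cpx bs) (link X e1 Y f).
  move=> e11 e22 e12 E; apply: heq_shrink; split.
    move=> [x|u] [y|v] //=; rewrite ?E => /andP[/eqP -> ->]; by rewrite ?eqxx.
  have cl x v : both (inl x) (inr v) -> ~~ link_rel e1 f (inl x) (inr v) ->
      x = e2 /\ v = f.
    rewrite /= E => /andP[xe /eqP->]; rewrite eqxx andbT => /negPf xe1.
    by move: xe; rewrite xe1 /= => /eqP.
  move=> u v cuv nuv; exists (inl e1).
  case: u v cuv nuv => [x|x] [y|v] //=; try by move=> ->.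
    move=> H1 H2; have [-> ->] := cl _ _ H1 H2; rewrite !eqxx; split=> //.
    move=> [z|w] /=; rewrite ?eqxx ?andbT ?E.
      by move=> zz _ /orP[]/eqP-> //.
    by rewrite eqxx orbT /= => _ /eqP ->.
  move=> H1 H2; have [-> ->] := cl _ _ H1 H2; rewrite !eqxx; split=> //.
  move=> [z|w] /=; rewrite ?eqxx ?andbT ?E.
    by move=> zz /orP[]/eqP-> //.
  by rewrite eqxx orbT /= => _ _ /eqP ->.
apply: (heq_trans (Y := Cpx bs)).
  by apply: heq_sym; apply: (main e e').
by apply: (main e' e) => //; [rewrite crel_sym|move=> x; rewrite orbC].
Qed.

Lemma link_heq (X Y Z : cpx) (f : Z) : heq X Y -> crel f f ->
  (forall e, crel e e -> exists2 e', crel e' e' & heq (link X e Z f) (link Y e' Z f)) /\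
  (forall e', crel e' e' -> exists2 e, crel e e & heq (link X e Z f) (link Y e' Z f)).
Proof.
move=> h ff; elim: h => {X Y} [X Y g gI gc gs|T c c' cs cs' [cc' H]|T c c' cs cs' E1 E2|X Y _ [IH1 IH2]|X Y W _ [IH1 IH1'] _ [IH2 IH2']].
- have E e : heq (link X e Z f) (link Y (g e) Z f) by exact: link_emb.
  split=> [e ee|e' e'e']; first by exists (g e) => //; rewrite gc.
  by have [e ee] := gs _ e'e'; exists e; rewrite -1?gc -?ee // ee.
- have main (e : T) : c' e e -> heq (link (Cpx cs) e Z f) (link (Cpx cs') e Z f).
    move=> ee; apply: heq_shrink; split.
      by move=> [x|u] [y|v] //=; apply: cc'.
    move=> [x|u] [y|v] /=; last 3 first; try by move=> ->.
    move=> cxy /[dup] c'xy /(H _ _ cxy)[a [aa ax ay Ha]]; exists (inl a).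
    split=> // -[z|w] //=; first exact: Ha.
    move=> _ /andP[/eqP Ex _] /andP[/eqP Ey _].
    by move: c'xy; rewrite Ex Ey ee.
  split=> e ee; last first.
    by exists e; [exact: cc'|exact: main].
  have [|nee] := boolP (c' e e); first by exists e => //; exact: main.
  have [a [aa ae _ Ha]] := H _ _ ee nee.
  exists a => //; apply: heq_trans (main _ aa).
  by apply: link_move => //=; [apply: cc'|rewrite cs; exact: cc'].
- have E (e : T) : heq (link (Cpx cs) e Z f) (link (Cpx cs') e Z f).
    by apply: heq_same => [[x|u]|[x|u] [y|v]] //=; exact: E2.
  by split=> e /= ee; exists e => //=; [rewrite -E1|rewrite E1].
- by split=> e ee; [have [e' ? ?] := IH2 _ ee|have [e' ? ?] := IH1 _ ee];
    exists e' => //; apply: heq_sym.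
- split=> e ee.
    have [e' e'e' h1] := IH1 _ ee; have [e2 ? h2] := IH2 _ e'e'.
    by exists e2 => //; exact: heq_trans h1 h2.
  have [e' e'e' h1] := IH2' _ ee; have [e2 ? h2] := IH1' _ e'e'.
  by exists e2 => //; exact: heq_trans h2 h1.
Qed.

Definition edge_in (X : cpx) : rel X := fun x y => [&& crel x x, crel y y & crel x y].
Arguments edge_in : clear implicits.

Definition conn (X : cpx) := forall x y : X,
  crel x x -> crel y y -> connect (edge_in X) x y.

Lemma edge_in_sym X : symmetric (edge_in X).
Proof. by move=> x y; rewrite /edge_in crel_sym andbCA. Qed.

Lemma heq_edge_in X : heq X (Cpx (@edge_in_sym X)).
Proof.
case: X => T c cs; apply: heq_same => [x|x y xx yy]; rewrite /edge_in /=.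
  by rewrite !andbb.
by rewrite xx yy.
Qed.

Lemma heq_emb_vertex (X Y : cpx) (g : X -> Y) :
  injective g -> (forall x, crel (g x) (g x) = crel x x) ->
  (forall x y, crel x x -> crel y y -> crel (g x) (g y) = crel x y) ->
  (forall u : Y, crel u u -> exists x, u = g x) -> heq X Y.
Proof.
move=> gI g1 g2 gs; apply: heq_trans (heq_edge_in X) _.
apply: heq_trans (heq_sym (heq_edge_in Y)).
apply: (@heq_emb (Cpx (@edge_in_sym X)) (Cpx (@edge_in_sym Y)) g) => //.
  move=> /= x y; rewrite /edge_in !g1; move: x y => /= x y.
  by have [xx|//] := boolP (crel (c := X) x x); have [yy|//] := boolP (crel (c := X) y y); rewrite /= g2.
by move=> u /and3P[/gs].
Qed.

Lemma conn_root (X : cpx) (r : X) :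
  (forall x : X, crel x x -> connect (edge_in X) x r) -> conn X.
Proof.
move=> H x y xx yy; apply: connect_trans (H _ xx) _.
by rewrite (sym_connect_sym (@edge_in_sym X)); exact: H.
Qed.

Lemma connect_map (T T' : finType) (r : rel T) (r' : rel T') (g : T -> T') :
  (forall x y, r x y -> connect r' (g x) (g y)) ->
  forall x y, connect r x y -> connect r' (g x) (g y).
Proof.
move=> H x y /connectP[p + ->]; elim: p x => [|z p IH] x //= /andP[/H xz pz].
exact: connect_trans xz (IH _ pz).
Qed.

Lemma conn_link (X : cpx) (e : X) (Y : cpx) (f : Y) :
  conn X -> conn Y -> crel e e -> crel f f -> conn (link X e Y f).
Proof.
move=> cX cY ee ff; apply: (@conn_root (link X e Y f) (inl e)) => -[x|y] /= xx.
  apply: (@connect_map _ _ (edge_in X) _ inl); last exact: cX.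
  by move=> {xx}x y xy; apply: connect1.
apply: (connect_trans (y := (inr f : link X e Y f))).
  apply: (@connect_map _ _ (edge_in Y) _ inr); last exact: cY.
  by move=> {xx}x z xy; apply: connect1.
by apply: connect1; rewrite /edge_in /= ee ff !eqxx.
Qed.

Lemma conn_susp (X : cpx) (x : X) : crel x x -> conn (susp X).
Proof.
move=> xx.
have px b : connect (edge_in (susp X)) (inr b) (inl x).
  by apply: connect1; rewrite /edge_in /= eqxx xx.
apply: (@conn_root (susp X) (inl x)) => -[y|b] // yy.
apply: connect_trans (px true); apply: connect1.
by move: yy; rewrite /edge_in /= => ->.
Qed.

(** The consequence of connectedness that is actually needed, in a form that [link_heq] transports
    along [heq] directly. *)
Definition homog (X : cpx) := forall (Z : cpx) (f : Z), crel f f ->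
  forall e e' : X, crel e e -> crel e' e' -> heq (link X e Z f) (link X e' Z f).

Lemma conn_homog X : conn X -> homog X.
Proof.
move=> cX Z f ff e e' ee e'e'; have /connectP[p + ->] := cX _ _ ee e'e'.
elim: p e {ee} => [|x p IH] e /=; first by move=> _; exact: heq_refl.
case/andP=> /and3P[ee xx ex] /IH h.
by apply: heq_trans h; exact: link_move.
Qed.

Lemma homog_heq X Y : heq X Y -> homog X -> homog Y.
Proof.
move=> h hX Z f ff e e' ee e'e'; have [_ H] := link_heq h ff.
have [x xx hx] := H _ ee; have [x' xx' hx'] := H _ e'e'.
exact: heq_trans (heq_sym hx) (heq_trans (hX _ _ ff _ _ xx xx') hx').
Qed.

Lemma link_assoc (X Y Z : cpx) (e : X) (h h' : Y) (z : Z) :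
  heq (link X e (link Y h Z z) (inl h')) (link (link X e Y h') (inr h) Z z).
Proof.
apply: (@heq_emb (link X e (link Y h Z z) (inl h')) (link (link X e Y h') (inr h) Z z)
  (fun p => match p with inl x => inl (inl x) | inr (inl y) => inl (inr y)
     | inr (inr z) => inr z end)).
- by move=> [x|[x|x]] [y|[y|y]] //= [->].
- by move=> [x|[x|x]] [y|[y|y]] //=; rewrite !andbF.
- by move=> [[x|x]|x] _; [exists (inl x)|exists (inr (inl x))|exists (inr (inr x))].
Qed.

Section SuspLink.
Variables (X Y : cpx) (e : X) (f : Y).
Hypotheses (ee : crel e e) (ff : crel f f).

(* [ypole] : are the poles of the first suspension joined to a point of [Y]?
   [pp] : are they joined to the matching poles of the second one? *)
Let R (ypole : pred Y) (pp pole' : bool) : rel ((X + bool) + (Y + bool)) :=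
  fun p q => match p, q with
  | inl x, inl y => crel (c := susp X) x y
  | inr (inl x), inr (inl y) => crel x y
  | inr (inl x), inr (inr y) | inr (inr y), inr (inl x) => true
  | inr (inr x), inr (inr y) => pole' && (x == y)
  | inl (inl x), inr (inl y) | inr (inl y), inl (inl x) => (x == e) && (y == f)
  | inl (inr _), inr (inl y) | inr (inl y), inl (inr _) => ypole y
  | inl (inr b), inr (inr b') | inr (inr b'), inl (inr b) => pp && (b == b')
  | inl (inl _), inr (inr _) | inr (inr _), inl (inl _) => false
  end.

Let Rs yp pp q : symmetric (R yp pp q).
Proof.
by move=> [[x|b]|[y|b']] [[z|b1]|[w|b1']] //=; rewrite 1?crel_sym 1?eq_sym.
Qed.

(** The poles of the second suspension are split off from the common poles, which dominate them. The
    common poles then lose their edges to [Y] outside [f], with the new poles as apexes; next the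
    edges between old and new poles, with apex [f]; finally the edges to [f], with apex [e]. *)
Lemma susp_link : heq (susp (link X e Y f)) (link (susp X) (inl e) (susp Y) (inl f)).
Proof.
pose C yp pp q := Cpx (Rs yp pp q).
apply: (heq_trans (Y := C predT true false)).
  apply: (@heq_emb (susp (link X e Y f)) (C predT true false)
    (fun p => match p with inl (inl x) => inl (inl x) | inl (inr y) => inr (inl y)
      | inr b => inl (inr b) end)).
  - by move=> [[x|x]|x] [[y|y]|y] //= [->].
  - by move=> [[x|x]|x] [[y|y]|y].
  - by move=> [[x|x]|[x|x]] //= _;
      [exists (inl (inl x))|exists (inr x)|exists (inl (inr x))].
apply: (heq_trans (Y := C predT true true)).
  apply: heq_sym; apply: heq_shrink; split.
    by move=> [[x|b]|[y|b']] [[z|b1]|[w|b1']].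
  move=> [[x|b]|[y|b']] [[z|b1]|[w|b1']] //=; try by move=> ->.
  move=> /eqP <-; exists (inl (inr b')); rewrite /= eqxx; split=> //.
  by move=> [[z|b2]|[w|b2']] //= _; rewrite 1?eq_sym.
apply: (heq_trans (Y := C (pred1 f) true true)).
  apply: heq_shrink; split.
    by move=> [[x|b]|[y|b']] [[z|b1]|[w|b1']].
  move=> [[x|b]|[y|b']] [[z|b1]|[w|b1']] //=; try (by move=> ->); move=> _ /negPf nf.
    exists (inr (inr b)); rewrite /= eqxx; split=> //.
    move=> [[z|b2]|[w2|b2']] //= _; rewrite 1?eq_sym //.
    by rewrite nf andbF.
  exists (inr (inr b1)); rewrite /= eqxx; split=> //.
  move=> [[z|b2]|[w2|b2']] //= _; rewrite 1?eq_sym //.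
  by rewrite nf andbF.
apply: (heq_trans (Y := C (pred1 f) false true)).
  apply: heq_shrink; split.
    by move=> [[x|b]|[y|b']] [[z|b1]|[w|b1']].
  move=> [[x|b]|[y|b']] [[z|b1]|[w|b1']] //=; try (by move=> ->); move=> /eqP E _.
    exists (inr (inl f)); rewrite /= !eqxx; split=> //.
    move=> [[z|b2]|[w2|b2']] //= _; rewrite ?eqxx //.
    by move=> /eqP->.
  exists (inr (inl f)); rewrite /= !eqxx; split=> //.
  move=> [[z|b2]|[w2|b2']] //= _; rewrite ?eqxx //.
  by move=> _ /eqP->.
apply: (heq_trans (Y := C pred0 false true)).
  apply: heq_shrink; split.
    by move=> [[x|b]|[y|b']] [[z|b1]|[w|b1']].
  move=> [[x|b]|[y|b']] [[z|b1]|[w|b1']] //=; try (by move=> ->); move=> /eqP E _.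
    exists (inl (inl e)); rewrite /= ?eqxx E ?eqxx; split=> //.
    move=> [[z|b2]|[w2|b2']] //= _; rewrite ?eqxx ?andbT //.
      by move=> _ /eqP->.
  exists (inl (inl e)); rewrite /= ?eqxx E ?eqxx; split=> //.
  move=> [[z|b2]|[w2|b2']] //= _; rewrite ?eqxx ?andbT //.
  by move=> /eqP->.
apply: heq_eqrel.
by move=> [[x|b]|[y|b']] [[z|b1]|[w|b1']] //=; rewrite ?andbF.
Qed.
End SuspLink.

(** The boundary of the cross-polytope of dimension [n.+1], a triangulated [n]-sphere in which only
    antipodes are not adjacent. *)
Definition sph_rel n : rel ('I_n.+1 * bool) := fun p q => (p.1 != q.1) || (p.2 == q.2).
Lemma sph_sym n : symmetric (@sph_rel n).
Proof. by move=> p q; rewrite /sph_rel eq_sym (eq_sym p.2). Qed.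
Definition sph n := Cpx (@sph_sym n).
Definition sph_base n : sph n := (ord0, true).

Lemma sph_vertex n (p : sph n) : crel p p.
Proof. by rewrite /= /sph_rel !eqxx. Qed.

(** The new poles are the last antipodal pair. The equivalence is stated inside a wedge because the
    base point has to be followed as well. *)
Lemma susp_sph n (Z : cpx) (e : Z) :
  heq (link Z e (susp (sph n)) (inl (sph_base n))) (link Z e (sph n.+1) (sph_base n.+1)).
Proof.
pose g (p : susp (sph n)) : sph n.+1 :=
  match p with inl (j, s) => (widen_ord (leqnSn _) j, s) | inr b => (ord_max, b) end.
have gb : g (inl (sph_base n)) = sph_base n.+1 by congr (_, _); apply: val_inj.
apply: heq_trans (linkC _ _) _; apply: heq_trans (linkC _ _).
rewrite -gb; apply: link_emb.
- move=> [[j s]|b] [[j' s']|b'] //= [].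
  + by move=> /val_inj -> ->.
  + by move=> E; have := ltn_ord j; rewrite E ltnn.
  + by move=> E; have := ltn_ord j'; rewrite -E ltnn.
  + by move=> ->.
- move=> [[j s]|b] [[j' s']|b'] //=; rewrite /sph_rel /= -!val_eqE /= ?eqxx //.
  + by rewrite ltn_eqF // ltn_ord.
  + by rewrite gtn_eqF // ltn_ord.
- move=> [j s] _; have [jn|nj] := ltnP j n.+1.
    by exists (inl (Ordinal jn, s)); congr (_, _); apply: val_inj.
  exists (inr s); congr (_, _); apply: val_inj => /=.
  by apply/eqP; rewrite eqn_leq nj -ltnS ltn_ord.
Qed.

(** * A normal form for wedges of spheres *)

Section Flat.
Implicit Types d : seq nat.

(* The boundary of a cross-polytope for each entry of [d], tied by an edge to the
   common hub [None]; [(i, j, s)] is the [j]-th vertex of sign [s], and is not a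
   vertex of the complex when [j > nth 0 d i]. *)
Definition flat_rel d : rel (option ('I_(size d) * 'I_(sumn d).+1 * bool)) :=
  fun p q => match p, q with
  | None, None => true
  | None, Some (_, j, s) | Some (_, j, s), None => (j == 0 :> nat) && s
  | Some (i, j, s), Some (i', j', s') =>
      [&& i == i', j <= nth 0 d i, j' <= nth 0 d i' & (j != j') || (s == s')]
  end.

Lemma flat_sym d : symmetric (@flat_rel d).
Proof.
move=> [[[i j] s]|] [[[i' j'] s']|] //=.
rewrite (eq_sym i) (eq_sym j) (eq_sym s); have [<-|//] := eqVneq i' i.
by rewrite /= andbCA.
Qed.
Definition flat d := Cpx (@flat_sym d).
Definition hub d : flat d := None.

Lemma leq_nth_sumn d i : nth 0 d i <= sumn d.
Proof.
elim: d i => [|n d IH] [|i] //=; first exact: leq_addr.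
exact: leq_trans (IH i) (leq_addl _ _).
Qed.

Lemma flat_rcons_emb d n :
  exists g : link (flat d) (hub d) (sph n) (sph_base n) -> flat (rcons d n),
  [/\ injective g, forall x y, crel (g x) (g y) = crel x y,
      forall u : flat (rcons d n), crel u u -> exists x, u = g x
    & g (inl (hub d)) = hub (rcons d n)].
Proof.
have sz : size d < size (rcons d n) by rewrite size_rcons.
have sl : (sumn d).+1 <= (sumn (rcons d n)).+1 by rewrite sumn_rcons ltnS leq_addr.
have nl : n.+1 <= (sumn (rcons d n)).+1 by rewrite sumn_rcons ltnS leq_addl.
pose g (p : link (flat d) (hub d) (sph n) (sph_base n)) : flat (rcons d n) :=
  match p with
  | inl None => None
  | inl (Some (i, j, s)) => Some (widen_ord (ltnW sz) i, widen_ord sl j, s)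
  | inr (j, s) => Some (Ordinal sz, widen_ord nl j, s)
  end.
have nthl (i : 'I_(size d)) : nth 0 (rcons d n) i = nth 0 d i.
  by rewrite nth_rcons ltn_ord.
have nthr : nth 0 (rcons d n) (size d) = n by rewrite nth_rcons ltnn eqxx.
have W (i : 'I_(size d)) : (i == size d :> nat) = false by rewrite ltn_eqF.
exists g; split=> //.
- move=> [[[[i j] s]|]|[j s]] [[[[i' j'] s']|]|[j' s']] //= [].
  + by move=> /val_inj -> /val_inj -> ->.
  + by move/eqP; rewrite W.
  + by move/esym/eqP; rewrite W.
  + by move=> /val_inj -> ->.
- move=> [[[[i j] s]|]|[j s]] [[[[i' j'] s']|]|[j' s']] //=;
    rewrite -?val_eqE /= ?nthl ?nthr ?(eq_sym (size d)) ?W ?eqxx //=.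
  + by rewrite xpair_eqE -val_eqE /= eqb_id.
  + by rewrite xpair_eqE -val_eqE /= eqb_id.
  + rewrite -ltnS ltn_ord -ltnS ltn_ord /= /sph_rel //.
- move=> [[[i j] s]|] /=; last by exists (inl None).
  rewrite eqxx /= andbA andbb => /andP[jd _].
  have [il|li] := ltnP i (size d).
    have jl : j < (sumn d).+1.
      by move: jd; rewrite nth_rcons il ltnS => /leq_trans-> //; exact: leq_nth_sumn.
    by exists (inl (Some (Ordinal il, Ordinal jl, s))); congr (Some (_, _, _)); apply: val_inj.
  have Ei : i = size d :> nat.
    by apply/eqP; rewrite eqn_leq li -ltnS -(size_rcons d n) ltn_ord.
  have jl : j < n.+1 by move: jd; rewrite Ei nthr.
  by exists (inr (Ordinal jl, s)); congr (Some (_, _, _)); apply: val_inj.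
Qed.

Lemma flat_rcons d n : heq (link (flat d) (hub d) (sph n) (sph_base n)) (flat (rcons d n)).
Proof. by have [g [? ? ? _]] := flat_rcons_emb d n; exact: (@heq_emb _ _ g). Qed.

Lemma link_flat_rcons d n (X : cpx) (e : X) :
  heq (link X e (flat (rcons d n)) (hub (rcons d n)))
      (link X e (link (flat d) (hub d) (sph n) (sph_base n)) (inl (hub d))).
Proof.
have [g [gI gc gs <-]] := flat_rcons_emb d n.
apply: heq_trans (linkC _ _) _; apply: heq_trans (linkC _ _).
by apply: heq_sym; exact: link_emb.
Qed.

Lemma conn_flat d : all (leq 1) d -> conn (flat d).
Proof.
move=> pd; apply: (@conn_root _ (hub d)) => -[[[i j] s]|//] /=.
rewrite eqxx /= andbA andbb => /andP[jd _].
have d1 : 0 < nth 0 d i by apply: (allP pd); rewrite mem_nth.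
have s1 : 1 < (sumn d).+1 by rewrite ltnS; exact: leq_trans d1 (leq_nth_sumn _ _).
pose v j s : flat d := Some (i, j, s).
have h0 : edge_in (flat d) (v ord0 true) (hub d) by rewrite /edge_in /= !eqxx.
have h1 t : edge_in (flat d) (v (Ordinal s1) t) (v ord0 true).
  by rewrite /edge_in /= !eqxx d1.
have [j0|j0] := eqVneq j ord0; last first.
  apply: connect_trans (connect1 h0); apply: connect1.
  by rewrite /edge_in /= !eqxx jd j0.
case: s => /=; first by rewrite j0; exact: connect1.
apply: connect_trans (connect1 h0); apply: connect_trans (connect1 (h1 true)).
by apply: connect1; rewrite /edge_in /= !eqxx jd d1 j0.
Qed.

Lemma link_pt (X : cpx) (e : X) : crel e e -> heq (link X e (flat [::]) (hub [::])) X.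
Proof.
move=> ee; pose r : rel (X + flat [::]) := fun p q => match p, q with
  | inr _, inr _ => false | _, _ => link_rel e (hub [::]) p q end.
have rs : symmetric r by move=> [x|x] [y|y] //=; rewrite crel_sym.
have pt (p : flat [::]) : p = hub [::] by case: p => // -[[[]]].
apply: (heq_trans (Y := Cpx rs)); last first.
  apply: heq_sym; apply: (@heq_emb X (Cpx rs) inl) => // [x y []//|[x|//] _].
  by exists x.
apply: heq_shrink; split=> [[x|x] [y|y] //|].
move=> [x|x] [y|y] /=; try (by move=> ->); move=> _ _.
exists (inl e); rewrite /= (pt x) (pt y) !eqxx; split=> // -[z|z] _ /=.
  by case/andP=> /eqP->.
by rewrite (pt z) !eqxx.
Qed.

(** The spheres of [d] are attached one by one. Positive dimensions keep what has been built
    connected, hence homogeneous; its normal form is then homogeneous too, and the attaching point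
    of the next sphere can be moved to the hub. *)
Lemma link_flat d (X : cpx) d1 (e : X) : all (leq 1) d -> conn X -> heq X (flat d1) ->
  crel e e -> exists d2, heq (link X e (flat d) (hub d)) (flat d2).
Proof.
move=> + cX hX ee; elim/last_ind: d => [_|d n IH].
  by exists d1; apply: heq_trans hX; exact: link_pt.
rewrite all_rcons => /andP[n1 d1'].
have {IH}[d2 IH] := IH d1'.
exists (rcons d2 n); apply: heq_trans (flat_rcons _ _).
apply: heq_trans (link_flat_rcons _ _ _) _; apply: heq_trans (link_assoc _ _ _ _) _.
have cX' : conn (link X e (flat d) (hub d)) by apply: conn_link => //; exact: conn_flat.
have [H _] := link_heq (f := sph_base n) IH (sph_vertex _).
have [//|e' ee' H'] := H (inr (hub d)).
apply: heq_trans H' _; apply: (homog_heq IH) => //; exact: conn_homog.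
Qed.

(** By [susp_link] each sphere is suspended separately. The suspended spheres have positive
    dimension, so the normal form reached so far is connected and the attaching point that
    [link_heq] yields can be brought back to the hub. *)
Lemma susp_flat d : heq (susp (flat d)) (flat (map S d)).
Proof.
elim/last_ind: d => [|d n IH].
  pose r : rel (flat [::] + bool) := fun p q => match p, q with
    | inr _, inr _ => false | _, _ => crel (c := susp (flat [::])) p q end.
  have rs : symmetric r by move=> [x|x] [y|y] //; exact: (crel_sym (c := flat [::])).
  apply: (heq_trans (Y := Cpx rs)); last first.
    apply: heq_sym; apply: (@heq_emb (flat [::]) (Cpx rs) inl) => // [x y []//|[x|//] _].
    by exists x.
  apply: heq_shrink; split=> [[x|x] [y|y] //|].
  move=> [x|x] [y|y] //=; try (by move=> ->); move=> _ _.
  have pt (p : flat [::]) : p = hub [::] by case: p => // -[[[]]].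
  by exists (inl (hub [::])); split=> // -[z|z] _ _ _ //; rewrite (pt z).
rewrite map_rcons; apply: heq_trans (flat_rcons _ _).
apply: heq_trans (ext_heq _ _ (heq_sym (flat_rcons _ _))) _.
apply: heq_trans (susp_link _ _) _ => //; apply: heq_trans (susp_sph _ _) _.
have [H _] := link_heq (f := sph_base n.+1) IH (sph_vertex _).
have [//|e' ee' H'] := H (inl (hub d)).
apply: heq_trans H' _; apply: conn_homog => //.
by apply: conn_flat; apply/allP => _ /mapP[k _ ->].
Qed.
End Flat.

(* The complex without vertices is allowed because its suspension is [S^0]. *)
Definition htype (X : cpx) := (forall x : X, ~~ crel x x) \/ exists d, heq X (flat d).

Lemma htype_heq X Y : heq X Y -> htype X -> htype Y.
Proof.
move=> h [H|[d hd]]; last by right; exists d; exact: heq_trans (heq_sym h) hd.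
left; have : (forall x : X, ~~ crel x x) <-> (forall y : Y, ~~ crel y y); last by case=> F _; exact: F.
elim: h {H} => {X Y} [X Y g gI gc gs|T c c' cs cs' [cc' H]|T c c' cs cs' E1 _|X Y _ [? ?]|X Y Z _ [? ?] _ [? ?]] //; last 1 first.
- by split; auto.
- split=> H; last by move=> x; rewrite -gc; exact: H.
  by move=> y; apply/negP => /[dup] /gs[x ->]; rewrite gc; exact/negP/H.
- split=> E x; first by apply: contra (E x); exact: cc'.
  apply/negP => xx; have [a [aa _ _ _]] := H _ _ xx (E x).
  by move: (E a); rewrite /= aa.
- by split=> H x; move: (H x); rewrite /= E1.
Qed.

Lemma htype_susp X : htype X -> htype (susp X).
Proof.
case=> [H|[d hd]]; right; last first.
  by exists (map S d); apply: heq_trans (susp_flat d); exact: ext_heq.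
exists [:: 0]; apply: heq_trans (flat_rcons [::] 0).
apply: (heq_trans (Y := sph 0)).
  apply: heq_sym; apply: (@heq_emb (sph 0) (susp X) (fun p => inr p.2)).
  - by move=> [i b] [j b'] [->]; rewrite (ord1 i) (ord1 j).
  - by move=> [i b] [j b'] /=; rewrite /sph_rel /= (ord1 i) (ord1 j) eqxx.
  - by move=> [x|b] /=; [rewrite (negPf (H x))|exists (ord0, b)].
apply: heq_sym; apply: heq_trans (linkC _ _) _; apply: link_pt.
exact: sph_vertex.
Qed.

Lemma htype_addpt X : htype X -> htype (addpt X).
Proof.
case=> [H|[d hd]]; right.
  exists [::]; apply: heq_sym; apply: (@heq_emb (flat [::]) (addpt X) (fun=> inr tt)).
  - by move=> [[[[]]]|] // [[[[]]]|].
  - by move=> [[[[]]]|] // [[[[]]]|].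
  - by move=> [x|[]] /=; [rewrite (negPf (H x))|exists (hub [::])].
exists (rcons d 0); apply: heq_trans (flat_rcons d 0).
apply: heq_trans (ext_heq _ _ hd) _.
(* the spoke from the hub to the first point of the new [S^0] retracts *)
pose r : rel (flat d + sph 0) := fun p q => match p, q with
  | inl _, inl _ => link_rel (hub d) (sph_base 0) p q
  | inr u, inr v => ~~ u.2 && ~~ v.2
  | _, _ => link_rel (hub d) (sph_base 0) p q end.
have sE (u : sph 0) : u = (ord0, u.2) by case: u => i b; rewrite (ord1 i).
have rs : symmetric r by move=> [x|x] [y|y] //=; [exact: (@crel_sym (flat d))|rewrite andbC].
apply: (heq_trans (Y := Cpx rs)).
  apply: (@heq_emb (addpt (flat d)) (Cpx rs)
    (fun p => match p with inl x => inl x | inr _ => inr (ord0, false) end)).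
  - by move=> [x|[]] [y|[]] // [->].
  - by move=> [x|[]] [y|[]] //=; rewrite andbF.
  - move=> [x|u] /=; first by exists (inl x).
    by rewrite andbb => u2; exists (inr tt); rewrite (sE u) (negPf u2).
apply: heq_sym; apply: heq_shrink; split.
  move=> [x|x] [y|y] //=; rewrite /sph_rel => /andP[/negPf-> /negPf->].
  by rewrite orbT.
move=> [x|x] [y|y] /=; try (by move=> ->).
rewrite (sE x) (sE y) /sph_rel /= => /eqP->; rewrite andbb negbK => ->.
exists (inl (hub d)); rewrite /= !eqxx; split=> // -[z|z] _ /=.
  by case/andP=> /eqP->.
by rewrite (sE z) /= /sph_rel /= => /eqP<-; rewrite eqxx.
Qed.

Lemma htype_link (X Y : cpx) (e : X) (f : Y) d : conn X -> htype X -> crel e e -> crel f f ->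
  heq Y (flat d) -> all (leq 1) d -> htype (link X e Y f).
Proof.
move=> cX [/(_ e)/negP//|[d1 hX]] ee ff hY pd; right.
have [d2 h2] := link_flat pd cX hX ee; exists d2; apply: heq_trans h2.
apply: heq_trans (linkC _ _) _; apply: heq_trans (linkC _ _).
have [H _] := link_heq hY ee.
have [f' ff' h] := H _ ff; apply: heq_trans h _.
by apply: conn_homog => //; exact: conn_flat.
Qed.

Definition restr_rel (T : finType) (c : rel T) (A : pred T) : rel T :=
  fun x y => [&& A x, A y & c x y].
Lemma restr_sym (T : finType) (c : rel T) A : symmetric c -> symmetric (restr_rel c A).
Proof. by move=> cs x y; rewrite /restr_rel cs andbCA. Qed.
Definition restr (X : cpx) (A : pred X) := Cpx (@restr_sym _ _ A (@crel_sym X)).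

Lemma heq_delete (X : cpx) (e f : X) : e != f -> crel e e -> crel e f ->
  (forall y, crel y y -> crel f y -> crel e y) -> heq X (restr (predC1 f)).
Proof.
case: X e f => T c cs /= e f nef ee ef H.
pose r : rel T := fun x y => c x y && ~~ ((x == f) && (y == f)).
have rs : symmetric r by move=> x y; rewrite /r cs andbC (andbC (x == f)) andbC.
apply: (heq_trans (Y := Cpx rs)).
  apply: heq_shrink; split=> [x y /andP[]//|u v uv]; rewrite /r uv /= negbK.
  case/andP=> /eqP-> /eqP->; exists e; rewrite ee ef (negPf nef); split=> // y yy fy _.
  by rewrite (H _ yy fy).
apply: heq_same => [x|x y]; rewrite /r /restr_rel /=.
  by case: (x == f); rewrite /= andbC ?andbT.
by case: (x == f) => /=; rewrite ?andbF //; case: (y == f); rewrite /= ?andbF ?andbT.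
Qed.

(** * Vertices whose link lies in the link of a non-neighbour *)

Section Dominated.
Variables (X : cpx) (e f : X).
Hypotheses (ee : crel e e) (ff : crel f f) (nef : ~~ crel e f).
Hypothesis fe : forall y, crel y y -> crel f y -> y != f -> crel e y.

Let L : pred X := fun y => [&& y != f, crel y y & crel f y].

(* A copy of the link [L] of [f] and two poles are adjoined to [X] without [f].
   The flags tell whether the copies and the pole [true] are vertices, and whether
   the pole [false] is joined to [L], the copies to [L], and [e] to the copies. *)
Let Q (vl vp fL xl eL : bool) : rel (X + (X + bool)) := fun p q => match p, q with
  | inl x, inl y => [&& x != f, y != f & crel x y]
  | inr (inl l), inr (inl m) => [&& L l, L m, crel l m & vl || (l != m)]
  | inr (inr b), inr (inr b') => (b == b') && (vp || ~~ b)
  | inl x, inr (inr b) | inr (inr b), inl x => if b then x == e else fL && L x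
  | inr (inl _), inr (inr _) | inr (inr _), inr (inl _) => true
  | inl x, inr (inl l) | inr (inl l), inl x =>
      L l && (eL && (x == e) || [&& xl, L x & crel l x])
  end.

Let Qs a b c d g : symmetric (Q a b c d g).
Proof.
move=> [x|[x|x]] [y|[y|y]] //=.
- by rewrite crel_sym; case: (x == f); case: (y == f).
- by rewrite crel_sym (eq_sym x); case: (L x); case: (L y).
- by rewrite (eq_sym x); case: eqP => // ->.
Qed.

Let ef : e != f. Proof. by apply: contra nef => /eqP->. Qed.
Let Le : L e = false. Proof. by rewrite /L crel_sym (negPf nef) !andbF. Qed.
Let LP x : L x -> [/\ x != f, crel x x, crel e x & crel f x].
Proof. by case/and3P=> xf xx fx; split=> //; exact: fe. Qed.

(** Attaching [f] means attaching a cone over its link [L], which already bounds a cone with apex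
    [e]; hence a wedge with the suspension of [L]. In terms of moves: the copies of [L] are added,
    each dominated by its original, then the pole [true], dominated by [e]. The vertex [f], now the
    pole [false], is detached from [L] with the copies as apexes; the copies are detached from [L]
    with apex [e], and from [e] with apex the pole [true]. Only the edge from [e] to that pole is
    left between the two parts. *)
Lemma heq_dominated :
  heq X (link (restr (predC1 f)) e (susp (restr L)) (inr true)).
Proof.
pose C a b c d g := Cpx (Qs a b c d g).
apply: (heq_trans (Y := C false false true true true)).
  apply: (@heq_emb_vertex X (C false false true true true)
    (fun x => if x == f then inr (inr false) else inl x)).
  - move=> x y; case: eqP => [->|_]; case: eqP => [->|_] //.
    by case.
  - move=> x; case: (eqVneq x f) => [->|xf]; by rewrite /= ?ff ?xf.
  - move=> x y xx yy; case: (eqVneq x f) => [->|xf]; case: (eqVneq y f) => [->|yf] //=.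
    + by rewrite /L yf yy.
    + by rewrite /L xf xx crel_sym.
    + by rewrite xf yf.
  - move=> [x|[x|x]] /=.
    + by case/and3P=> xf _ _; exists x; rewrite (negPf xf).
    + by rewrite eqxx !andbF.
    + by case: x => // _; exists f; rewrite eqxx.
apply: (heq_trans (Y := C true false true true true)).
  apply: heq_sym; apply: heq_shrink; split.
    move=> [x|[x|x]] [y|[y|y]] //=.
    by move=> /and4P[-> -> -> _].
  move=> [x|[x|x]] [y|[y|y]] //=; try (by move=> ->).
  case/and4P=> Lx Ly xy _; rewrite Lx Ly xy /= negbK => /eqP ?; subst y.
  have [xf xx ex fx] := LP Lx; exists (inl x); rewrite /= xf xx Lx /= orbT; split=> //.
  move=> [z|[z|z]] //=; rewrite ?Lx /=.
  - case/and3P => zf _ zz /orP[/eqP->|/andP[Lz xz]] _.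
      by rewrite ef crel_sym ex.
    by rewrite zf.
  - by case/and4P=> -> _ _ _ /= /andP[xz _] _; rewrite crel_sym xz orbT.
  - by case: z.
apply: (heq_trans (Y := C true true true true true)).
  apply: heq_sym; apply: heq_shrink; split.
    move=> [x|[x|x]] [y|[y|y]] //=.
    by move=> /andP[-> _].
  move=> [x|[x|x]] [y|[y|y]] //=; try (by move=> ->).
  rewrite andbT => /eqP <-; rewrite eqxx /= negbK => ->.
  exists (inl e); rewrite /= ef ee eqxx; split=> // -[z|[z|z]] //=.
  - by move=> _ /eqP->; rewrite ef ee.
  - by case/and4P=> -> _ _ _; rewrite ?eqxx.
  - by move=> _ /andP[/eqP <-].
apply: (heq_trans (Y := C true true false true true)).
  apply: heq_shrink; split.
    move=> [x|[x|x]] [y|[y|y]] //=; by case: x || case: y.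
  have H x : L x -> exists a, [/\ Q true true false true true a a,
     Q true true false true true a (inl x), Q true true false true true a (inr (inr false))
     & forall y, Q true true true true true y y -> Q true true true true true (inl x) y ->
       Q true true true true true (inr (inr false)) y -> Q true true false true true a y].
    move=> Lx; have [xf xx ex fx] := LP Lx.
    exists (inr (inl x)); rewrite /= Lx xx orbT /=; split=> //.
    move=> [z|[z|[]]] //=; rewrite ?Lx /=.
      by move=> _ /and3P[_ zf xz] ->; rewrite xz orbT.
    case/and4P=> Lz _ _ _; rewrite Lz /= => /orP[/eqP E|zx].
      by move: Le; rewrite -E Lx.
    by rewrite crel_sym zx.
  move=> [x|[x|x]] [y|[y|y]] //=; try (by move=> ->).
    case: y => [->//|/= Lx _]; have [a [? ? ? ?]] := H _ Lx.
    by exists a; split.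
  case: x => [->//|/= Lx _]; have [a [? ? ? Ha]] := H _ Lx.
  by exists a; split=> // z zz z1 z2; exact: Ha.
apply: (heq_trans (Y := C true true false false true)).
  apply: heq_shrink; split.
    by move=> [x|[x|x]] [y|[y|y]] //=; rewrite ?orbF => /andP[-> ->].
  pose c := Q true true false true true; pose c' := Q true true false false true.
  have H x l : L l -> L x -> exists a, [/\ c' a a,
     c' a (inl x), c' a (inr (inl l))
     & forall y, c y y -> c (inl x) y -> c (inr (inl l)) y -> c' a y].
    move=> Ll Lx; have [xf xx ex fx] := LP Lx.
    exists (inl e); rewrite /c /c' /= ef ee xf ex Ll eqxx; split=> //.
    move=> [z|[z|[]]] //=.
    - move=> /and3P[zf _ _] _ /orP[/eqP->|/andP[/LP[_ _ ez _] _]].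
        by rewrite ef ee.
      by rewrite zf ez.
    - by case/and4P=> -> _ _ _; rewrite ?eqxx.
  move=> [x|[x|x]] [y|[y|y]] //=; try (by move=> ->).
    case/andP=> Ly /orP[/eqP->|/andP[Lx _] _]; first by rewrite Ly eqxx.
    exact: H.
  case/andP=> Ly /orP[/eqP->|/andP[Lx _] _]; first by rewrite Ly eqxx.
  have [a [? ? ? Ha]] := H _ _ Ly Lx.
  by exists a; split=> // z zz z1 z2; exact: Ha.
apply: (heq_trans (Y := C true true false false false)).
  apply: heq_shrink; split.
    by move=> [x|[x|x]] [y|[y|y]] //=; rewrite andbF.
  move=> [x|[x|x]] [y|[y|y]] //=; try (by move=> ->);
    rewrite orbF => /andP[Ly /eqP->] _.
    exists (inr (inr true)); rewrite /= eqxx; split=> // -[z|[z|[]]] //=.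
    by rewrite orbF => _ _ /andP[].
  exists (inr (inr true)); rewrite /= eqxx; split=> // -[z|[z|[]]] //=.
  by rewrite orbF => _ /andP[].
apply: heq_eqrel.
move=> [x|[x|x]] [y|[y|[]]] //=; rewrite ?andbF ?andbT //=.
by case: x; rewrite ?eqxx ?andbT ?andbF.
Qed.
End Dominated.

(** * Four consecutive edges of a path, seen in the complex *)

Section Path.
Variables (X : cpx) (e1 e2 e3 e4 : X).
Hypothesis vertexX : forall x y : X, crel x y -> crel x x.
Hypotheses (v1 : crel e1 e1) (v2 : crel e2 e2) (v3 : crel e3 e3) (v4 : crel e4 e4).
Hypotheses (n12 : ~~ crel e1 e2) (n23 : ~~ crel e2 e3) (n34 : ~~ crel e3 e4).
Hypothesis c14 : crel e1 e4.
Hypothesis c2 : forall y, crel y y -> y != e1 -> y != e3 -> crel e2 y.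
Hypothesis c3 : forall y, crel y y -> y != e2 -> y != e4 -> crel e3 y.

(** Here [e1] stands for the merger of [e1] and [e4], joined to whatever both are joined to. In a
    matching complex this is the edge that remains when the inner vertices of the path are
    contracted. *)
Definition contract_rel : rel X := fun x y =>
  [&& x \notin [:: e2; e3; e4], y \notin [:: e2; e3; e4], crel x y,
      (x == e1) ==> crel e4 y & (y == e1) ==> crel e4 x].

Lemma contract_sym : symmetric contract_rel.
Proof.
move=> x y; rewrite /contract_rel crel_sym.
by case: (_ \notin _); case: (_ \notin _); rewrite //=; case: crel; rewrite //= andbC.
Qed.

Hypothesis e_uniq : uniq [:: e1; e2; e3; e4].

(** Once [e4] is gone, [e2] and [e3] are joined to all other vertices but not to each other: they
    are the two poles. *)
Lemma heq_path : heq X (susp (Cpx contract_sym)).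
Proof.
have vr x y : crel (c := X) x y -> crel y y by rewrite crel_sym; exact: vertexX.
move: e_uniq; rewrite /= !inE !negb_or andbT.
case/and3P=> /and3P[n12' n13 n14] /andP[n23' n24] n34'.
pose r1 : rel X := fun x y => [&& crel x y,
  (x == e1) ==> (y == e3) || crel e4 y & (y == e1) ==> (x == e3) || crel e4 x].
have s1 : symmetric r1 by move=> x y; rewrite /r1 crel_sym; congr andb; rewrite andbC.
pose r2 : rel X := fun x y => [|| r1 x y, (x == e1) && (y == e2) | (x == e2) && (y == e1)].
have s2 : symmetric r2.
  by move=> x y; rewrite /r2 s1; congr orb; rewrite orbC (andbC (y == e2)) (andbC (x == e2)).
have r1v x : r1 x x = crel x x.
  rewrite /r1; case xx: (crel x x) => //=; case: eqP => //= ->.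
  by rewrite (crel_sym e4) c14 orbT.
have r2v x : r2 x x = crel x x.
  rewrite /r2 r1v; case: (eqVneq x e1) => [->|_] /=; first by rewrite v1.
  by rewrite andbF orbF.
have c31 : crel e3 e1 by apply: c3.
have c24 : crel e2 e4 by apply: c2 => //; rewrite eq_sym.
have c41 : crel e4 e1 by rewrite crel_sym.
(* Edges from [e1] to non-neighbours of [e4] go first, with apex [e3]; then
   [e1 e2] is added with apex [e4], after which [e2] dominates [e4]. *)
have cs12 : heq X (Cpx s1).
  have H b : crel e1 b -> b != e3 -> ~~ crel e4 b ->
      [/\ r1 e3 e1, r1 e3 b & forall y, crel y y -> crel e1 y -> crel b y -> r1 e3 y].
    move=> e1b b3 e4b; have bb := vr _ _ e1b.
    have K y : crel y y -> crel e1 y -> crel b y -> r1 e3 y.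
      move=> yy ey by_; rewrite /r1 (eq_sym e3 e1) (negPf n13) eqxx /= implybT andbT.
      apply: c3 => //; first by apply: contraTneq ey => ->.
      by apply: contraTneq by_ => ->; rewrite crel_sym.
    have e1b' : crel b e1 by rewrite crel_sym.
    by split=> //; [exact: K|exact: K].
  apply: heq_shrinks; split=> [x y /andP[]//|u v uv].
  rewrite {1}/r1 uv /= negb_and !negb_imply !negb_or.
  case/orP=> [/andP[/eqP E /andP[x3 x4]]|/andP[/eqP E /andP[x3 x4]]].
    rewrite {}E in uv *; have [h1 h2 h3] := H _ uv x3 x4.
    by exists e3; rewrite r1v.
  rewrite {}E crel_sym in uv *; have [h1 h2 h3] := H _ uv x3 x4.
  by exists e3; rewrite r1v; split=> // y yy A B; exact: h3.
have h12 : heq (Cpx s2) (Cpx s1).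
  apply: heq_shrink; split=> [x y xy|u v]; first by rewrite /r2 xy.
  move=> uv nuv; exists e4.
  have E : (u, v) = (e1, e2) \/ (u, v) = (e2, e1).
    by move: uv; rewrite /r2 (negPf nuv) /= => /orP[]/andP[/eqP-> /eqP->]; [left|right].
  have a1 : r1 e4 e1 by rewrite /r1 c41 (eq_sym e4 e1) (negPf n14) eqxx /= v4 orbT.
  have a2 : r1 e4 e2.
    by rewrite /r1 crel_sym c24 (eq_sym e4 e1) (negPf n14) (eq_sym e2 e1) (negPf n12').
  have a3 y : r2 y y -> r2 e1 y -> r2 e2 y -> r1 e4 y.
    rewrite r2v => yy; have [->//|y1] := eqVneq y e1; have [->//|y2] := eqVneq y e2.
    rewrite /r2 (negPf y1) (negPf y2) !andbF !orbF /r1 !eqxx (eq_sym e2 e1) (negPf n12').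
    rewrite (negPf y1) /= !andbT (eq_sym e4 e1) (negPf n14) /= andbT.
    case/andP=> _ /orP[/eqP->|//]; by rewrite (negPf n23).
  have a4 : r1 e4 e4 by rewrite r1v.
  by case: E => -[-> ->]; split=> // y yy A B; exact: a3.
apply: heq_trans cs12 _; apply: heq_trans (heq_sym h12) _.
apply: (heq_trans (Y := @restr (Cpx s2) (predC1 e4))).
  apply: (@heq_delete (Cpx s2) e2 e4) => //=; first by rewrite r2v.
    by rewrite /r2 /r1 c24 (eq_sym e2 e1) (negPf n12') (eq_sym e4 e1) (negPf n14).
  move=> y; rewrite r2v => yy.
  have [->|y1] := eqVneq y e1; first by rewrite /r2 !eqxx !orbT.
  have [->|y2] := eqVneq y e2; first by rewrite r2v.
  rewrite /r2 (negPf y1) (negPf y2) !andbF !orbF /r1 (negPf y1) /= !andbT.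
  case/andP=> c4y _; rewrite (eq_sym e2 e1) (negPf n12') /= andbT; apply: c2 => //.
  by apply: contraNneq n34 => <-; rewrite crel_sym.
pose g (x : X) : susp (Cpx contract_sym) :=
  if x == e2 then inr true else if x == e3 then inr false else inl x.
apply: (@heq_emb_vertex (@restr (Cpx s2) (predC1 e4)) (susp (Cpx contract_sym)) g).
- rewrite /g => x y; case: (eqVneq x e2) => [->|_].
    by case: (eqVneq y e2) => [->//|_]; case: (y == e3).
  case: (eqVneq x e3) => [->|_].
    by case: (y == e2) => //; case: (eqVneq y e3) => [->|].
  by case: (y == e2) => //; case: (y == e3) => // -[].
- move=> x /=; rewrite /restr_rel /= r2v /g.
  case: eqVneq => [->|x2]; first by rewrite v2 n24.
  case: eqVneq => [->|x3]; first by rewrite v3 n34'.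
  rewrite /= /contract_rel !inE (negPf x2) (negPf x3) /=; case: (x != e4) => //=.
  by case: (eqVneq x e1) => [->|_]; rewrite ?c41 ?andbT /= ?andbT.
- move=> x y; rewrite /= /restr_rel !r2v => /and3P[x4 _ xx] /and3P[y4 _ yy].
  rewrite x4 y4 /= /g; move: x4 y4 => /= x4 y4; have r2s a b : r2 a b = r2 b a by exact: s2.
  have A z : z != e4 -> crel z z -> z != e2 -> z != e3 -> r2 e2 z /\ r2 e3 z.
    move=> z4 zz z2 z3; split.
      have [->|z1] := eqVneq z e1; first by rewrite /r2 !eqxx !orbT.
      by rewrite /r2 /r1 c2 //= (eq_sym e2 e1) (negPf n12') (negPf z1).
    by rewrite /r2 /r1 c3 //= (eq_sym e3 e1) (negPf n13) eqxx /= implybT.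
  have B : r2 e2 e3 = false.
    by rewrite /r2 /r1 (negPf n23) (eq_sym e3 e1) (negPf n13) (eq_sym e2 e1) (negPf n12') !andbF.
  have [->|x2] := eqVneq x e2; have [->|y2] := eqVneq y e2.
  - by rewrite r2v v2.
  - by have [->|y3] := eqVneq y e3; [rewrite B|have [-> _] := A _ y4 yy y2 y3].
  - by rewrite r2s; have [->|x3] := eqVneq x e3; [rewrite B|have [-> _] := A _ x4 xx x2 x3].
  have [->|x3] := eqVneq x e3; have [->|y3] := eqVneq y e3.
  - by rewrite r2v v3.
  - by have [_ ->] := A _ y4 yy y2 y3.
  - by rewrite r2s; have [_ ->] := A _ x4 xx x2 x3.
  rewrite /= /contract_rel !inE !negb_or x2 x3 x4 y2 y3 y4 /=.
  by rewrite /r2 /r1 (negPf x2) (negPf x3) (negPf y2) (negPf y3) !andbF !orbF.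
- move=> [x|b] /=; last first.
    by case: b; [exists e2|exists e3]; rewrite /g ?eqxx // eq_sym (negPf n23').
  case/and3P; rewrite !inE !negb_or => /and3P[x2 x3 _] _ _; exists x.
  by rewrite /g (negPf x2) (negPf x3).
Qed.
End Path.

(** * Minors and reducible configurations *)

Section Minors.
Variable V : finType.
Implicit Types (a : rel V) (S T : {set V}).

Definition adj_in a S : rel V := fun x y => [&& x \in S, y \in S & a x y].
Definition sconn a S := forall x y, x \in S -> y \in S -> connect (adj_in a S) x y.
Definition touch a S T := exists x y, [/\ x \in S, y \in T & a x y].

(** Branch sets are nonempty as soon as the index has a neighbour, because [touch] exhibits a point
    in each of the two sets; [K4] and [K23] have no isolated vertex. *)
Definition minor (I : finType) (H : rel I) a := exists B : I -> {set V},
  [/\ forall i, sconn a (B i), forall i j, i != j -> [disjoint B i & B j]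
    & forall i j, H i j -> touch a (B i) (B j)].

Definition K4 : rel 'I_4 := fun i j => i != j.
Definition K23 : rel (bool + 'I_3) := fun i j =>
  match i, j with inl _, inr _ => true | _, _ => false end.

Lemma sconn_sub a S T x y : S \subset T -> connect (adj_in a S) x y -> connect (adj_in a T) x y.
Proof.
move=> ST; apply: connect_sub => u v /and3P[uS vS uv]; apply: connect1.
by rewrite /adj_in !(subsetP ST).
Qed.

Lemma adj_in_sym a S : symmetric a -> symmetric (adj_in a S).
Proof. by move=> sa x y; rewrite /adj_in sa andbCA. Qed.

Lemma sconn_root a S r : symmetric a ->
  (forall x, x \in S -> connect (adj_in a S) r x) -> sconn a S.
Proof.
move=> sa H x y xS yS; apply: connect_trans (H _ yS).
by rewrite (sym_connect_sym (adj_in_sym S sa)); exact: H.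
Qed.

Lemma sconn1 a x : sconn a [set x].
Proof. by move=> y z /set1P-> /set1P->; exact: connect0. Qed.

Lemma sconnU a S T : symmetric a -> sconn a S -> sconn a T -> touch a S T ->
  sconn a (S :|: T).
Proof.
move=> sa cS cT [x [y [xS yT xy]]]; apply: (@sconn_root _ _ x) => // z /setUP[zS|zT].
  by apply: sconn_sub (cS _ _ xS zS); exact: subsetUl.
apply: (@connect_trans _ _ y); last by apply: sconn_sub (cT _ _ yT zT); exact: subsetUr.
by apply: connect1; rewrite /adj_in !inE xS yT xy orbT.
Qed.

(** Branch sets are pulled back along the contraction [phi]: its fibres are connected and every edge
    of [a'] lifts to an edge of [a], so a path in a branch set lifts with detours inside the
    fibres. *)
Lemma minor_contract (I : finType) (H : rel I) (a a' : rel V) (phi : V -> V) :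
  (forall u w, a' u w -> exists u0 w0, [/\ phi u0 = u, phi w0 = w & a u0 w0]) ->
  (forall u, sconn a [set v | phi v == u]) -> minor H a' -> minor H a.
Proof.
move=> Ha Hf [B [cB dB tB]]; exists (fun i => phi @^-1: B i); split.
- move=> i x y; rewrite !inE => xB yB.
  have fib z : phi z \in B i -> [set v | phi v == phi z] \subset phi @^-1: B i.
    by move=> zB; apply/subsetP=> v; rewrite !inE => /eqP->.
  have /connectP[p pp ep] := cB i _ _ xB yB.
  elim: p x xB pp ep => [|z p IH] x xB /=.
    move=> _ E; apply: sconn_sub (fib _ xB) _; apply: Hf; rewrite !inE //.
    by rewrite E.
  case/andP=> /and3P[_ zB /Ha[u0 [w0 [u0x w0z uw]]]] pz ez.
  apply: (@connect_trans _ _ u0).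
    by apply: sconn_sub (fib _ xB) _; apply: Hf; rewrite !inE ?u0x.
  apply: (@connect_trans _ _ w0); last by apply: IH => //; rewrite w0z.
  by apply: connect1; rewrite /adj_in !inE u0x w0z xB zB.
- move=> i j /dB; rewrite -!setI_eq0 => /eqP E.
  by rewrite -preimsetI E preimset0.
- move=> i j /tB[u [w [uB wB /Ha[u0 [w0 [E1 E2 uw]]]]]].
  by exists u0, w0; rewrite !inE E1 E2.
Qed.

Lemma minor_sub (I : finType) (H : rel I) (a a' : rel V) :
  subrel a' a -> minor H a' -> minor H a.
Proof.
move=> sub; apply: (@minor_contract _ _ _ _ id) => [u w /sub|u]; first by exists u, w.
move=> x y; rewrite !inE => /eqP-> /eqP->; exact: connect0.
Qed.

End Minors.

(** * Peeling a minimal piece cut off by an edge *)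

Section Structure.
Variables (V : finType) (a : rel V).
Hypotheses (sa : symmetric a) (ia : irreflexive a).
Hypotheses (noK4 : ~ minor K4 a) (noK23 : ~ minor K23 a).
Hypothesis deg2 : forall u v, a u v -> exists2 w, w != v & a u w.
Implicit Types S Z T : {set V}.

Definition bounded S p q := forall s t, s \in S -> t \notin S -> a s t -> t = p \/ t = q.

(** A piece of the graph behind the edge [p q]. For a plane picture, think of what a chord of the
    outer cycle cuts off: a minimal piece is the interior of a path from [p] to [q], and its
    vertices have degree 2. *)
Definition good S := [&& S != set0, [forall v in S, [exists u, a v u]] &
  [exists p, exists q, [&& p \notin S, q \notin S, a p q &
    [forall s in S, forall t, (t \notin S) && a s t ==> (t == p) || (t == q)]]]].

Lemma goodP S : reflect [/\ S != set0, forall v, v \in S -> exists u, a v u &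
  exists p q, [/\ p \notin S, q \notin S, a p q & bounded S p q]] (good S).
Proof.
apply: (iffP and3P) => -[S0 H1 H2]; split=> //.
- by move=> v vS; apply/existsP; exact: (forall_inP H1).
- have /existsP[p /existsP[q /and4P[pS qS pq /forall_inP H]]] := H2.
  exists p, q; split=> // s t sS tS st; have /forallP/(_ t) := H _ sS.
  by rewrite tS st /= => /orP[]/eqP; [left|right].
- by apply/forall_inP => v /H1[u vu]; apply/existsP; exists u.
- have [p [q [pS qS pq H]]] := H2; apply/existsP; exists p; apply/existsP; exists q.
  rewrite pS qS pq; apply/forall_inP => s sS; apply/forallP => t; apply/implyP.
  by case/andP=> tS st; have [->|->] := H _ _ sS tS st; rewrite eqxx ?orbT.
Qed.

Definition comp S w := [set z | connect (adj_in a S) w z].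

Lemma comp_sub S w : w \in S -> comp S w \subset S.
Proof.
move=> wS; apply/subsetP => z; rewrite inE => /connectP[p + ->].
elim: p w wS => [|y p IH] w wS //= /andP[/and3P[_ yS _]]; exact: IH.
Qed.

Lemma comp_refl S w : w \in comp S w. Proof. by rewrite inE connect0. Qed.

Lemma comp_bd S w s t : w \in S -> s \in comp S w -> t \notin comp S w -> a s t -> t \notin S.
Proof.
move=> wS sc tc st; apply: contra tc => tS; have sS := subsetP (comp_sub wS) _ sc.
move: sc; rewrite !inE => /connect_trans; apply; apply: connect1.
by rewrite /adj_in sS tS.
Qed.
Arguments comp_bd {S w s t}.

Lemma comp_sconn S w : w \in S -> sconn a (comp S w).
Proof.
move=> wS; apply: (@sconn_root _ _ _ w) => // z; rewrite inE => /connectP[p pp ->].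
suff H u q : path (adj_in a S) u q -> u \in comp S w ->
    connect (adj_in a (comp S w)) u (last u q) by exact: H pp (comp_refl S w).
elim: q u => [|y q IH] u /=; first by rewrite connect0.
case/andP=> /and3P[uS yS uy] py uc; have yc : y \in comp S w.
  by apply: contraT => /(comp_bd wS uc)/(_ uy); rewrite yS.
apply: connect_trans (IH _ py yc); apply: connect1.
by rewrite /adj_in uc yc.
Qed.

Lemma sconn_exit S T x y : sconn a S -> T \subset S -> x \in T -> y \in S -> y \notin T ->
  exists s t, [/\ s \in T, t \in S, t \notin T & a s t].
Proof.
move=> cS TS xT yS yT; have /connectP[p pp ep] := cS _ _ (subsetP TS _ xT) yS.
elim: p x xT pp ep => [|z p IH] x xT /=; first by move=> _ E; rewrite E xT in yT.
case/andP=> /and3P[_ zS xz] pz ez; have [zT|zT] := boolP (z \in T).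
  exact: IH zT pz ez.
by exists x, z.
Qed.

(* A minimal good set is peeled from the end [x]; [S] is what remains of it and
   [Z] contains [x] and the vertices already removed. *)
Record arm S Z x y : Prop := Arm {
  arm_conn : sconn a S;
  arm_Zconn : sconn a Z;
  arm_xZ : x \in Z;
  arm_dis : [disjoint Z & S];
  arm_yS : y \notin S;
  arm_yZ : y \notin Z;
  arm_bd : bounded S x y;
  arm_x : exists2 s, s \in S & a x s;
  arm_y : exists2 s, s \in S & a y s;
  arm_zy : exists2 z, z \in Z & a z y;
  arm_min : forall S', S' \proper S -> ~~ good S' }.

Lemma arm_nonisol S Z x y v : arm S Z x y -> v \in S -> exists u, a v u.
Proof.
move=> A vS; have [s sS xs] := arm_x A; have [->|vs] := eqVneq v s.
  by exists x; rewrite sa.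
have vs' : s \notin [set v] by rewrite inE eq_sym.
have [|u [t [/set1P-> _ _ ut]]] := sconn_exit (arm_conn A) _ (set11 v) sS vs'.
  by rewrite sub1set.
by exists t.
Qed.

Lemma K4_intro B1 B2 B3 B4 : sconn a B1 -> sconn a B2 -> sconn a B3 -> sconn a B4 ->
  [disjoint B1 & B2] -> [disjoint B1 & B3] -> [disjoint B1 & B4] ->
  [disjoint B2 & B3] -> [disjoint B2 & B4] -> [disjoint B3 & B4] ->
  touch a B1 B2 -> touch a B1 B3 -> touch a B1 B4 ->
  touch a B2 B3 -> touch a B2 B4 -> touch a B3 B4 -> False.
Proof.
have tC S T : touch a S T -> touch a T S.
  by move=> [x [y [xS yT xy]]]; exists y, x; rewrite sa.
move=> c1 c2 c3 c4 d12 d13 d14 d23 d24 d34 t12 t13 t14 t23 t24 t34; apply: noK4.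
exists (fun i : 'I_4 => nth set0 [:: B1; B2; B3; B4] i); split.
- by case=> [[|[|[|[|]]]]].
- by move=> [[|[|[|[|//]]]] ?] [[|[|[|[|//]]]] ?] //= _; rewrite 1?disjoint_sym.
- move=> [[|[|[|[|//]]]] ?] [[|[|[|[|//]]]] ?] //= _; exact: tC.
Qed.

Lemma K23_intro A1 A2 B1 B2 B3 : sconn a A1 -> sconn a A2 ->
  sconn a B1 -> sconn a B2 -> sconn a B3 -> [disjoint A1 & A2] ->
  [disjoint A1 & B1] -> [disjoint A1 & B2] -> [disjoint A1 & B3] ->
  [disjoint A2 & B1] -> [disjoint A2 & B2] -> [disjoint A2 & B3] ->
  [disjoint B1 & B2] -> [disjoint B1 & B3] -> [disjoint B2 & B3] ->
  touch a A1 B1 -> touch a A1 B2 -> touch a A1 B3 ->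
  touch a A2 B1 -> touch a A2 B2 -> touch a A2 B3 -> False.
Proof.
move=> c1 c2 c3 c4 c5 d1 d2 d3 d4 d5 d6 d7 d8 d9 d10 t1 t2 t3 t4 t5 t6; apply: noK23.
exists (fun i : bool + 'I_3 => match i with inl b => if b then A1 else A2
  | inr i => nth set0 [:: B1; B2; B3] i end); split.
- by case=> [[]|[[|[|[|]]]]].
- by move=> [[]|[[|[|[|//]]] ?]] [[]|[[|[|[|//]]] ?]] //= _; rewrite 1?disjoint_sym.
- by move=> [[]|i] [[]|[[|[|[|//]]] ?]].
Qed.

Section Step.
Variables (S Z : {set V}) (x y : V).
Hypothesis A : arm S Z x y.

(** Such a component would be enclosed by the adjacent pair [p q] and be a good set smaller than
    [S], against minimality. *)
Let comp_good v w p q : v \in S -> a p q -> w \in S :\ v -> p \notin comp (S :\ v) w ->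
  q \notin comp (S :\ v) w ->
  (forall s t, s \in comp (S :\ v) w -> a s t -> t \notin comp (S :\ v) w ->
     t \in [:: v; x; y] -> t = p \/ t = q) -> False.
Proof.
move=> vS pq wS pc qc H.
have sub := subset_trans (comp_sub wS) (subsetDl S [set v]).
have pr : comp (S :\ v) w \proper S.
  rewrite properE sub /=; apply/negP => /subsetP/(_ _ vS).
  by move/(subsetP (comp_sub wS)); rewrite !inE eqxx.
move/negP: (arm_min A pr); apply.
apply/goodP; split.
- by apply/set0Pn; exists w; exact: comp_refl.
- by move=> u uc; apply: (arm_nonisol A); exact: (subsetP sub).
- exists p, q; split=> // s t sc tc st; apply: (H s) => //.
  have := comp_bd wS sc tc st; rewrite !inE negb_and negbK.
  have [->//|_ /= tS] := eqVneq t v; apply/orP.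
  by have [->|->] := arm_bd A (subsetP sub _ sc) tS st; rewrite eqxx; [left|right].
Qed.

Let xS : x \notin S.
Proof. by have /disjointFr -> := arm_dis A; rewrite ?(arm_xZ A). Qed.
Let yS := arm_yS A.
Let yx : y != x. Proof. by apply: contraNneq (arm_yZ A) => ->; exact: arm_xZ A. Qed.

(** A component of [S] without [v] that missed [y] would be enclosed by the edge [x v]. If [v y]
    were an edge, a component that missed [x] would be enclosed by it; so the component would meet
    [v], [y] and [Z], and together with these three form a [K4] minor. *)
Lemma arm_sep v w : v \in S -> a x v -> w \in S :\ v ->
  [/\ ~~ a v y, touch a (comp (S :\ v) w) [set v] & touch a (comp (S :\ v) w) [set y]].
Proof.
move=> vS xv wS; set D := comp _ w.
have sub : D \subset S :\ v := comp_sub wS.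
have D_S u : u \in D -> u \in S /\ u != v.
  by move/(subsetP sub); rewrite !inE => /andP[].
have nD u : u \notin S -> u \notin D by apply: contra => /D_S[].
have vD : v \notin D by apply/negP => /D_S[_]; rewrite eqxx.
have tv : touch a D [set v].
  have [|s [t [sD tS tD st]]] := sconn_exit (arm_conn A) _ (comp_refl _ w) vS vD.
    exact: subset_trans sub (subsetDl _ _).
  have := comp_bd wS sD tD st; rewrite !inE tS andbT negbK => /eqP tv.
  by exists s, t; rewrite tv set11 -tv.
have ty : touch a D [set y].
  have [/existsP[s /andP[sD sy]]|/negP ny] := boolP [exists s, (s \in D) && a s y].
    by exists s, y; rewrite set11.
  exfalso; apply: (comp_good vS xv wS) ; [exact: nD|exact: vD|] => s t sD st tD.
  rewrite !inE => /or3P[]/eqP E; [by right|by left|].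
  by case: ny; apply/existsP; exists s; rewrite sD -E.
split=> //; apply/negP => vy.
have tx : touch a D Z.
  have [/existsP[s /andP[sD sx]]|/negP nx] := boolP [exists s, (s \in D) && a s x].
    by exists s, x; rewrite (arm_xZ A).
  exfalso; apply: (comp_good vS vy wS); [exact: vD|exact: nD|] => s t sD st tD.
  rewrite !inE => /or3P[]/eqP E; [by left| |by right].
  by case: nx; apply/existsP; exists s; rewrite sD -E.
have dZ : [disjoint D & Z].
  rewrite disjoint_sym; apply: disjointWr (arm_dis A).
  exact: subset_trans sub (subsetDl _ _).
have vZ : v \notin Z by apply/negP => vZ; have := disjointFr (arm_dis A) vZ; rewrite vS.
have [z zZ zy] := arm_zy A.
apply: (@K4_intro D [set v] [set y] Z) => //.
all: try exact: sconn1.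
- exact: comp_sconn.
- exact: arm_Zconn A.
- by rewrite disjoint_sym disjoints1.
- by rewrite disjoint_sym disjoints1 nD.
- by rewrite disjoints1 inE; apply: contraNneq yS => <-.
- by rewrite disjoints1.
- by rewrite disjoints1 (arm_yZ A).
- by exists v, y; rewrite !set11.
- by exists v, x; rewrite set11 (arm_xZ A) sa.
- by exists y, z; rewrite set11 sa.
Qed.

(** By [arm_sep] every component touches both [v] and [y], and so does [Z]: two components would
    give a [K23] minor with [v] and [y] on the side of two. *)
Lemma arm_D1 v : v \in S -> a x v -> sconn a (S :\ v).
Proof.
move=> vS xv w1 w2 w1S w2S; apply: contraT => nc; exfalso.
have [_ tv1 ty1] := arm_sep vS xv w1S; have [_ tv2 ty2] := arm_sep vS xv w2S.
have tC B C : touch a B C -> touch a C B.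
  by move=> [u [t [uB tC ut]]]; exists t, u; rewrite sa.
have sub w : w \in S :\ v -> comp (S :\ v) w \subset S :\ v := @comp_sub _ w.
have D_S w u : w \in S :\ v -> u \in comp (S :\ v) w -> u \in S /\ u != v.
  by move=> /sub/subsetP H /H; rewrite !inE => /andP[].
have vZ : v \notin Z by apply/negP => vZ; have := disjointFr (arm_dis A) vZ; rewrite vS.
have [z zZ zy] := arm_zy A.
have dZ w : w \in S :\ v -> [disjoint comp (S :\ v) w & Z].
  move=> wS; rewrite disjoint_sym; apply: disjointWr (arm_dis A).
  exact: subset_trans (sub _ wS) (subsetDl _ _).
apply: (@K23_intro [set v] [set y] (comp (S :\ v) w1) (comp (S :\ v) w2) Z) => //.
all: try exact: sconn1.
all: try exact: tC.
all: try exact: dZ.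
all: try exact: comp_sconn.
- exact: arm_Zconn A.
- by rewrite disjoints1 inE; apply: contraNneq yS => <-.
- by rewrite disjoints1; apply/negP => /(D_S _ _ w1S)[_]; rewrite eqxx.
- by rewrite disjoints1; apply/negP => /(D_S _ _ w2S)[_]; rewrite eqxx.
- by rewrite disjoints1.
- by rewrite disjoints1; apply: contra yS => /(D_S _ _ w1S)[].
- by rewrite disjoints1; apply: contra yS => /(D_S _ _ w2S)[].
- by rewrite disjoints1 (arm_yZ A).
- rewrite -setI_eq0; apply/set0Pn => -[u]; rewrite !inE => /andP[c1 c2].
  case/negP: nc; apply: connect_trans c1 _.
  by rewrite (sym_connect_sym (adj_in_sym _ sa)).
- by exists v, x; rewrite set11 (arm_xZ A) sa.
- by exists y, z; rewrite set11 sa.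
Qed.

(** Otherwise take the component [W] of a neighbour of [y] after deleting [u] and [v]. By [arm_D1]
    it touches both of them, so [W] and [Z] form the side of two of a [K23] minor whose other side
    is [u], [v], [y]. *)
Lemma arm_uniq u v : u \in S -> v \in S -> a x u -> a x v -> u = v.
Proof.
move=> uS vS xu xv; apply/eqP; apply: contraT => uv; exfalso.
have vSu : v \in S :\ u by rewrite !inE eq_sym uv.
have uSv : u \in S :\ v by rewrite !inE uv.
have [nuy _ _] := arm_sep uS xu vSu; have [nvy _ _] := arm_sep vS xv uSv.
have [w wS yw] := arm_y A.
have wu : w != u by apply: contraNneq nuy => <-; rewrite sa.
have wv : w != v by apply: contraNneq nvy => <-; rewrite sa.
have tC B C : touch a B C -> touch a C B.
  by move=> [r [t [uB tC ut]]]; exists t, r; rewrite sa.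
pose W := comp (S :\ u :\ v) w.
have wW : w \in S :\ u :\ v by rewrite !inE wu wv.
have subW : W \subset S :\ u :\ v := comp_sub wW.
have W_S r : r \in W -> [/\ r \in S, r != u & r != v].
  by move/(subsetP subW); rewrite !inE => /and3P[].
have uW : u \notin W by apply/negP => /W_S[_]; rewrite eqxx.
have vW : v \notin W by apply/negP => /W_S[_ _]; rewrite eqxx.
have tu : touch a W [set u].
  have [|s [t [sD tS tD st]]] := sconn_exit (arm_D1 vS xv) _ (comp_refl _ w) uSv uW.
    by apply/subsetP => r /W_S[? ? ?]; rewrite !inE; apply/andP.
  have := comp_bd wW sD tD st; move: tS; rewrite !inE => /andP[-> ->].
  by rewrite /= andbT negbK => /eqP E; exists s, t; split; rewrite // E set11.
have tv : touch a W [set v].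
  have [|s [t [sD tS tD st]]] := sconn_exit (arm_D1 uS xu) _ (comp_refl _ w) vSu vW.
    by apply/subsetP => r /W_S[? ? ?]; rewrite !inE; apply/andP.
  have := comp_bd wW sD tD st; move: tS; rewrite !inE => /andP[-> ->].
  by rewrite /= andbT negbK => /eqP E; exists s, t; split; rewrite // E set11.
have nZ r : r \in S -> r \notin Z.
  by move=> rS; apply/negP => rZ; have := disjointFr (arm_dis A) rZ; rewrite rS.
have [z zZ zy] := arm_zy A.
have yW : y \notin W by apply: contra yS => /W_S[].
apply: (@K23_intro W Z [set u] [set v] [set y]) => //.
all: try exact: sconn1.
- exact: comp_sconn.
- exact: arm_Zconn A.
- rewrite disjoint_sym; apply: disjointWr (arm_dis A).
  by apply/subsetP => r /W_S[].
- by rewrite disjoint_sym disjoints1.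
- by rewrite disjoint_sym disjoints1.
- by rewrite disjoint_sym disjoints1.
- by rewrite disjoint_sym disjoints1 nZ.
- by rewrite disjoint_sym disjoints1 nZ.
- by rewrite disjoint_sym disjoints1 (arm_yZ A).
- by rewrite disjoints1 inE.
- by rewrite disjoints1 inE; apply: contraNneq yS => <-.
- by rewrite disjoints1 inE; apply: contraNneq yS => <-.
- by exists w, y; rewrite comp_refl set11 sa.
- by exists x, u; rewrite set11 (arm_xZ A).
- by exists x, v; rewrite set11 (arm_xZ A).
- by exists z, y; rewrite set11.
Qed.

(** The removed vertex [v] becomes the new end and joins [Z]. Uniqueness of [v] is what keeps [x]
    out of the boundary of the remainder. *)
Lemma arm_step : exists v, [/\ v \in S, a x v, forall u, u \in S -> a x u -> u = v
  & S = [set v] \/ ~~ a v y /\ arm (S :\ v) (v |: Z) v y].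
Proof.
have [v vS xv] := arm_x A; exists v; split=> // [u uS xu|]; first exact: arm_uniq.
have [|/set0Pn[w wS]] := boolP (S :\ v == set0); last first.
  right; have [nvy [s [t [sD /set1P-> sv]]] _] := arm_sep vS xv wS; split=> //.
  have sS := subsetP (comp_sub wS) _ sD.
  split.
  - exact: arm_D1.
  - rewrite setUC; apply: sconnU => //; [exact: arm_Zconn A|exact: sconn1|].
    by exists x, v; rewrite (arm_xZ A) set11.
  - by rewrite setU11.
  - rewrite -setI_eq0; apply/set0Pn => -[r]; rewrite !inE.
    case/and3P=> /orP[->//|rZ] _ rS; have := disjointFr (arm_dis A) rZ.
    by rewrite rS.
  - by rewrite !inE (negPf yS) andbF.
  - rewrite !inE (negPf (arm_yZ A)) orbF; by apply: contraNneq yS => ->.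
  - move=> r t'; rewrite !inE => /andP[rv rS]; rewrite negb_and negbK => tS rt.
    have [->|t'v] := eqVneq t' v; [by left|right].
    move: tS; rewrite (negPf t'v) /= => tS.
    case: (arm_bd A rS tS rt) => // E; move: rv; rewrite (arm_uniq rS vS _ xv) ?eqxx //.
    by rewrite -E sa.
  - by exists s => //; rewrite sa.
  - have [r rS yr] := arm_y A; exists r => //; rewrite !inE rS andbT.
    by apply: contraNneq nvy => <-; rewrite sa.
  - by have [z zZ zy] := arm_zy A; exists z; rewrite // inE zZ orbT.
  - move=> S' /proper_sub_trans S'S; apply: (arm_min A); apply: S'S.
    exact: subsetDl.
rewrite setD_eq0 => Sv; left; apply/eqP.
by rewrite eqEsubset Sv sub1set.
Qed.
End Step.

Let aneq u v : a u v -> u != v.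
Proof. by apply: contraTneq => ->; rewrite ia. Qed.

Lemma good_ex u v : a u v -> exists2 S, good S & forall S', S' \proper S -> ~~ good S'.
Proof.
move=> uv; pose S := [set s | [exists t, a s t]] :\: [set u; v].
have gS : good S.
  apply/goodP; split.
  - have vu : a v u by rewrite sa.
    have [w wu vw] := deg2 vu; apply/set0Pn; exists w.
    rewrite !inE negb_or wu eq_sym (aneq vw) /=; apply/existsP; exists v.
    by rewrite sa.
  - by move=> s; rewrite !inE => /andP[_ /existsP].
  - exists u, v; split=> //; rewrite ?inE ?eqxx ?orbT // => s t.
    rewrite !inE => /andP[_ _]; rewrite negb_and negbK => + st.
    case/orP=> [/orP[]/eqP->|/existsP[]]; [by left|by right|].
    by exists s; rewrite sa.
have [S0 /minsetP[g0 m0] _] := minset_exists gS.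
exists S0 => // S' /andP[sub nsub]; apply/negP => g'.
by move: nsub; rewrite (m0 _ g' sub) subxx.
Qed.

(** If [q] had no neighbour in [S], all edges leaving [S] would end in [p]. Removing a neighbour [v]
    of [p] then leaves a good set behind the edge [p v], nonempty since [v] has a second neighbour.
    If [p] has no neighbour in [S] either, the two ends of any edge inside [S] serve instead. *)
Lemma good_attached S p q : good S -> (forall S', S' \proper S -> ~~ good S') ->
  p \notin S -> bounded S p q -> exists2 s, s \in S & a q s.
Proof.
move=> gS mS pS bS; have [S0 ni _] := goodP _ gS.
have [/existsP[s /andP[sS qs]]|/negP nq] := boolP [exists s, (s \in S) && a q s].
  by exists s.
exfalso; have bp s t : s \in S -> t \notin S -> a s t -> t = p.
  move=> sS tS st; have [//|E] := bS _ _ sS tS st; case: nq.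
  by apply/existsP; exists s; rewrite sS -E sa.
have smaller r v : v \in S -> a r v -> (forall s t, s \in S -> t \notin S -> a s t -> t = r) ->
      False.
  move=> vS rv H; have vr : a v r by rewrite sa.
  have [w wr vw] := deg2 vr.
  have wS : w \in S -> good (S :\: [set r; v]).
    move=> wS; apply/goodP; split.
    - by apply/set0Pn; exists w; rewrite !inE negb_or wr eq_sym (aneq vw) wS.
    - by move=> s; rewrite !inE => /andP[_]; exact: ni.
    - exists r, v; split=> //; rewrite ?inE ?eqxx ?orbT // => s t.
      rewrite !inE negb_or => /andP[/andP[sr sv] sS].
      rewrite negb_and negbK => /orP[/orP[]/eqP->|tS] st; [by left|by right|left].
      exact: (H s).
  have prop : S :\: [set r; v] \proper S.
    rewrite properE subsetDl /=; apply/negP => /subsetP/(_ _ vS).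
    by rewrite !inE eqxx orbT.
  have [/wS|wS'] := boolP (w \in S); first exact/negP/mS.
  by move: wr; rewrite (H _ _ vS wS' vw) eqxx.
have [/existsP[v /andP[vS pv]]|/negP np] := boolP [exists v, (v \in S) && a p v].
  exact: (smaller _ _ vS pv).
have [v vS] := set0Pn _ S0; have [w vw] := ni _ vS.
have nb s t : s \in S -> a s t -> t \in S.
  move=> sS st; apply: contraT => tS; case: np; apply/existsP; exists s.
  by rewrite sS -(bp _ _ sS tS st) sa.
apply: (smaller w _ vS); first by rewrite sa.
by move=> s t sS tS /(nb _ _ sS); rewrite (negPf tS).
Qed.

(** The three cases are a minimal good set that is exhausted after one step of [arm_step], after
    two, or not before the third. *)
Lemma reducible u v : a u v ->
  [\/ exists x y v, [/\ a x y, a x v, a v y & forall t, a v t -> t = x \/ t = y],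
     exists x y v1 v2, [/\ [/\ a x y, a x v1, a v1 v2 & a v2 y],
       forall t, a v1 t -> t = x \/ t = v2, forall t, a v2 t -> t = v1 \/ t = y
       & uniq [:: x; v1; v2; y]]
   | exists x v1 v2 v3 v4, [/\ [/\ a x v1, a v1 v2, a v2 v3 & a v3 v4],
       forall t, a v1 t -> t = x \/ t = v2, forall t, a v2 t -> t = v1 \/ t = v3,
       forall t, a v3 t -> t = v2 \/ t = v4 & uniq [:: x; v1; v2; v3; v4]]].
Proof.
move=> /good_ex[S gS mS]; have [S0 ni [x [y [xS yS xy bS]]]] := goodP _ gS.
have ay := good_attached gS mS xS bS.
have ax : exists2 s, s \in S & a x s.
  by apply: (good_attached gS mS yS) => s t sS tS /(bS _ _ sS tS)[]; [right|left].
have cS : sconn a S.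
  move=> w1 w2 w1S w2S; apply: contraT => nc.
  have pr : comp S w1 \proper S.
    rewrite properE comp_sub //=; apply/negP => /subsetP/(_ _ w2S).
    by rewrite inE (negPf nc).
  case/negP: (mS _ pr); apply/goodP; split.
  - by apply/set0Pn; exists w1; exact: comp_refl.
  - by move=> s /(subsetP (comp_sub w1S)); exact: ni.
  - have nD r : r \notin S -> r \notin comp S w1.
      by apply: contra; exact: (subsetP (comp_sub w1S)).
    exists x, y; split; rewrite ?nD // => s t sc tc st.
    exact: bS (subsetP (comp_sub w1S) _ sc) (comp_bd w1S sc tc st) st.
have A0 : arm S [set x] x y.
  split=> //; first exact: sconn1.
  - by rewrite set11.
  - by rewrite disjoints1.
  - by rewrite inE eq_sym aneq.
  - by exists x; rewrite ?set11.
have [v1 [v1S xv1 u1 [E1|[n1 A1]]]] := arm_step A0.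
  apply: Or31; exists x, y, v1; split=> //.
    by have [s] := ay; rewrite E1 inE => /eqP->; rewrite sa.
  move=> t vt; apply: (bS v1) => //; rewrite E1 inE.
  by rewrite eq_sym aneq.
have [v2 [v2S v12 u2 st2]] := arm_step A1.
have N1 t : a v1 t -> t = x \/ t = v2.
  move=> vt; have [tS|tS] := boolP (t \in S); [right|left].
    by apply: u2 => //; rewrite !inE tS eq_sym aneq.
  have [//|E] := bS _ _ v1S tS vt; by move: n1; rewrite -E vt.
have x1 : x != v1 by exact: aneq.
have v1y : v1 != y by apply: contraNneq yS => <-.
move: (v2S); rewrite !inE => /andP[v21 v2S0].
have x2 : x != v2 by apply: contraNneq xS => ->.
have v2y : v2 != y by apply: contraNneq yS => <-.
case: st2 => [E2|[n2 A2]].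
  apply: Or32; exists x, y, v1, v2; split=> //.
  - split=> //; have [s] := arm_y A1; rewrite E2 inE => /eqP->; by rewrite sa.
  - move=> t vt; apply: (arm_bd A1 v2S) => //; rewrite E2 inE.
    by rewrite eq_sym aneq.
  - by rewrite /= !inE !negb_or x1 x2 aneq //= v1y v2y eq_sym v21.
have [v3 [v3S v23 u3 st3]] := arm_step A2.
have N2 t : a v2 t -> t = v1 \/ t = v3.
  move=> vt; have [tS|tS] := boolP (t \in S :\ v1); [right|left].
    by apply: u3 => //; rewrite in_setD1 tS eq_sym aneq.
  have [//|E] := arm_bd A1 v2S tS vt; by move: n2; rewrite -E vt.
move: (v3S); rewrite !inE => /and3P[v32 v31 v3S0].
have x3 : x != v3 by apply: contraNneq xS => ->.
have v3y : v3 != y by apply: contraNneq yS => <-.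
have fin v4 : a v3 v4 -> (forall t, a v3 t -> t = v2 \/ t = v4) -> v4 != x -> v4 != v1 ->
    v4 != v2 -> exists x v1 v2 v3 v4, [/\ [/\ a x v1, a v1 v2, a v2 v3 & a v3 v4],
       forall t, a v1 t -> t = x \/ t = v2, forall t, a v2 t -> t = v1 \/ t = v3,
       forall t, a v3 t -> t = v2 \/ t = v4 & uniq [:: x; v1; v2; v3; v4]].
  move=> v34 N3 n4x n41 n42; exists x, v1, v2, v3, v4; split=> //.
  rewrite /= !inE !negb_or x1 x2 x3 (eq_sym x) n4x (eq_sym v1) v21 (eq_sym v1) v31.
  by rewrite (eq_sym v1) n41 (eq_sym v2) v32 (eq_sym v2) n42 aneq.
apply: Or33; case: st3 => [E3|[n3 A3]].
  apply: (fin y).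
  - by have [s] := arm_y A2; rewrite E3 inE => /eqP->; rewrite sa.
  - move=> t vt; apply: (arm_bd A2 v3S) => //; rewrite E3 inE.
    by rewrite eq_sym aneq.
  - by rewrite eq_sym aneq.
  - by rewrite eq_sym.
  - by rewrite eq_sym.
have [v4 [v4S v34 u4 _]] := arm_step A3.
move: (v4S); rewrite !inE => /and4P[v43 v42 v41 v4S0].
apply: (fin v4) => //; last by apply: contraNneq xS => <-.
move=> t vt; have [tS|tS] := boolP (t \in S :\ v1 :\ v2); [right|left].
  by apply: u4 => //; rewrite in_setD1 tS eq_sym aneq.
have [//|E] := arm_bd A2 v3S tS vt; by move: n3; rewrite -E vt.
Qed.

End Structure.

(** * Matching complexes of graphs without K4 and K23 minors *)

Section Matching.
Variable V : finType.
Implicit Types (D : {set {set V}}) (e f g : {set V}) (x y v : V).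

Definition mrel D : rel {set V} :=
  fun e f => [&& e \in D, f \in D & (e == f) || [disjoint e & f]].
Lemma mrel_sym D : symmetric (mrel D).
Proof. by move=> e f; rewrite /mrel eq_sym disjoint_sym andbCA. Qed.
Definition mcpx D := Cpx (@mrel_sym D).

Definition madj D : rel V := fun x y => (x != y) && ([set x; y] \in D).
Lemma madj_sym D : symmetric (madj D).
Proof. by move=> x y; rewrite /madj eq_sym setUC. Qed.
Lemma madj_irr D : irreflexive (madj D).
Proof. by move=> x; rewrite /madj eqxx. Qed.

Definition pairs D := forall e, e \in D -> #|e| = 2.

Lemma mrel_vertex D e : mrel D e e = (e \in D).
Proof. by rewrite /mrel eqxx andbT andbb. Qed.

Lemma disjoints2 x y g : [disjoint [set x; y] & g] = (x \notin g) && (y \notin g).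
Proof. by rewrite -setI_eq0 setIUl setU_eq0 !setI_eq0 !disjoints1. Qed.

Lemma pairs_other D e v : pairs D -> e \in D -> v \in e ->
  exists2 w, e = [set v; w] & madj D v w.
Proof.
move=> pD eD ve; have /eqP/cards2P[x [y [xy E]]] := pD _ eD.
move: ve; rewrite E !inE => /orP[]/eqP->.
  by exists y => //; rewrite /madj xy -E.
by exists x; rewrite 1?setUC // /madj eq_sym xy setUC -E.
Qed.

Lemma conn_eqrel (T : finType) (c c' : rel T) (cs : symmetric c) (cs' : symmetric c') :
  c =2 c' -> conn (Cpx cs') -> conn (Cpx cs).
Proof.
move=> E H x y; rewrite /= !E => xx yy; rewrite -(eq_connect (e := edge_in (Cpx cs'))).
  exact: H.
by move=> u v; rewrite /edge_in /= !E.
Qed.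

Lemma restr_delete D f : @restr_rel _ (mrel D) (predC1 f) =2 mrel (D :\ f).
Proof.
move=> e g; rewrite /restr_rel /mrel !inE /=.
by case: (e == f) => //=; case: (g == f); rewrite //= andbF.
Qed.

Lemma restr_mcpx D f : heq (restr (X := mcpx D) (predC1 f)) (mcpx (D :\ f)).
Proof.
by apply: heq_eqrel; exact: restr_delete.
Qed.

Lemma meet_two e f g : #|g| = 2 -> [disjoint e & f] -> ~~ [disjoint g & e] ->
  ~~ [disjoint g & f] -> g \subset e :|: f.
Proof.
move=> g2 ef; rewrite -!setI_eq0 => /set0Pn[x /setIP[xg xe]] /set0Pn[y /setIP[yg yf]].
have xy : x != y by apply: contraTneq yf => <-; rewrite (disjointFr ef xe).
have -> : g = [set x; y].
  apply/esym/eqP; rewrite eqEcard cards2 xy g2 andbT.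
  by apply/subsetP => z /set2P[]->.
by apply/subsetP => z /set2P[]->; rewrite inE ?xe ?yf ?orbT.
Qed.

(** Every vertex has a neighbour, so two components contain disjoint pairs [x x'] and [y y'] of
    graph edges. An edge of one component meets all edges of the other, which forces everything, [f]
    included by domination, into the four points of [x] and [x']. There a disjoint edge is a
    complement: an edge disjoint from [f] has [f] as its only partner, and deleting [f] would leave
    it without one. *)
Lemma conn_delete D e f : pairs D -> e \in D -> f \in D -> e != f ->
  ~~ [disjoint e & f] ->
  (forall g, g \in D -> g != f -> [disjoint f & g] -> [disjoint e & g]) ->
  (forall u, u \in D -> exists2 w, w \in D & [disjoint u & w]) ->
  conn (mcpx (D :\ f)).
Proof.
move=> pD eD fD ef mef dom nofull.
set D0 := D :\ f; have eD0 : e \in D0 by rewrite !inE ef.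
have D0D g : g \in D0 -> g \in D by rewrite inE => /andP[].
have partner u : u \in D0 -> exists2 w, w \in D0 & [disjoint u & w].
  move=> uD0; have [w wD uw] := nofull _ (D0D _ uD0).
  have [E|wf] := eqVneq w f; last by exists w; rewrite // !inE wf.
  exists e => //; rewrite disjoint_sym; apply: dom; first exact: D0D.
    by move: uD0; rewrite !inE => /andP[].
  by rewrite -E disjoint_sym.
suff H (x y : {set V}) : x \in D0 -> y \in D0 -> connect (edge_in (mcpx D0)) x y.
  by move=> x y; rewrite /= !mrel_vertex; exact: H.
move=> xD yD; apply: contraT => nxy; exfalso.
have sc := sym_connect_sym (@edge_in_sym (mcpx D0)).
pose C := connect (edge_in (mcpx D0)) x.
have Cstep u w : u \in D0 -> w \in D0 -> [disjoint u & w] -> C u = C w.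
  move=> uD wD uw; have st : edge_in (mcpx D0) u w.
    by rewrite /edge_in /= !mrel_vertex uD wD /= /mrel uD wD uw orbT.
  by apply/idP/idP => /connect_trans; apply; apply: connect1; rewrite // edge_in_sym.
have meet u w : u \in D0 -> w \in D0 -> C u != C w -> ~~ [disjoint u & w].
  by move=> uD wD; apply: contra => /(Cstep _ _ uD wD) ->.
have Cx : C x by exact: connect0.
have Cy : C y = false by exact: negbTE.
have [x' x'D xx'] := partner _ xD; have [y' y'D yy'] := partner _ yD.
have Cx' : C x' by rewrite -(Cstep x x').
have Cy' : C y' = false by rewrite -(Cstep y y').
have p2 g : g \in D0 -> #|g| = 2 by move=> /D0D; exact: pD.
pose W := x :|: x'.
have yW : y :|: y' \subset W.
  by rewrite subUset !meet_two ?p2 // meet ?Cx ?Cy ?Cx' ?Cy'.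
have inW g : g \in D0 -> g \subset W.
  move=> gD; case Cg : (C g).
    by apply: subset_trans yW; rewrite meet_two ?p2 // meet // Cg ?Cy ?Cy'.
  by rewrite meet_two ?p2 // meet // Cg ?Cx ?Cx'.
have W4 : #|W| = 4.
  have E : x :&: x' = set0 by apply/eqP; rewrite setI_eq0.
  by rewrite cardsU E cards0 !p2.
have compl (g h : {set V}) : #|g| = 2 -> #|h| = 2 -> g \subset W -> h \subset W -> [disjoint g & h] -> h = W :\: g.
  move=> g2 h2 gW hW gh; apply/eqP; rewrite eqEcard subsetD hW disjoint_sym gh /=.
  by rewrite cardsD (setIidPr gW) W4 g2 h2.
have fmeet w : w \in D0 -> C w != C e -> ~~ [disjoint f & w].
  move=> wD Cwe; have := meet _ _ wD eD0 Cwe; apply: contra => fw.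
  rewrite disjoint_sym; apply: dom => //; first exact: D0D.
  by move: wD; rewrite !inE => /andP[].
have fW : f \subset W.
  case Ce : (C e).
    by apply: subset_trans yW; rewrite meet_two ?pD // fmeet // Ce ?Cy ?Cy'.
  by rewrite meet_two ?pD // fmeet // Ce ?Cx ?Cx'.
have [f' f'D ff'] := nofull _ fD.
have f'f : f' != f.
  apply: contraTneq ff' => ->; rewrite -setI_eq0 setIid -cards_eq0 pD //.
have f'D0 : f' \in D0 by rewrite !inE f'f.
have [h hD f'h] := partner _ f'D0.
have f2 := pD _ fD; have E1 := compl _ _ f2 (p2 _ f'D0) fW (inW _ f'D0) ff'.
have E2 := compl _ _ (p2 _ f'D0) (p2 _ hD) (inW _ f'D0) (inW _ hD) f'h.
have hf : h = f by rewrite E2 E1 setDDr setDv set0U; exact/setIidPr.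
by move: hD; rewrite hf !inE eqxx.
Qed.

(** Since the link of [f] is not empty, its suspension is a wedge of spheres of positive dimension,
    as [htype_link] requires. *)
Lemma htype_dominated D e f : pairs D -> e \in D -> f \in D -> ~~ [disjoint e & f] -> e != f ->
  (forall g, g \in D -> g != f -> [disjoint f & g] -> [disjoint e & g]) ->
  conn (mcpx (D :\ f)) -> htype (mcpx (D :\ f)) ->
  (exists2 g, g \in D & [disjoint f & g]) ->
  htype (mcpx [set g in D | [disjoint f & g]]) -> htype (mcpx D).
Proof.
move=> pD eD fD mef ef dom cD hD [g0 g0D fg0] hL.
have e0 : e \in D :\ f by rewrite !inE ef.
pose X := mcpx D.
apply: htype_heq (heq_sym (@heq_dominated X e f _ _ _ _)) _.
- by rewrite /= mrel_vertex.
- by rewrite /= mrel_vertex.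
- by rewrite /= /mrel negb_and negb_and (negPf ef) mef !orbT.
- move=> y; rewrite /= mrel_vertex /mrel => yD /and3P[_ _ /orP[/eqP->|fy]] yf.
    by rewrite eqxx in yf.
  by rewrite eD yD dom // orbT.
pose L : pred X := fun g => [&& g != f, mrel D g g & mrel D f g].
have LE g : L g = (g \in [set g in D | [disjoint f & g]]).
  rewrite /L mrel_vertex /mrel fD !inE eq_sym; case: eqP => [<-|_] /=; last by case: (g \in D).
  by rewrite -setI_eq0 setIid; apply/esym; rewrite -cards_eq0 (pD _ fD) andbF.
have hB : heq (@restr X L) (mcpx [set g in D | [disjoint f & g]]).
  apply: heq_eqrel => g h; rewrite /restr_rel !LE /= /mrel !inE.
  by case: (g \in D); case: (h \in D); rewrite /= ?andbF.
have [H|[d hd]] := hL.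
  by move: (H g0); rewrite /= mrel_vertex inE g0D fg0.
apply: (@htype_link _ _ _ _ (map S d)).
- exact: conn_eqrel (@restr_delete D f) cD.
- exact: htype_heq (heq_sym (restr_mcpx _ _)) hD.
- by rewrite /= /restr_rel /= ef mrel_vertex.
- by [].
- apply: heq_trans (susp_flat d); apply: ext_heq; exact: heq_trans hB hd.
- by apply/allP => _ /mapP[k _ ->].
Qed.

(** * Four consecutive edges of a path, seen in the graph *)

Section Path.
Variables (D : {set {set V}}) (x v1 v2 v3 v4 : V).
Hypothesis pD : pairs D.
Hypotheses (a1 : madj D x v1) (a2 : madj D v1 v2) (a3 : madj D v2 v3) (a4 : madj D v3 v4).
Hypotheses (N1 : forall t, madj D v1 t -> t = x \/ t = v2)
  (N2 : forall t, madj D v2 t -> t = v1 \/ t = v3)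
  (N3 : forall t, madj D v3 t -> t = v2 \/ t = v4).
Hypothesis vU : uniq [:: x; v1; v2; v3; v4].

Let e1 := [set x; v1].
Let e2 := [set v1; v2].
Let e3 := [set v2; v3].
Let e4 := [set v3; v4].
Let D' := D :\: [set e1; e2; e3; e4].

Let e1D : e1 \in D. Proof. by case/andP: a1. Qed.
Let e2D : e2 \in D. Proof. by case/andP: a2. Qed.
Let e3D : e3 \in D. Proof. by case/andP: a3. Qed.
Let e4D : e4 \in D. Proof. by case/andP: a4. Qed.

Let neqs : [/\ [/\ x != v1, x != v2, x != v3 & x != v4], [/\ v1 != v2, v1 != v3 & v1 != v4],
  v2 != v3 /\ v2 != v4 & v3 != v4].
Proof.
move: vU; rewrite /= !inE !negb_or !andbT.
by case/and4P=> /and4P[-> -> -> ->] /and3P[-> -> ->] /andP[-> ->] ->.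
Qed.

Let at1 g : g \in D -> v1 \in g -> g = e1 \/ g = e2.
Proof.
move=> gD v1g; have [w -> /N1[->|->]] := pairs_other pD gD v1g; last by right.
by left; rewrite setUC.
Qed.
Let at2 g : g \in D -> v2 \in g -> g = e2 \/ g = e3.
Proof.
move=> gD v1g; have [w -> /N2[->|->]] := pairs_other pD gD v1g; last by right.
by left; rewrite setUC.
Qed.
Let at3 g : g \in D -> v3 \in g -> g = e3 \/ g = e4.
Proof.
move=> gD v1g; have [w -> /N3[->|->]] := pairs_other pD gD v1g; last by right.
by left; rewrite setUC.
Qed.

Let memE : [/\ v1 \notin e3, v1 \notin e4, v2 \notin e1, v2 \notin e4 &
  [/\ v3 \notin e1, v3 \notin e2, x \notin e2, x \notin e3 & x \notin e4]].
Proof.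
have [[x1 x2 x3 x4] [n12 n13 n14] [n23 n24] n34] := neqs.
rewrite /e1 /e2 /e3 /e4 !inE !negb_or; split; last split.
all: by apply/andP; split; rewrite // eq_sym.
Qed.

Let eU : uniq [:: e1; e2; e3; e4].
Proof.
have [m13 m14 m21 m24 [m31 m32 mx2 mx3 mx4]] := memE.
have xe1 : x \in e1 by exact: set21.
have v2e2 : v2 \in e2 by exact: set22.
have v2e3 : v2 \in e3 by exact: set21.
have v1e2 : v1 \in e2 by exact: set21.
rewrite /= !inE !negb_or !andbT; apply/and3P; split.
- by apply/and3P; split; apply: contraTneq xe1 => ->.
- by apply/andP; split; apply: contraTneq v1e2 => ->.
- by apply: contraTneq v2e3 => ->.
Qed.

Let X := mcpx D.

Let n12 : ~~ crel (c := X) e1 e2.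
Proof.
move: eU; rewrite /= !inE !negb_or /mrel => /andP[/andP[/negPf-> _] _] /=.
rewrite -setI_eq0 !negb_and; apply/orP; right; apply/orP; right; apply/set0Pn; exists v1.
by rewrite !inE eqxx orbT.
Qed.
Let n23 : ~~ crel (c := X) e2 e3.
Proof.
move: eU; rewrite /= !inE !negb_or /mrel => /and3P[_ /andP[/negPf-> _] _] /=.
rewrite -setI_eq0 !negb_and; apply/orP; right; apply/orP; right; apply/set0Pn; exists v2.
by rewrite !inE eqxx orbT.
Qed.
Let n34 : ~~ crel (c := X) e3 e4.
Proof.
move: eU; rewrite /= !inE !negb_or /mrel => /and4P[_ _ /negPf-> _] /=.
rewrite -setI_eq0 !negb_and; apply/orP; right; apply/orP; right; apply/set0Pn; exists v3.
by rewrite !inE eqxx orbT.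
Qed.
Let c14 : crel (c := X) e1 e4.
Proof.
have [m13 m14 m21 m24 [m31 m32 mx2 mx3 mx4]] := memE.
by rewrite /= /mrel e1D e4D disjoints2 mx4 m14 orbT.
Qed.
Let c2 (y : {set V}) : mrel D y y -> y != e1 -> y != e3 -> crel (c := X) e2 y.
Proof.
rewrite mrel_vertex => yD y1 y3; rewrite /= /mrel e2D yD disjoints2 eq_sym.
have [//|y2] := eqVneq y e2; rewrite /=; apply/andP; split.
  by apply/negP => /(at1 yD)[E|E]; [rewrite E eqxx in y1|rewrite E eqxx in y2].
by apply/negP => /(at2 yD)[E|E]; [rewrite E eqxx in y2|rewrite E eqxx in y3].
Qed.
Let c3 (y : {set V}) : mrel D y y -> y != e2 -> y != e4 -> crel (c := X) e3 y.
Proof.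
rewrite mrel_vertex => yD y2 y4; rewrite /= /mrel e3D yD disjoints2 eq_sym.
have [//|y3] := eqVneq y e3; rewrite /=; apply/andP; split.
  by apply/negP => /(at2 yD)[E|E]; [rewrite E eqxx in y2|rewrite E eqxx in y3].
by apply/negP => /(at3 yD)[E|E]; [rewrite E eqxx in y3|rewrite E eqxx in y4].
Qed.

Definition contracted := Cpx (@contract_sym X e1 e2 e3 e4).

Lemma heq_contracted : heq X (susp contracted).
Proof.
apply: heq_path => //; rewrite /= ?mrel_vertex //.
by move=> f g; rewrite /mrel eqxx => /and3P[-> _ _].
Qed.

Let D'E g : (g \in D') = [&& g != e1, g \notin [:: e2; e3; e4] & g \in D].
Proof. by rewrite !inE !negb_or -!andbA. Qed.

Lemma card_path : #|D'| < #|D|.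
Proof.
apply: proper_card; rewrite properE subsetDl /=; apply/negP => /subsetP/(_ _ e1D).
by rewrite D'E eqxx.
Qed.

(** Contraction makes the merged edge [e1] parallel to the existing edge [d], which dominates it, so
    [heq_dominated] applies to the contracted complex. The wedge is treated after the outer
    suspension: its first part is then connected, and the second, a double suspension, has only
    spheres of positive dimension, even when the link of [e1] is empty. *)
Lemma htype_path_adj : madj D x v4 -> htype (mcpx D') ->
  (forall D0 : {set {set V}}, D0 \subset D' -> htype (mcpx D0)) -> htype X.
Proof.
move=> a5 hD' IH; apply: htype_heq (heq_sym heq_contracted) _.
have [m13 m14 m21 m24 [m31 m32 mx2 mx3 mx4]] := memE.
have [[x1 x2 x3 x4] [n12' n13 n14] [n23' n24] n34'] := neqs.
pose d := [set x; v4]; have dD : d \in D by case/andP: a5.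
have nd v : v != x -> v != v4 -> v \notin d by rewrite !inE negb_or => -> ->.
have d1 : d != e1.
  by apply: contraTneq (set22 x v1) => E; rewrite -/e1 -E nd // eq_sym.
have d234 : d \notin [:: e2; e3; e4].
  have xd : x \in d := set21 _ _.
  by rewrite !inE !negb_or; apply/and3P; split; apply: contraTneq xd => ->.
have e1n : e1 \notin [:: e2; e3; e4] by move: eU => /= /andP[].
pose cr : rel {set V} := @contract_rel X e1 e2 e3 e4.
have CE (f g : {set V}) : f != e1 -> g != e1 -> cr f g = mrel D' f g.
  move=> f1 g1; rewrite /cr /contract_rel /= /mrel !D'E f1 g1 (negPf f1) (negPf g1) /= andbT.
  by case: (f \notin _); case: (g \notin _); rewrite //= ?andbF.
have v1c : cr e1 e1.
  by rewrite /cr /contract_rel e1n eqxx /= mrel_vertex e1D mrel_sym (c14 : mrel D e1 e4).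
have ndc : ~~ cr d e1.
  rewrite /cr /contract_rel /= /mrel (negPf d1) /= !negb_and disjoints2.
  by rewrite (set21 x v1) /= !orbT.
have dc : cr d d by rewrite CE // mrel_vertex D'E d1 d234.
apply: htype_heq (ext_heq _ _ (heq_sym (@heq_dominated contracted d e1 dc v1c ndc _))) _.
  move=> g gg e1g g1; rewrite -[crel _ _]/(cr d g) (CE _ _ d1 g1); move: e1g.
  rewrite /= /contract_rel eqxx /= => /and5P[_ gn e1g e4g _]; move: e1g e4g; rewrite /mrel !D'E g1 gn d1 d234 dD /= e1D e4D /=.
  case/andP=> -> /orP[/eqP E|]; first by rewrite -E eqxx in g1.
  rewrite disjoints2 => /andP[xg _] /orP[/eqP E|].
    by move: gn; rewrite -E !inE eqxx !orbT.
  by rewrite !disjoints2 xg => /andP[_ ->]; rewrite orbT.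
set A := restr _; set B := restr _.
apply: htype_heq (heq_sym (susp_link _ _)) _ => //.
  by rewrite /= /restr_rel /= d1.
have hA : heq A (mcpx D').
  apply: heq_eqrel => f g; rewrite /restr_rel /=.
  have e1D' : e1 \notin D' by rewrite D'E eqxx.
  have [->|f1] := eqVneq f e1; first by rewrite /mrel (negPf e1D').
  have [->|g1] := eqVneq g e1; first by rewrite /mrel (negPf e1D') /= andbF.
  exact: CE.
have hB : htype (susp B).
  apply: htype_susp; pose L : pred {set V} := fun g => [&& g != e1, cr g g & cr e1 g].
  have LD : [set g | L g] \subset D'.
    apply/subsetP => g; rewrite inE => /and3P[g1 gg _].
    by move: gg; rewrite CE // mrel_vertex.
  apply: htype_heq (IH _ LD); apply: heq_sym; apply: heq_eqrel => f g.
  change (restr_rel cr L f g = mrel [set h | L h] f g).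
  rewrite /restr_rel /mrel !inE -!/(L _).
  case Lf : (L f) => //; case Lg : (L g) => //=.
  have /and3P[f1 ff _] := Lf; have /and3P[g1 gg _] := Lg.
  rewrite CE // /mrel; move: ff gg; rewrite !CE // !mrel_vertex => -> ->.
  by [].
have [H|[d' hd]] := hB.
  by move: (H (inr true)).
apply: (@htype_link _ _ _ _ (map S d')) => //.
- apply: (@conn_susp A d); by rewrite /= /restr_rel /= d1.
- exact/htype_susp/htype_heq/hD'/heq_sym.
- by rewrite /= /restr_rel /= d1.
- by apply: heq_trans (susp_flat d'); exact: ext_heq.
- by apply/allP => _ /mapP[k _ ->].
Qed.

Let D2 := [set x; v4] |: D'.

Lemma card_path2 : #|D2| < #|D|.
Proof.
have e21 : e1 != e2 by move: eU; rewrite /= inE negb_or => /andP[/andP[]].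
have e1n : e1 \notin e2 |: D' by rewrite in_setU1 negb_or e21 D'E eqxx.
have e2n : e2 \notin D' by rewrite D'E !inE eqxx andbF.
apply: (@leq_trans #|e1 |: (e2 |: D')|).
  by rewrite !cardsU1 e1n e2n ltnS leq_add2r leq_b1.
apply/subset_leq_card/subsetP => g /setU1P[->//|/setU1P[->//|]].
by rewrite D'E => /and3P[].
Qed.

Lemma pairs_path2 : pairs D2.
Proof.
have [[x1 x2 x3 x4] _ _ _] := neqs.
move=> e; rewrite inE D'E => /orP[/set1P->|/and3P[_ _ /pD //]].
by rewrite cards2 x4.
Qed.

(** The graph [D2] arises by contracting [v1], [v2] and [v3] into [x]; its new edge lifts to
    [v3 v4]. *)
Lemma minor_path2 (I : finType) (H : rel I) : minor H (madj D2) -> minor H (madj D).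
Proof.
have [[x1 x2 x3 x4] [n12' n13 n14] [n23' n24] n34'] := neqs.
have sy := @madj_sym D.
pose phi v := if v \in [:: v1; v2; v3] then x else v.
have phi_id v : v \notin [:: v1; v2; v3] -> phi v = v by rewrite /phi => /negPf->.
apply: (@minor_contract _ _ _ _ _ phi) => [u w /andP[uw]|u].
  have x4E : madj D v3 v4 /\ phi v3 = x /\ phi v4 = v4.
    split=> //; rewrite /phi !inE eqxx !orbT; split=> //.
    by rewrite (eq_sym v4) (negPf n14) (eq_sym v4) (negPf n24) (eq_sym v4) (negPf n34').
  have [a34 [p3 p4]] := x4E.
  rewrite inE => /orP[|].
    move/set1P/setP => E; have := E u; have := E w; rewrite !inE !eqxx orbT /=.
    move=> /esym/orP[]/eqP Ew /esym/orP[]/eqP Eu; subst u w.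
    - by rewrite eqxx in uw.
    - by exists v4, v3; rewrite sy.
    - by exists v3, v4.
    - by rewrite eqxx in uw.
  rewrite D'E => /and3P[f1]; rewrite !inE !negb_or => /and3P[f2 f3 f4] fD.
  have notin v : v \in [set u; w] -> v \notin [:: v1; v2; v3].
    move=> vf; rewrite !inE !negb_or; apply/and3P; split; apply/negP => /eqP E.
    - by case: (at1 fD); rewrite -?E // => Ef; [move: f1|move: f2]; rewrite Ef eqxx.
    - by case: (at2 fD); rewrite -?E // => Ef; [move: f2|move: f3]; rewrite Ef eqxx.
    - by case: (at3 fD); rewrite -?E // => Ef; [move: f3|move: f4]; rewrite Ef eqxx.
  by exists u, w; rewrite !phi_id ?notin ?set21 ?set22 // /madj uw.
have xn : x \notin [:: v1; v2; v3] by rewrite !inE !negb_or x1 x2 x3.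
have [->|ux] := eqVneq u x; last first.
  have fib v : phi v == u -> v = u.
    by rewrite /phi; case: ifP => _ /eqP E //; rewrite -E eqxx in ux.
  by move=> v w; rewrite !inE => /fib-> /fib->; exact: connect0.
apply: (@sconn_root _ _ _ x) => // v; rewrite inE /phi.
pose F := [set v | phi v == x].
have st r s : phi r == x -> phi s == x -> madj D r s -> connect (adj_in (madj D) F) r s.
  by move=> r1 s1 rs; apply: connect1; rewrite /adj_in !inE r1 s1.
have px : phi x == x by rewrite phi_id.
have p1 : phi v1 == x by rewrite /phi !inE eqxx.
have p2 : phi v2 == x by rewrite /phi !inE eqxx orbT.
have p3 : phi v3 == x by rewrite /phi !inE eqxx !orbT.
have c1 : connect (adj_in (madj D) F) x v1 by exact: st.
have c2' : connect (adj_in (madj D) F) x v2 by apply: connect_trans c1 _; exact: st.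
have c3' : connect (adj_in (madj D) F) x v3 by apply: connect_trans c2' _; exact: st.
by case: ifP => [|_ /eqP->]; [rewrite !inE => /or3P[]/eqP->|exact: connect0].
Qed.

(** The merged edge plays the role of [d]: an edge of [D'] contains neither [v1] nor [v3], so it
    avoids both [e1] and [e4] exactly when it avoids [x] and [v4]. The renaming is a transposition
    of [e1] and [d] so that it is injective on all of [{set V}]. *)
Lemma htype_path_nadj : ~~ madj D x v4 -> htype (mcpx D2) -> htype X.
Proof.
move=> na hD2; apply: htype_heq (heq_sym heq_contracted) _; apply: htype_susp.
apply: htype_heq hD2; apply: heq_sym.
have [m13 m14 m21 m24 [m31 m32 mx2 mx3 mx4]] := memE.
have [[x1 x2 x3 x4] [n12' n13 n14] [n23' n24] n34'] := neqs.
pose d := [set x; v4]; have dD : d \notin D by move: na; rewrite /madj x4.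
pose s (g : {set V}) := if g == e1 then d else if g == d then e1 else g.
have sK : involutive s.
  move=> g; rewrite /s; have [->|g1] := eqVneq g e1.
    by rewrite eqxx; case: eqP.
  by have [->|gd] := eqVneq g d; rewrite ?eqxx // (negPf g1) (negPf gd).
have e1n : e1 \notin [:: e2; e3; e4] by move: eU => /= /andP[].
have e1d : e1 != d by apply: contraNneq dD => <-.
have vertexC (g : contracted) : crel g g = (g == e1) || (g \in D').
  rewrite /= /contract_rel D'E /= mrel_vertex; have [->|g1] /= := eqVneq g e1.
    by rewrite e1n e1D mrel_sym (c14 : mrel D e1 e4).
  by case: (g \notin _); rewrite //= ?andbT.
have vertex2 g : crel (c := mcpx D2) g g = (g == d) || (g \in D').
  by rewrite /= mrel_vertex !inE.
have D'd g : g \in D' -> g != d.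
  by rewrite D'E => /and3P[_ _ gD]; apply: contraNneq dD => <-.
have D'1 g : g \in D' -> g != e1 by rewrite D'E => /and3P[].
have d' : d \notin D' by rewrite D'E (negPf dD) !andbF.
have e1' : e1 \notin D' by rewrite D'E eqxx.
apply: (@heq_emb_vertex contracted (mcpx D2) s).
- exact: inv_inj.
- move=> g; rewrite vertexC vertex2 /s; have [->|g1] := eqVneq g e1; first by rewrite eqxx.
  have [->|gd] := eqVneq g d; last by rewrite (negPf gd).
  by rewrite (negPf e1d) (negPf e1') (negPf d').
- move=> f g; rewrite !vertexC.
  have side h : h \in D' -> crel (c := mcpx D2) d h = crel (c := contracted) e1 h.
    move=> hD'; have := hD'; rewrite D'E => /and3P[h1 hn hD].
    have v1h : v1 \notin h.
      by apply/negP => /(at1 hD)[E|E]; [rewrite E eqxx in h1|rewrite E !inE eqxx in hn].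
    have v3h : v3 \notin h.
      by apply/negP => /(at3 hD)[E|E]; rewrite E !inE eqxx ?orbT in hn.
    have hd : (d == h) = false by rewrite eq_sym (negPf (D'd _ hD')).
    have he1 : (e1 == h) = false by rewrite eq_sym (negPf h1).
    have he4 : (e4 == h) = false.
      by apply: contraNF hn => /eqP<-; rewrite !inE eqxx !orbT.
    rewrite /= /contract_rel /= /mrel e1n hn eqxx (eq_sym h) he1 e1D hD e4D !in_setU1 eqxx hD'.
    rewrite ?he1 ?he4 ?hd ?orbT /= !disjoints2 v1h v3h /= !andbT.
    by [].
  case/orP=> [/eqP->|fD]; case/orP=> [/eqP->|gD].
  + by rewrite /s eqxx vertex2 eqxx vertexC eqxx.
  + by rewrite {1}/s eqxx /s (negPf (D'1 _ gD)) (negPf (D'd _ gD)) side.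
  + rewrite crel_sym [RHS]crel_sym.
    by rewrite {1}/s eqxx /s (negPf (D'1 _ fD)) (negPf (D'd _ fD)) side.
  + rewrite /s (negPf (D'1 _ gD)) (negPf (D'd _ gD)) (negPf (D'1 _ fD)) (negPf (D'd _ fD)).
    rewrite /= /contract_rel /= /mrel !in_setU1 fD gD !orbT (negPf (D'1 _ gD)) (negPf (D'1 _ fD)).
    move: fD gD; rewrite !D'E => /and3P[_ -> ->] /and3P[_ -> ->].
    by rewrite /= andbT.
- move=> g; rewrite vertex2 => /orP[/eqP->|gD].
    by exists e1; rewrite /s eqxx.
  by exists g; rewrite /s (negPf (D'1 _ gD)) (negPf (D'd _ gD)).
Qed.

End Path.

(** The induction runs over sets [D] of pairs on a fixed vertex type, since deletions, links and
    contractions are all expressed as such sets. *)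
Theorem htype_outerplanar D : pairs D -> ~ minor K4 (madj D) -> ~ minor K23 (madj D) ->
  htype (mcpx D).
Proof.
have [n] := ubnP #|D|; elim: n D => // n IHn D /ltnSE Dn pD nK4 nK23.
have IH D0 : D0 \subset D -> #|D0| < #|D| -> htype (mcpx D0).
  move=> sub lt; have subr : subrel (madj D0) (madj D).
    by move=> x y /andP[xy /(subsetP sub)]; rewrite /madj xy.
  apply: IHn; first exact: leq_trans lt Dn.
  - by move=> e /(subsetP sub)/pD.
  - by move/(minor_sub subr).
  - by move/(minor_sub subr).
have IH1 f : f \in D -> htype (mcpx (D :\ f)).
  by move=> fD; apply: IH; [exact: subsetDl|rewrite [X in _ < X](cardsD1 f) fD].
have [D0|[e0 e0D]] := set_0Vmem D.
  by left=> e; rewrite /= mrel_vertex D0 inE.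
have [/existsP[u /andP[uD /forall_inP Hu]]|/existsPn nofull] :=
    boolP [exists u, (u \in D) && [forall f in D, (f == u) || ~~ [disjoint u & f]]].
  apply: htype_heq (htype_addpt (IH1 _ uD)); apply: heq_sym.
  apply: (@heq_emb (mcpx D) (addpt (mcpx (D :\ u))) (fun e => if e == u then inr tt else inl e)).
  - move=> e f; case: (eqVneq e u) => [->|_]; case: (eqVneq f u) => [->|_] //.
    by case.
  - move=> e f; rewrite /= /mrel; have Huf g : g \in D -> g != u -> [disjoint u & g] = false.
      by move=> gD gu; have := Hu _ gD; rewrite (negPf gu) => /negPf.
    case: (eqVneq e u) => [->|eu]; case: (eqVneq f u) => [->|fu] /=.
    + by rewrite uD.
    + by rewrite uD /=; case fD : (f \in D); rewrite //= Huf.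
    + by case eD : (e \in D); rewrite //= uD (negPf eu) disjoint_sym Huf.
    + by rewrite /mrel !inE eu fu.
  - move=> [e|[]] /= H; last by exists u; rewrite eqxx.
    by move: H; rewrite mrel_vertex !inE => /andP[eu _]; exists e; rewrite (negPf eu).
have {}nofull u : u \in D -> exists2 w, w \in D & [disjoint u & w].
  move=> uD; have := nofull u; rewrite uD /= => /forall_inPn[w wD].
  by rewrite negb_or negbK => /andP[_ uw]; exists w.
(* Both the deletion of [f] and the link of [f] have fewer edges. As no edge meets all the others,
   the deletion is connected and the link is not empty. *)
have caseA e f : e \in D -> f \in D -> e != f -> ~~ [disjoint e & f] ->
    (forall g, g \in D -> g != f -> [disjoint f & g] -> [disjoint e & g]) -> htype (mcpx D).
  move=> eD fD ef mef dom; apply: (htype_dominated pD eD fD mef ef dom) => //.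
  - exact: conn_delete pD eD fD ef mef dom nofull.
  - exact: IH1.
  - exact: nofull.
  - apply: IH; first by apply/subsetP => g; rewrite inE => /andP[].
    apply: proper_card; apply/properP; split; first by apply/subsetP => g; rewrite inE => /andP[].
    by exists f; rewrite // inE fD -setI_eq0 setIid -cards_eq0 pD.
(* Now [e] itself lies in the link of [f], and the rest of that link is joined to it: the link is a
   cone and [f] can be deleted. *)
have caseB e f : e \in D -> f \in D -> e != f -> [disjoint e & f] ->
    (forall g, g \in D -> [disjoint f & g] -> g = e \/ [disjoint e & g]) -> htype (mcpx D).
  move=> eD fD ef dis dom; apply: htype_heq (IH1 _ fD); apply: heq_sym.
  apply: heq_trans (restr_mcpx D f); apply: (@heq_delete (mcpx D) e f) => //=.
  - by rewrite mrel_vertex.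
  - by rewrite /mrel eD fD dis orbT.
  - move=> g; rewrite mrel_vertex => gD; rewrite /mrel eD fD gD /=.
    case/orP=> [/eqP<-|/(dom _ gD)[->|->]]; rewrite ?dis ?eqxx ?orbT //.
(* An edge with an end [u] of degree 1 dominates every other edge at its end [v]. If there is none,
   it is disjoint from all other edges and the complex is a cone. *)
have [/existsP[u /existsP[v /andP[uv /forallP nw]]]|nleaf] :=
    boolP [exists u, exists v, madj D u v && [forall w, madj D u w ==> (w == v)]].
  have /andP[uvn eD] := uv; set e := [set u; v] in eD.
  have only g : g \in D -> u \in g -> g = e.
    move=> gD ug; have [w -> uw] := pairs_other pD gD ug.
    by have := nw w; rewrite uw => /eqP->.
  have disE g : g \in D -> g != e -> v \notin g -> [disjoint e & g].
    move=> gD ge vg; rewrite disjoints2 vg andbT; apply/negP => /(only _ gD) E.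
    by rewrite E eqxx in ge.
  have [/existsP[f /and3P[fD fe vf]]|/existsPn nf] :=
      boolP [exists f, [&& f \in D, f != e & v \in f]].
    apply: (caseA e f) => //; first by rewrite eq_sym.
      by rewrite disjoints2 vf andbF.
    move=> g gD gf fg; apply: disE => //; last by rewrite (disjointFr fg vf).
    by apply: contraTneq fg => ->; rewrite disjoint_sym disjoints2 vf andbF.
  have iso g : g \in D -> g != e -> [disjoint e & g].
    by move=> gD ge; apply: disE => //; have := nf g; rewrite gD ge.
  have [f fD ef] := nofull _ eD; apply: (caseB e f) => //.
    by apply: contraTneq ef => <-; rewrite disjoints2 set21.
  by move=> g gD _; have [->|ge] := eqVneq g e; [left|right; exact: iso].
have deg2 u v : madj D u v -> exists2 w, w != v & madj D u w.
  move=> uv; move: nleaf; rewrite negb_exists => /forallP/(_ u).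
  rewrite negb_exists => /forallP/(_ v); rewrite uv => /forallPn[w].
  by rewrite negb_imply => /andP[uw wv]; exists w.
have /eqP/cards2P[x0 [y0 [xy0 E0]]] := pD _ e0D.
have a0 : madj D x0 y0 by rewrite /madj xy0 -E0.
have neq x y : madj D x y -> x != y by case/andP.
have inD x y : madj D x y -> [set x; y] \in D by case/andP.
have [] := reducible (@madj_sym D) (@madj_irr D) nK4 nK23 deg2 a0.
(* A triangle: an edge that avoids [x] and [y] cannot contain [v]. *)
- move=> [x [y [v [xy xv vy Nv]]]].
  apply: (caseA [set x; v] [set x; y]); rewrite ?inD //.
  + apply: contraTneq (set22 x v) => ->; rewrite !inE negb_or (neq _ _ vy) andbT.
    by rewrite eq_sym neq.
  + by rewrite disjoints2 set21.
  + move=> g gD gf; rewrite !disjoints2 => /andP[xg yg]; rewrite xg /=.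
    apply/negP => vg; have [w E /Nv[Ew|Ew]] := pairs_other pD gD vg.
      by move: xg; rewrite E Ew set22.
    by move: yg; rewrite E Ew set22.
(* A quadrilateral: an edge that avoids [x] and [y] but contains [v1] or [v2] is the edge
   [v1 v2]. *)
- move=> [x [y [v1 [v2 [[xy x1 v12 v2y] N1 N2 U]]]]].
  apply: (caseB [set v1; v2] [set x; y]); rewrite ?inD //.
  + apply: contraTneq (set21 x y) => <-; rewrite !inE negb_or.
    by move: U; rewrite /= !inE !negb_or => /and3P[/and3P[-> -> _] _ _].
  + move: U; rewrite /= disjoints2 !inE !negb_or !andbT => /and3P[/and3P[x1' x2 _] /andP[_ ->] ->].
    by rewrite eq_sym x1' eq_sym x2.
  + move=> g gD; rewrite !disjoints2 => /andP[xg yg].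
    have [v1g|_] := boolP (v1 \in g).
      have [w E /N1[Ew|Ew]] := pairs_other pD gD v1g; last by left; rewrite E Ew.
      by move: xg; rewrite E Ew set22.
    have [v2g|_] := boolP (v2 \in g); last by right.
    have [w E /N2[Ew|Ew]] := pairs_other pD gD v2g; first by left; rewrite E Ew setUC.
    by move: yg; rewrite E Ew set22.
- move=> [x [v1 [v2 [v3 [v4 [[a1 a2 a3 a4] N1 N2 N3 U]]]]]].
  have lt := card_path v2 v3 v4 a1.
  have [x4|x4] := boolP (madj D x v4).
    apply: (htype_path_adj pD a1 a2 a3 a4 N1 N2 N3 U x4); first by apply: IH => //; exact: subsetDl.
    move=> D0 sub; apply: IH; first exact: subset_trans sub (subsetDl _ _).
    exact: leq_ltn_trans (subset_leq_card sub) lt.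
  apply: (htype_path_nadj pD a1 a2 a3 a4 N1 N2 N3 U x4); apply: IHn.
  + exact: leq_trans (card_path2 a1 a2 U) Dn.
  + exact: pairs_path2 pD U.
  + by move/(minor_path2 pD a1 a2 a3 a4 N1 N2 N3 U).
  + by move/(minor_path2 pD a1 a2 a3 a4 N1 N2 N3 U).
Qed.
End Matching.

From mathcomp Require Import all_order all_algebra.
From mathcomp Require Import all_classical all_reals all_analysis.
From mathcomp Require Import homotopy ring lra.
From Stdlib Require Import Btauto.
Import Order.TTheory GRing.Theory Num.Theory.
Import numFieldNormedType.Exports.

Local Open Scope classical_set_scope.
Local Open Scope ring_scope.

(** * A van Kampen obstruction for connected sets in the plane *)

Section Crossing.
Variable R : realType.
Implicit Types z w p q : R * R.

Definition upper z := (0 < z.2) || ((z.2 == 0) && (0 < z.1)).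
Definition det z w := z.1 * w.2 - z.2 * w.1.
Definition dot z w := z.1 * w.1 + z.2 * w.2.

(* Does the segment from [z] to [w] cross the positive [x]-axis?  With [upper] in
   place of a strict inequality no vector has to be avoided. *)
Definition crossing z w :=
  (upper z != upper w) && (if upper z then det z w < 0 else 0 < det z w).

Lemma upperN z : z != 0 -> upper (- z) = ~~ upper z.
Proof.
case: z => a b; rewrite /upper /= -[0]/(0, 0) xpair_eqE negb_and !oppr_gt0 oppr_eq0.
case: (ltgtP b 0) => //= _; by case: (ltgtP a 0).
Qed.

Lemma detC z w : det z w = - det w z.
Proof. rewrite /det; ring. Qed.

Lemma crossingC z w : crossing z w = crossing w z.
Proof.
rewrite /crossing eq_sym detC; case: (upper z); case: (upper w) => //=.
  by rewrite oppr_lt0.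
by rewrite oppr_gt0.
Qed.

Lemma dotC z w : dot z w = dot w z.
Proof. rewrite /dot; ring. Qed.

Lemma upper_cone (a b : R) z w : 0 < a -> 0 < b -> upper z -> upper w ->
  upper (a * z.1 + b * w.1, a * z.2 + b * w.2).
Proof.
rewrite /upper /= => a0 b0 /orP zu /orP wu.
have [z2|[]] : 0 < z.2 \/ z.2 = 0 /\ 0 < z.1.
- by case: zu => [|/andP[/eqP]]; auto.
- have : 0 <= w.2 by case: wu => [/ltW//|/andP[/eqP->]].
  by move=> w2; apply/orP; left; nra.
move=> z20 z1; case: wu => [w2|/andP[/eqP w2 w1]].
  by apply/orP; left; rewrite z20; nra.
apply/orP; right; rewrite z20 w2 !mulr0 addr0 eqxx /=; nra.
Qed.

Lemma upper_cone_eq (a b : R) z w : 0 < a -> 0 < b -> z != 0 -> w != 0 ->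
  upper z = upper w -> upper (a * z.1 + b * w.1, a * z.2 + b * w.2) = upper z.
Proof.
move=> a0 b0 z0 w0; case uz : (upper z) => /esym uw; first exact: upper_cone.
have uz' : upper (- z) by rewrite upperN ?uz.
have uw' : upper (- w) by rewrite upperN ?uw.
have := upper_cone a0 b0 uz' uw'.
rewrite (_ : (_, _) = - (a * z.1 + b * w.1, a * z.2 + b * w.2)); last first.
  by congr (_, _) => /=; rewrite !mulrN -opprD.
have [->|n0] := eqVneq (a * z.1 + b * w.1, a * z.2 + b * w.2) 0.
  by rewrite oppr0 /upper /= ltxx /= andbF.
by rewrite upperN // => /negbTE.
Qed.

Lemma dot_neq0 z w : 0 < dot z w -> z != 0.
Proof. by apply: contraTneq => ->; rewrite /dot /= !mul0r addr0 ltxx. Qed.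

Lemma det0_upper z w : 0 < dot z w -> det z w = 0 -> upper z = upper w.
Proof.
move=> d0 det0; have z0 := dot_neq0 d0; have w0 : w != 0 by apply: (@dot_neq0 _ z); rewrite dotC.
have N0 : 0 < z.1 ^+ 2 + z.2 ^+ 2.
  rewrite lt0r paddr_eq0 ?sqr_ge0 // !sqrf_eq0 addr_ge0 ?sqr_ge0 // andbT.
  by move: z0; case: (z) => u v; rewrite -[0]/(0, 0) xpair_eqE.
have scale (c : R) (v : R * R) : 0 < c -> v != 0 -> upper (c * v.1, c * v.2) = upper v.
  move=> c0 v0; rewrite -(upper_cone_eq (divr_gt0 c0 (ltr0Sn R 1)) (divr_gt0 c0 (ltr0Sn R 1)) v0 v0 erefl).
  by congr upper; congr (_, _); field.
rewrite -(scale (dot z w) z) // -(scale (z.1 ^+ 2 + z.2 ^+ 2) w) //.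
have E1 : (z.1 ^+ 2 + z.2 ^+ 2) * w.1 = dot z w * z.1 - det z w * z.2 by rewrite /dot /det; ring.
have E2 : (z.1 ^+ 2 + z.2 ^+ 2) * w.2 = dot z w * z.2 + det z w * z.1 by rewrite /dot /det; ring.
by rewrite E1 E2 det0 !mul0r subr0 addr0.
Qed.

(** Otherwise a positive combination of [w] and [w'], weighted by the two determinants, points in
    the direction of [z]; but it lies in the half-plane of [w] and [w']. *)
Lemma det_sign z w w' : 0 < dot z w -> 0 < dot z w' -> upper w = upper w' ->
  upper z != upper w -> ~ (det z w < 0 /\ 0 < det z w').
Proof.
move=> d d' u uz [n p].
have w0 : w != 0 by apply: (@dot_neq0 _ z); rewrite dotC.
have w0' : w' != 0 by apply: (@dot_neq0 _ z); rewrite dotC.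
have m : 0 < - det z w by rewrite oppr_gt0.
have := upper_cone_eq p m w0 w0' u.
set c := (_, _) => uc; have : upper z = upper c.
  apply: det0_upper; rewrite /dot /det /c /=.
    have -> : z.1 * (det z w' * w.1 + - det z w * w'.1) + z.2 * (det z w' * w.2 + - det z w * w'.2)
      = det z w' * dot z w + - det z w * dot z w' by rewrite /dot; ring.
    by rewrite addr_gt0 // mulr_gt0.
  rewrite /det; ring.
by rewrite uc => E; rewrite E eqxx in uz.
Qed.

Lemma crossing_eq z w w' : 0 < dot z w -> 0 < dot z w' -> upper w = upper w' ->
  crossing z w = crossing z w'.
Proof.
move=> d d' u; rewrite /crossing -u; have [//|uz] := eqVneq (upper z) (upper w) => /=.
have n : det z w != 0 by apply: contraNneq uz => /(det0_upper d) ->.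
have n' : det z w' != 0.
  by apply: contraNneq uz => /(det0_upper d') ->; rewrite u.
have uz' : upper z != upper w' by rewrite -u.
have s := det_sign d d' u uz; have s' := det_sign d' d (esym u) uz'.
move: n n'; rewrite !neq_lt => /orP[n|n] /orP[n'|n']; case: (upper z);
  rewrite ?n ?n' ?(lt_gtF n) ?(lt_gtF n') //; by [case: s|case: s'].
Qed.

(** Two of the three vectors lie in the same half-plane, and [crossing_eq] makes them
    interchangeable as seen from the third. The positive scalar products exclude a triangle around
    the origin. *)
Lemma crossing_trans z1 z2 z3 : 0 < dot z1 z2 -> 0 < dot z2 z3 -> 0 < dot z1 z3 ->
  crossing z1 z2 (+) crossing z2 z3 = crossing z1 z3.
Proof.
move=> d12 d23 d13; have same z w : upper z = upper w -> crossing z w = false.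
  by rewrite /crossing => ->; rewrite eqxx.
have d21 : 0 < dot z2 z1 by rewrite dotC.
have d31 : 0 < dot z3 z1 by rewrite dotC.
have d32 : 0 < dot z3 z2 by rewrite dotC.
have [e12|n12] := eqVneq (upper z1) (upper z2).
  by rewrite same //= crossingC [RHS]crossingC; exact: crossing_eq.
have [e23|n23] := eqVneq (upper z2) (upper z3).
  by rewrite (same _ _ e23) addbF; exact: crossing_eq.
have e13 : upper z1 = upper z3.
  by move: n12 n23; case: (upper z1); case: (upper z2); case: (upper z3).
by rewrite (same _ _ e13) crossingC (crossing_eq d21 d23 e13) addbb.
Qed.

Lemma crossing_upper z w : 0 < dot z w ->
  crossing z w (+) crossing (- z) (- w) = upper z (+) upper w.
Proof.
move=> d; have z0 := dot_neq0 d; have w0 : w != 0 by apply: (@dot_neq0 _ z); rewrite dotC.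
have detN : det (- z) (- w) = det z w by rewrite /det /=; ring.
rewrite /crossing !upperN // detN.
have [E|ne] := eqVneq (upper z) (upper w); first by rewrite E eqxx /= addbb.
have n : det z w != 0 by apply: contraNneq ne => /(det0_upper d) ->.
move: n; rewrite neq_lt => /orP[] n; move: ne; case: (upper z); case: (upper w) => //= _;
  by rewrite n (lt_gtF n).
Qed.

(** The norm is the maximum of the coordinates. The coordinate that attains it contributes more than
    [e ^+ 2] to the scalar product, and the other one at least [- e ^+ 2 / 4]. *)
Lemma dot_close z w (e : R) : `|z - w| < e -> e + e <= `|z| -> 0 < dot z w.
Proof.
case: z => a b; case: w => c d; rewrite /dot /= !prod_normE /=.
rewrite gt_max => /andP[h1 h2]; rewrite le_max => h.
have e0 : 0 < e by apply: le_lt_trans h1.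
move: h1 h2; rewrite !ltr_norml => /andP[h1 h2] /andP[h3 h4].
have key (x y : R) : - e < x - y -> x - y < e -> 0 <= 4 * (x * y) + e ^+ 2.
  move=> k1 k2; suff : (x - y) ^+ 2 <= e ^+ 2 by move=> k; have := sqr_ge0 (x + y); nra.
  by nra.
have big (x y : R) : - e < x - y -> x - y < e -> e + e <= `|x| -> e ^+ 2 < x * y.
  move=> k1 k2; have [x0|x0] := ger0P x => k; nra.
have e2 : 0 < e ^+ 2 by rewrite exprn_gt0.
case/orP: h => h.
  by have := big a c h1 h2 h; have := key b d h3 h4; nra.
by have := big b d h3 h4 h; have := key a c h1 h2; nra.
Qed.

End Crossing.

(** * Crossing parities of chains of points *)

Section Chains.
Variable R : realType.
Implicit Types (a b w : R * R) (s t : seq (R * R)) (e : R).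

Fixpoint cross a s := if s is b :: s' then crossing a b (+) cross b s' else false.

(** Crossings of the chain with the horizontal ray from [w] to the right; [parityN] counts those
    with the ray to the left. *)
Definition parity w a s := cross (a - w) [seq x - w | x <- s].
Definition parityN w a s := cross (w - a) [seq w - x | x <- s].
Definition step e : rel (R * R) := fun a b => `|a - b| < e.
(** Two simultaneous steps change a difference [a - b] by less than [e + e], and [dot_close] wants
    twice that bound: hence the factor 4. *)
Definition far e s t := forall x y, x \in s -> y \in t -> e *+ 4 <= `|x - y|.

Lemma step_dot e a a' b b' : `|a - a'| < e -> `|b - b'| < e -> e *+ 4 <= `|a - b| ->
  0 < dot (a - b) (a' - b').
Proof.
move=> h h' f; apply: (@dot_close _ _ _ (e + e)); last by rewrite -!mulr2n -mulrnA.
rewrite (_ : _ - _ = (a - a') - (b - b')); last by rewrite !opprB (addrC b' (- a')) addrACA (addrC (- b)).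
by apply: le_lt_trans (ler_normB _ _) _; rewrite ltrD.
Qed.

Lemma far_cons e a s t : far e (a :: s) t -> far e s t.
Proof. by move=> H x y xs yt; apply: H => //; rewrite inE xs orbT. Qed.
Lemma farC e s t : far e s t -> far e t s.
Proof. by move=> H x y xs yt; rewrite distrC; exact: H. Qed.

Lemma grid_square e a a' b b' : 0 < e -> step e a a' -> step e b b' ->
  far e [:: a; a'] [:: b; b'] ->
  crossing (a - b) (a' - b) (+) crossing (a - b') (a' - b') =
  crossing (a - b) (a - b') (+) crossing (a' - b) (a' - b').
Proof.
move=> e0 ha hb f; have zz (x : R * R) : `|x - x| < e by rewrite subrr normr0.
have f1 : e *+ 4 <= `|a - b| by apply: f; rewrite ?inE eqxx.
have f2 : e *+ 4 <= `|a' - b| by apply: f; rewrite ?inE eqxx ?orbT.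
have f3 : e *+ 4 <= `|a - b'| by apply: f; rewrite ?inE eqxx ?orbT.
have d (x y : bool) : x (+) y = y (+) x by exact: addbC.
have E1 := crossing_trans (step_dot ha (zz b) f1) (step_dot (zz a') hb f2) (step_dot ha hb f1).
have E2 := crossing_trans (step_dot (zz a) hb f1) (step_dot ha (zz b') f3) (step_dot ha hb f1).
move: E1; rewrite -E2.
by case: crossing; case: crossing; case: crossing; case: crossing.
Qed.

Lemma strip e a a' b t : 0 < e -> step e a a' -> path (step e) b t ->
  far e [:: a; a'] (b :: t) ->
  crossing (a - b) (a' - b) (+) crossing (a - last b t) (a' - last b t) =
  parityN a b t (+) parityN a' b t.
Proof.
move=> e0 ha; rewrite /parityN; elim: t b => [|b' t IH] b /=; first by rewrite addbb.
case/andP=> hb pt f; have := IH b' pt _.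
have f' : far e [:: a; a'] (b' :: t) by apply/farC/(@far_cons _ b)/farC.
move=> /(_ f'); have := @grid_square e a a' b b' e0 ha hb.
have f2 : far e [:: a; a'] [:: b; b'].
  by move=> x y xa yb; apply: f => //; move: yb; rewrite !inE => /orP[]->; rewrite ?orbT.
move=> /(_ f2).
set c1 := crossing _ _; set c2 := crossing _ _; set c3 := crossing _ _; set c4 := crossing _ _.
set c5 := crossing _ _; set p1 := cross _ _; set p2 := cross _ _.
by case: c1; case: c2; case: c3; case: c4; case: c5; case: p1; case: p2.
Qed.

(** A discrete form of Stokes' theorem. The differences of points of the two chains form a grid that
    stays away from the origin; each small square contributes 0 by [crossing_trans], hence so does
    the boundary of the grid. Along two sides the first chain moves, along the other two the second
    one. *)
Lemma grid e a s b t : 0 < e -> path (step e) a s -> path (step e) b t ->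
  far e (a :: s) (b :: t) ->
  parity b a s (+) parity (last b t) a s = parityN a b t (+) parityN (last a s) b t.
Proof.
move=> e0 + pt; rewrite /parity; elim: s a => [|a' s IH] a /=; first by rewrite addbb.
case/andP=> ha ps f.
have := IH a' ps (far_cons f).
have f2 : far e [:: a; a'] (b :: t).
  by move=> x y xa yb; apply: f => //; move: xa; rewrite !inE => /orP[]->; rewrite ?orbT.
have := strip e0 ha pt f2.
set c1 := crossing _ _; set c2 := crossing _ _; set p1 := cross _ _; set p2 := cross _ _.
set p3 := parityN _ _ _; set p4 := parityN _ _ _; set p5 := parityN _ _ _.
by case: c1; case: c2; case: p1; case: p2; case: p3; case: p4; case: p5.
Qed.

Lemma parityNE e w a s : 0 < e -> path (step e) a s -> far e [:: w] (a :: s) ->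
  parityN w a s = parity w a s (+) (upper (a - w) (+) upper (last a s - w)).
Proof.
move=> e0; rewrite /parityN /parity; elim: s a => [|a' s IH] a /=; first by rewrite addbb.
case/andP=> ha ps f.
have f' : far e [:: w] (a' :: s) by apply/farC/(@far_cons _ a)/farC.
rewrite (IH _ ps f').
have d : 0 < dot (a - w) (a' - w).
  apply: step_dot ha _ _; first by rewrite subrr normr0.
  by rewrite distrC; apply: f; rewrite inE eqxx.
have := crossing_upper d; rewrite !opprB.
set c1 := crossing _ _; set c2 := crossing _ _; set u := upper _; set u' := upper _.
set p := cross _ _; set u2 := upper _.
by case: c1; case: c2; case: u; case: u'; case: u2; case: p.
Qed.

(** The substitute for the statement that disjoint edges cross an even number of times. It relates
    the crossings of each chain with the rays from the ends of the other one to the relative heights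
    of the four ends; all rays now point to the right, which is where the heights come from. *)
Lemma independent_parity e a s b t : 0 < e -> path (step e) a s -> path (step e) b t ->
  far e (a :: s) (b :: t) ->
  (parity b a s (+) parity (last b t) a s) (+) (parity a b t (+) parity (last a s) b t) =
  (upper (b - a) (+) upper (last b t - a)) (+)
  (upper (b - last a s) (+) upper (last b t - last a s)).
Proof.
move=> e0 ps pt f; rewrite (grid e0 ps pt f).
have f1 w : w \in a :: s -> far e [:: w] (b :: t).
  by move=> ws x y /[!inE]/eqP->; exact: f.
rewrite (parityNE e0 pt (f1 a (mem_head _ _))) (parityNE e0 pt (f1 _ (mem_last a s))).
set p := parity _ _ _; set p' := parity _ _ _; set u1 := upper _; set u2 := upper _.
set u3 := upper _; set u4 := upper _.
by case: p; case: p'; case: u1; case: u2; case: u3; case: u4.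
Qed.

(** The points reachable from [a] by such chains form a relatively open and closed subset of [K], as
    steps can be taken in both directions. *)
Lemma connected_chain (K : set (R * R)) a b e : connected K -> K a -> K b -> 0 < e ->
  exists s, [/\ path (step e) a s, last a s = b & forall x, x \in a :: s -> K x].
Proof.
move=> cK Ka Kb e0.
pose P x := K x /\ exists s, [/\ path (step e) a s, last a s = x & forall x, x \in a :: s -> K x].
suff EP : P = K by have [] : P b by rewrite EP.
have step1 x y : P x -> K y -> `|x - y| < e -> P y.
  move=> [Kx [s [ps lx sK]]] Ky xy; split=> //; exists (rcons s y).
  rewrite rcons_path ps last_rcons lx; split=> // z.
  by rewrite -rcons_cons mem_rcons inE => /orP[/eqP->|/sK].
apply: cK.
- by exists a; split=> //; exists [::]; split=> // x; rewrite inE => /eqP->.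
- exists (\bigcup_(x in P) ball x e).
    by apply: bigcup_open => x _; exact: ball_open.
  apply/seteqP; split=> [x Px|y [Ky [x Px]]].
    by split; [case: Px|exists x => //; exact: ballxx].
  by rewrite -ball_normE /= => xy; exact: step1 Px Ky xy.
- exists (~` \bigcup_(x in K `\` P) ball x e).
    by apply: open_closedC; apply: bigcup_open => x _; exact: ball_open.
  apply/seteqP; split=> [y Py|y [Ky nb]].
    split; first by case: Py.
    move=> [x [Kx nPx]]; rewrite -ball_normE /= distrC => yx.
    by apply: nPx; exact: step1 Py Kx yx.
  apply: contrapT => nPy; apply: nb; exists y; first by split.
  exact: ballxx.
Qed.

End Chains.

(** * The parity count for K5 and K33 *)

Section Parity.
Variables (r : nat -> nat -> nat -> bool) (h : nat -> nat -> bool).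
Hypothesis hN : forall i j, i != j -> h i j = negb (h j i).

(** Intended meaning: [r w i j] is the parity of the crossings of the edge [i j] with the ray from
    the vertex [w], and [h i j] tells whether the vertex [i] lies above [j]. *)
Definition parity_lhs (q : nat * nat * (nat * nat)) := let: ((i, j), (k, l)) := q in
  xorb (xorb (r k i j) (r l i j)) (xorb (r i k l) (r j k l)).
Definition parity_rhs (q : nat * nat * (nat * nat)) := let: ((i, j), (k, l)) := q in
  xorb (xorb (h k i) (h l i)) (xorb (h k j) (h l j)).

Definition independent_pairs (edges : seq (nat * nat)) :=
  [seq p <- allpairs pair edges edges |
    (index p.1 edges < index p.2 edges)%N && uniq [:: p.1.1; p.1.2; p.2.1; p.2.2]].

Let sum F (s : seq (nat * nat * (nat * nat))) := foldr (fun q b => xorb (F q) b) false s.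

Lemma parity_sum edges :
  (forall i j k l, ((i, j), (k, l)) \in independent_pairs edges ->
     parity_lhs ((i, j), (k, l)) = parity_rhs ((i, j), (k, l))) ->
  sum parity_lhs (independent_pairs edges) = sum parity_rhs (independent_pairs edges).
Proof.
elim: independent_pairs => //= -[[i j] [k l]] s IH H; congr xorb; last first.
  by apply: IH => i' j' k' l' qs; apply: H; rewrite inE qs orbT.
by apply: H; rewrite inE eqxx.
Qed.

(** Orients all values of [h] the same way, so that antisymmetric ones are recognized as negations
    of one atom by [btauto]. *)
Let hE : h = fun i j => if (i < j)%N then h i j else if i == j then h i j else negb (h j i).
Proof.
apply/funext => i; apply/funext => j; case: ifP => // _; case: eqP => // /eqP; exact: hN.
Qed.

(* The van Kampen obstruction: summing the relations over all pairs of disjoint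
   edges of the complete graph on 5 vertices, every [r] occurs twice, while the
   antisymmetric terms contribute once per crossing of the convex drawing. *)
Lemma parity_K5 (edges := [:: (0, 1); (0, 2); (0, 3); (0, 4); (1, 2); (1, 3); (1, 4);
    (2, 3); (2, 4); (3, 4)]%N) :
  ~ (forall i j k l, ((i, j), (k, l)) \in independent_pairs edges ->
     parity_lhs ((i, j), (k, l)) = parity_rhs ((i, j), (k, l))).
Proof.
move=> /parity_sum; let s := eval vm_compute in (independent_pairs edges) in
  change (independent_pairs edges) with s.
set s := (X in sum parity_lhs X); have -> : sum parity_lhs s = false.
  by rewrite /sum /parity_lhs /s /foldr; btauto.
suff -> : sum parity_rhs s = true by [].
by rewrite /sum /parity_rhs /s /foldr hE; lazy -[xorb negb]; btauto.
Qed.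

(** For a vertex [w] off the edge [i j], two edges at [w] avoid [i j], so again every [r] occurs
    twice. Each unordered pair of vertices occurs 4 or 6 times among the [h], so these cancel up to
    the number of reversed occurrences, which is odd. *)
Lemma parity_K33 (edges := [:: (0, 3); (0, 4); (0, 5); (1, 3); (1, 4); (1, 5);
    (2, 3); (2, 4); (2, 5)]%N) :
  ~ (forall i j k l, ((i, j), (k, l)) \in independent_pairs edges ->
     parity_lhs ((i, j), (k, l)) = parity_rhs ((i, j), (k, l))).
Proof.
move=> /parity_sum; let s := eval vm_compute in (independent_pairs edges) in
  change (independent_pairs edges) with s.
set s := (X in sum parity_lhs X); have -> : sum parity_lhs s = false.
  by rewrite /sum /parity_lhs /s /foldr; btauto.
suff -> : sum parity_rhs s = true by [].
by rewrite /sum /parity_rhs /s /foldr hE; lazy -[xorb negb]; btauto.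
Qed.

End Parity.

(** * From disjoint compact connected sets to parity relations *)

Section VanKampen.
Variable R : realType.
Implicit Types (K : set (R * R)).

Lemma compact_separated K K' : compact K -> compact K' -> K `&` K' = set0 ->
  exists2 d : R, 0 < d & forall x y, K x -> K' y -> d <= `|x - y|.
Proof.
move=> cK cK' dis; pose f (p : (R * R) * (R * R)) := `|p.1 - p.2|.
have cf : continuous f.
  by move=> p; apply: cvg_norm; apply: cvgB; [exact: cvg_fst|exact: cvg_snd].
have cI : compact (f @` (K `*` K')).
  by apply: continuous_compact; [exact: continuous_subspaceT|exact: compact_setX].
have clI := compact_closed (@norm_hausdorff R R) cI.
have n0 : (~` (f @` (K `*` K'))) 0.
  move=> [[x y] /= [Kx Ky]] /normr0P; rewrite subr_eq0 => /eqP /= xy.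
  have : (K `&` K') x by split=> //; rewrite xy.
  by rewrite dis.
have : nbhs (0 : R) (~` (f @` (K `*` K'))).
  by apply: open_nbhs_nbhs; split=> //; exact: closed_openC.
rewrite -nbhs_ballE => -[d /= d0 H]; exists d => // x y Kx Ky.
rewrite leNgt; apply/negP => xy; apply: (H `|x - y|); last by exists (x, y).
by rewrite -ball_normE /= sub0r normrN normr_id.
Qed.

Lemma uniform_pos (T : finType) (P : T -> R -> Prop) :
  (forall t, exists2 d, 0 < d & P t d) ->
  (forall t d d', 0 < d' -> d' <= d -> P t d -> P t d') ->
  exists2 d, 0 < d & forall t, P t d.
Proof.
move=> H mono; pose D t := projT1 (cid2 (H t)).
have D0 t : 0 < D t by rewrite /D; case: cid2.
have DP t : P t (D t) by rewrite /D; case: cid2.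
pose d := \big[Order.min/1]_t D t.
have d0 : 0 < d by rewrite /d; elim/big_ind: _ => // x y x0 y0; rewrite lt_min x0.
exists d => // t; apply: (mono _ (D t)) => //.
by rewrite /d (bigD1 t) //= ge_min lexx.
Qed.

(** Finitely many disjoint pairs of compact sets have a common positive distance [d]. Chains with
    steps below [d / 4] inside the connected sets satisfy [independent_parity]. Sets of edges with a
    common end may overlap freely. *)
Lemma van_kampen (I : finType) (H : rel I) (P : I -> R * R) (K : I -> I -> set (R * R)) :
  injective P ->
  (forall i j, H i j -> [/\ compact (K i j), connected (K i j), K i j (P i) & K i j (P j)]) ->
  (forall i j k l, H i j -> H k l -> uniq [:: i; j; k; l] -> K i j `&` K k l = set0) ->
  exists (r : I -> I -> I -> bool) (h : I -> I -> bool),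
    (forall i j, i != j -> h i j = ~~ h j i) /\
    (forall i j k l, H i j -> H k l -> uniq [:: i; j; k; l] ->
      xorb (xorb (r k i j) (r l i j)) (xorb (r i k l) (r j k l)) =
      xorb (xorb (h k i) (h l i)) (xorb (h k j) (h l j))).
Proof.
move=> Pinj HK dis.
have [d d0 Hd] : exists2 d : R, 0 < d & forall q : (I * I) * (I * I),
    H q.1.1 q.1.2 -> H q.2.1 q.2.2 -> uniq [:: q.1.1; q.1.2; q.2.1; q.2.2] ->
    forall x y, K q.1.1 q.1.2 x -> K q.2.1 q.2.2 y -> d <= `|x - y|.
  apply: uniform_pos => [[[i j] [k l]]|t e e' _ ee' Ht Hij Hkl U x y Kx Ky] /=; last first.
    exact: le_trans ee' (Ht Hij Hkl U x y Kx Ky).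
  case: (boolP [&& H i j, H k l & uniq [:: i; j; k; l]]) => [/and3P[ij kl U]|n]; last first.
    by exists 1 => // ij kl U; case/negP: n; apply/and3P.
  have [ck _ _ _] := HK _ _ ij; have [ck' _ _ _] := HK _ _ kl.
  by have [e e0 He] := compact_separated ck ck' (dis _ _ _ _ ij kl U); exists e.
pose e := d / 4; have e0 : 0 < e by rewrite divr_gt0.
have e4 : e *+ 4 = d by rewrite /e -mulr_natr divfK // pnatr_eq0.
have chain i j : exists s, H i j ->
    [/\ path (step e) (P i) s, last (P i) s = P j & forall x, x \in P i :: s -> K i j x].
  have [ij|] := boolP (H i j); last by exists [::].
  have [_ ck Ki Kj] := HK _ _ ij.
  by have [s Hs] := connected_chain ck Ki Kj e0; exists s.
pose S i j := projT1 (cid (chain i j)).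
have SP i j : H i j -> [/\ path (step e) (P i) (S i j), last (P i) (S i j) = P j
    & forall x, x \in P i :: S i j -> K i j x].
  by rewrite /S; case: cid.
exists (fun w i j => parity (P w) (P i) (S i j)), (fun i j => upper (P i - P j)); split.
  move=> i j ij; rewrite -opprB upperN // subr_eq0; apply: contra ij => /eqP/Pinj->.
  exact: eqxx.
move=> i j k l ij kl U; have [pij lij sij] := SP _ _ ij; have [pkl lkl skl] := SP _ _ kl.
have f : far e (P i :: S i j) (P k :: S k l).
  by move=> x y xs ys; rewrite e4; apply: (Hd ((i, j), (k, l))) => //; [exact: sij|exact: skl].
have := independent_parity e0 pij pkl f; rewrite lij lkl.
set b1 := parity _ _ _; set b2 := parity _ _ _; set b3 := parity _ _ _; set b4 := parity _ _ _.
set u1 := upper _; set u2 := upper _; set u3 := upper _; set u4 := upper _.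
by case: b1; case: b2; case: b3; case: b4; case: u1; case: u2; case: u3; case: u4.
Qed.

End VanKampen.

(** * Outerplanar drawings exclude K4 and K23 minors *)

Section Drawing.
Variables (R : realType) (G : sgraph) (p : G -> R * R) (c : edge G -> R -> R * R).
Hypothesis pc : plane_embedding p c.
Implicit Types (S T : {set G}).

Let arc (e : edge G) : set (R * R) := c e @` `[0, 1].

Definition drawn S : set (R * R) :=
  \bigcup_(v in [set v | v \in S]) [set p v] `|`
  \bigcup_(e in [set e : edge G | val e \subset S]) arc e.

Lemma drawnP S x : drawn S x <->
  (exists2 v, v \in S & x = p v) \/ (exists2 e : edge G, val e \subset S & arc e x).
Proof.
by split=> [[[v vS ->]|[e eS ae]]|[[v vS ->]|[e eS ae]]];
  [left; exists v|right; exists e|left; exists v|right; exists e].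
Qed.

Lemma arc_compact e : compact (arc e).
Proof. apply: continuous_compact; [exact: pe_arc_cont pc e|exact: segment_compact]. Qed.

Lemma arc_connected e : connected (arc e).
Proof.
apply: connected_continuous_connected; [exact: segment_connected|exact: pe_arc_cont pc e].
Qed.

Lemma drawn_compact S : compact (drawn S).
Proof.
have fin (T : finType) (P : pred T) (F : T -> set (R * R)) :
    (forall i, compact (F i)) -> compact (\bigcup_(i in [set i | P i]) F i).
  move=> cF; rewrite (_ : [set i | P i] = [set i | (i \in index_enum T) && P i]).
    rewrite bigcup_seq_cond; exact: bigsetU_compact.
  by apply/seteqP; split=> i /=; rewrite mem_index_enum.
apply: compactU; apply: fin => i; [exact: compact_set1|exact: arc_compact].
Qed.

Lemma arc_vertex (e : edge G) v : v \in val e -> arc e (p v).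
Proof.
move=> ve; have /seteqP[_ /(_ (p v))] := pe_arc_ends pc e.
have pv : (p @` [set` val e]) (p v) by exists v.
move=> /(_ pv) [->|->]; [exists 0|exists 1] => //=; rewrite in_itv /= ?lexx ?ler01 //.
Qed.

Lemma arc_cases (e : edge G) x : arc e x ->
  (exists2 v, v \in val e & x = p v) \/ exists2 t, t \in `]0, 1[ & x = c e t.
Proof.
move=> [t /= + <-]; rewrite in_itv /= => /andP[t0 t1].
have ends s : s = 0 \/ s = 1 -> exists2 v, v \in val e & c e s = p v.
  move=> s01; have /seteqP[+ _] := pe_arc_ends pc e => /(_ (c e s)).
  have cs : [set c e 0; c e 1] (c e s) by case: s01 => ->; [left|right].
  by move=> /(_ cs) [v ve <-]; exists v.
move: t0 t1; rewrite le_eqVlt => /predU1P[<- _|t0]; first by left; apply: ends; left.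
rewrite le_eqVlt => /predU1P[->|t1]; first by left; apply: ends; right.
by right; exists t => //; rewrite in_itv /= t0.
Qed.

Lemma edge_ends (e : edge G) : exists u v, adj u v /\ val e = [set u; v]%SET.
Proof. by have /existsP[u /existsP[v /andP[uv /eqP]]] := valP e; exists u, v. Qed.

Lemma drawn_disjoint S T : [disjoint S & T]%B -> drawn S `&` drawn T = set0.
Proof.
move=> ST; apply/seteqP; split=> // x [dS dT].
have cases U : drawn U x -> (exists2 v, v \in U & x = p v) \/
    exists2 e : edge G, val e \subset U & exists2 t, t \in `]0, 1[ & x = c e t.
  move=> /drawnP[|[e eU /arc_cases[[v ve ->]|]]]; first by left.
    by left; exists v => //; exact: (fintype.subsetP eU).
  by right; exists e.
have [[v vS xv]|[e eS [t t01 xt]]] := cases _ dS;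
  have [[w wT xw]|[f fT [s s01 xs]]] := cases _ dT; first [move: xw|move: xs]; rewrite ?xv ?xt.
- by move/(pe_vertex_inj pc) => vw; have := disjointFr ST vS; rewrite vw wT.
- by move/esym; exact: (pe_arc_vertex pc).
- exact: (pe_arc_vertex pc).
- apply: (pe_arc_arc pc) => //; apply/eqP => ef.
  have [x' [y' [_ E]]] := edge_ends e.
  have x'e : x' \in val e by rewrite E !finset.inE eqxx.
  have x'S := fintype.subsetP eS _ x'e.
  have x'T : x' \in T by apply: (fintype.subsetP fT); rewrite -ef.
  by have := disjointFr ST x'S; rewrite x'T.
Qed.

Lemma adj_edge u v : adj u v -> exists e : edge G, val e = [set u; v]%SET.
Proof.
move=> uv; have H : is_edge [set u; v]%SET.
  by apply/existsP; exists u; apply/existsP; exists v; rewrite uv eqxx.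
by exists (Sub _ H).
Qed.

Lemma drawn_connected S r : r \in S -> sconn (@adj G) S -> connected (drawn S).
Proof.
move=> rS cS.
have Dv v : v \in S -> drawn S (p v) by move=> vS; apply/drawnP; left; exists v.
have Da (e : edge G) : val e \subset S -> arc e `<=` drawn S.
  by move=> eS x ax; apply/drawnP; right; exists e.
have step u v : adj_in (@adj G) S u v -> connected_component (drawn S) (p u) (p v).
  move=> /and3P[uS vS /adj_edge[e E]].
  apply: (connected_component_max (B := arc e)).
  - by apply: arc_vertex; rewrite E !finset.inE eqxx.
  - apply: Da; rewrite E; apply/fintype.subsetP => z.
    by rewrite !finset.inE => /orP[]/eqP->.
  - exact: arc_connected.
  - by apply: arc_vertex; rewrite E !finset.inE eqxx orbT.
have vert v : v \in S -> connected_component (drawn S) (p r) (p v).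
  move=> vS; have /connectP[q + ->] := cS _ _ rS vS.
  elim: q r rS => [|w q IH] u uS /=.
    by move=> _; exact/connected_component_refl/Dv.
  case/andP=> uw qw; apply: connected_component_trans (step _ _ uw) _.
  by apply: IH qw; case/and3P: uw.
suff -> : drawn S = connected_component (drawn S) (p r) by exact: component_connected.
apply/seteqP; split; last exact: connected_component_sub.
move=> x /drawnP[[v vS ->]|[e eS ax]]; first exact: vert.
have [u [v [_ E]]] := edge_ends e.
have ue : u \in val e by rewrite E !finset.inE eqxx.
apply: connected_component_trans (vert _ (fintype.subsetP eS _ ue)) _.
apply: (connected_component_max (B := arc e)) => //.
- exact: arc_vertex.
- exact: Da.
- exact: arc_connected.
Qed.

Lemma drawingE : drawing p c = drawn [set: G]%SET.
Proof.
apply/seteqP; split=> x.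
  move=> [[v _ <-]|[e _ ax]]; apply/drawnP; [left; exists v|right; exists e];
    rewrite ?finset.in_setT ?finset.subsetT //.
by move=> /drawnP[[v _ ->]|[e _ ax]]; [left; exists v|right; exists e].
Qed.

End Drawing.

(** * Access to the vertices through the outer face *)

Section Apex.
Variable R : realType.
Implicit Types (a b x y z : R * R) (D F : set (R * R)).

Definition line a b : set (R * R) := (fun t : R => a + t *: (b - a)) @` `[0, 1].

Lemma line_continuous a b : continuous (fun t : R => a + t *: (b - a)).
Proof. by move=> t; apply: cvgD; [exact: cvg_cst|apply: cvgZl; exact: cvg_id]. Qed.

Lemma line_compact a b : compact (line a b).
Proof.
apply: continuous_compact; last exact: segment_compact.
by apply: continuous_subspaceT; exact: line_continuous.
Qed.

Lemma line_connected a b : connected (line a b).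
Proof.
apply: connected_continuous_connected; first exact: segment_connected.
by apply: continuous_subspaceT; exact: line_continuous.
Qed.

Lemma line0 a b : line a b a.
Proof. by exists 0; rewrite /= ?in_itv /= ?lexx ?ler01 // scale0r addr0. Qed.
Lemma line1 a b : line a b b.
Proof. by exists 1; rewrite /= ?in_itv /= ?lexx ?ler01 // scale1r addrC subrK. Qed.

Lemma line_ball a b r : ball a r b -> line a b `<=` ball a r.
Proof.
rewrite -ball_normE /= => ab _ [t /= + <-]; rewrite in_itv /= => /andP[t0 t1].
rewrite opprD addrA subrr add0r normrN normrZ ger0_norm //.
by apply: le_lt_trans ab; rewrite distrC ler_piMl.
Qed.

(** A component of an open set is connected but need not be compact, while [van_kampen] asks for
    compact sets. The points reached from [z] by compact connected sets are open and closed in the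
    component, because a small ball allows extension by a segment. *)
Lemma component_path D z y : closed D -> connected_component (~` D) z y ->
  exists K, [/\ compact K, connected K, K `<=` ~` D, K z & K y].
Proof.
move=> cD; set F := connected_component _ _ => Fy.
have FD : F `<=` ~` D by exact: connected_component_sub.
have Dz : (~` D) z by apply: contrapT => nz; move: Fy; rewrite /F connected_component_out.
pose P x := F x /\ exists K, [/\ compact K, connected K, K `<=` ~` D, K z & K x].
suff EP : P = F by have [] : P y by rewrite EP.
have extend x x' (L : set (R * R)) : P x -> F x' -> compact L -> connected L ->
    L `<=` ~` D -> L x -> L x' -> P x'.
  move=> [_ [K [cK conK KD Kz Kx]]] Fx' cL conL LD Lx Lx'; split=> //.
  exists (K `|` L); split; [exact: compactU| |by move=> u []; [exact: KD|exact: LD]|by left|by right].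
  by apply: connectedU => //; exists x.
have small x : F x -> exists2 r, 0 < r & ball x r `<=` ~` D.
  move=> /FD nx; have : nbhs x (~` D) by apply: open_nbhs_nbhs; split=> //; exact: closed_openC.
  by rewrite -nbhs_ballE => -[r /= r0 H]; exists r.
have move_in x x' r : ball x r `<=` ~` D -> ball x r x' -> P x -> F x' -> P x'.
  move=> rD xx' Px Fx'; apply: (extend x x' (line x x')) => //; first exact: line_compact.
  - exact: line_connected.
  - by apply: subset_trans (line_ball xx') rD.
  - exact: line0.
  - exact: line1.
have move_out x x' r : ball x r `<=` ~` D -> ball x r x' -> P x' -> F x -> P x.
  move=> rD xx' Px Fx'; apply: (extend x' x (line x x')) => //; first exact: line_compact.
  - exact: line_connected.
  - by apply: subset_trans (line_ball xx') rD.
  - exact: line1.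
  - exact: line0.
pose U Q := \bigcup_(q in [set q : (R * R) * R | [/\ Q q.1, 0 < q.2 & ball q.1 q.2 `<=` ~` D]])
  ball q.1 q.2.
have oU Q : open (U Q) by apply: bigcup_open => q _; exact: ball_open.
apply: (@component_connected _ (~` D) z).
- exists z; split; first exact: connected_component_refl.
  exists [set z]; split=> //; [exact: compact_set1|exact: connected1|by move=> ? ->].
- exists (U P) => //; apply/seteqP; split=> [x Px|x [Fx [[q r] /= [Pq r0 rD] qx]]].
    have Fx : F x by case: Px.
    split=> //; have [r r0 rD] := small x Fx.
    by exists (x, r) => //=; exact: ballxx.
  exact: move_in rD qx Pq Fx.
- exists (~` U (F `\` P)); first exact: open_closedC.
  apply/seteqP; split=> [x Px|x [Fx nU]].
    have Fx : F x by case: Px.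
    split=> // -[[q r] /= [[Fq nPq] r0 rD] qx].
    by apply: nPq; exact: move_out rD qx Px Fq.
  apply: contrapT => nPx; apply: nU; have [r r0 rD] := small x Fx.
  by exists (x, r) => //=; exact: ballxx.
Qed.

End Apex.

Section ApexPath.
Variables (R : realType) (G : sgraph) (p : G -> R * R) (c : edge G -> R -> R * R).
Hypothesis pc : plane_embedding p c.
Variable z : R * R.
Let D := drawing p c.
Hypothesis Dz : ~ D z.
Hypothesis outer : forall v, closure (connected_component (~` D) z) (p v).

Lemma drawn_closed S : closed (drawn p c S).
Proof. by apply: compact_closed; [exact: norm_hausdorff|exact: drawn_compact]. Qed.

Lemma drawn_sub S : drawn p c S `<=` D.
Proof.
rewrite /D drawingE => x /drawnP[[v _ ->]|[e _ ae]]; apply/drawnP; [left; exists v|right; exists e];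
  rewrite ?finset.in_setT ?finset.subsetT //.
Qed.

(** A vertex on the boundary of the face need not be visibly accessible from it, so [K] goes inside
    the face to some [y] close to [p v] and then straight to [p v]. The last segment may hit arcs at
    [v], but it stays in a ball free of everything drawn without [v]. *)
Lemma apex_path v : exists K, [/\ compact K, connected K, K z, K (p v) &
  forall S : {set G}, v \notin S -> drawn p c S `&` K = set0].
Proof.
pose V := (~: [set v])%SET.
have nV : (~` drawn p c V) (p v).
  move=> dv; have : (drawn p c [set v]%SET `&` drawn p c V) (p v).
    by split=> //; apply/drawnP; left; exists v => //; rewrite finset.inE.
  rewrite (drawn_disjoint pc) //; rewrite -setI_eq0; apply/eqP/finset.setP => u.
  by rewrite !finset.inE andbN.
have : nbhs (p v) (~` drawn p c V).
  by apply: open_nbhs_nbhs; split=> //; apply: closed_openC; exact: drawn_closed.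
rewrite -nbhs_ballE => -[r /= r0 rV].
have [y [Fy /= py]] := outer (nbhsx_ballx (p v) r r0).
have cD : closed D by rewrite /D drawingE; exact: drawn_closed.
have [K [cK conK KD Kz Ky]] := component_path cD Fy.
exists (K `|` line (p v) y); split; [| |by left|by right; exact: line0|].
- by apply: compactU => //; exact: line_compact.
- apply: connectedU => //; last exact: line_connected.
  by exists y; split=> //; exact: line1.
move=> S vS; apply/seteqP; split=> // x [dS [Kx|Lx]].
  exact: KD Kx (drawn_sub dS).
apply: (rV x (line_ball py Lx)).
move: dS => /drawnP[[u uS ->]|[e eS ae]]; apply/drawnP; [left; exists u|right; exists e] => //.
  by rewrite !finset.inE; apply: contraNneq vS => <-.
apply/fintype.subsetP => u /(fintype.subsetP eS) uS.
by rewrite !finset.inE; apply: contraNneq vS => <-.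
Qed.

End ApexPath.

(** * Adding an apex to a minor *)

Section NoMinor.
Variables (R : realType) (G : sgraph).
Hypothesis outerG : outerplanar R G.

Definition apex_rel (I : finType) (H : rel I) : rel (option I) := fun o o' =>
  match o, o' with
  | Some i, Some j => H i j
  | None, None => false
  | _, _ => true
  end.

Lemma disjointUU (T : finType) (A B C D : {set T}) :
  [disjoint A & C]%B -> [disjoint A & D]%B -> [disjoint B & C]%B -> [disjoint B & D]%B ->
  [disjoint (A :|: B)%SET & (C :|: D)%SET]%B.
Proof.
rewrite -!setI_eq0 => /eqP h1 /eqP h2 /eqP h3 /eqP h4.
by rewrite finset.setIUl !finset.setIUr h1 h2 h3 h4 !finset.setU0.
Qed.

(** The edge [i j] is represented by the whole drawing of [B i] and [B j], and the vertex [i] by a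
    chosen point of [B i]. Edges with a common end overlap, which is harmless: two edges without
    common end use disjoint branch sets, and two edges at the apex always share an end. *)
Lemma apex_minor (I : finType) (H : rel I) : minor H (@adj G) ->
  (forall i, exists j, H i j || H j i) ->
  exists (r : option I -> option I -> option I -> bool) (h : option I -> option I -> bool),
    (forall i j, i != j -> h i j = ~~ h j i) /\
    (forall i j k l, apex_rel H i j -> apex_rel H k l -> uniq [:: i; j; k; l] ->
      xorb (xorb (r k i j) (r l i j)) (xorb (r i k l) (r j k l)) =
      xorb (xorb (h k i) (h l i)) (xorb (h k j) (h l j))).
Proof.
move=> [B [cB dB tB]] Hne.
have [p [c [pc [F [[z Dz ->] _ cF]]]]] := outerG.
have ne i : exists v, v \in B i.
  by have [j /orP[/tB|/tB] [x [y [? ? _]]]] := Hne i; [exists x|exists y].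
pose v i := projT1 (cid (ne i)).
have vB i : v i \in B i by rewrite /v; case: cid.
pose Ga i := projT1 (cid (apex_path pc cF (v i))).
have GaP i : [/\ compact (Ga i), connected (Ga i), Ga i z, Ga i (p (v i)) &
    forall S : {set G}, v i \notin S -> drawn p c S `&` Ga i = set0].
  by rewrite /Ga; case: cid.
pose P (o : option I) := if o is Some i then p (v i) else z.
pose K (o o' : option I) : set (R * R) := match o, o' with
  | Some i, Some j => drawn p c (B i :|: B j)%SET
  | None, Some i | Some i, None => Ga i
  | None, None => set0 end.
have Dp w : drawing p c (p w) by left; exists w.
have notin i j k : i != j -> i != k -> v i \notin (B j :|: B k)%SET.
  move=> ij ik; rewrite finset.inE negb_or.
  by rewrite (disjointFr (dB _ _ ij) (vB i)) (disjointFr (dB _ _ ik) (vB i)).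
apply: (@van_kampen R _ (apex_rel H) P K).
- move=> [i|] [j|] //= E; last 2 first.
  + by case: Dz; rewrite -E.
  + by case: Dz; rewrite E.
  + have [->//|ij] := eqVneq i j; have := pe_vertex_inj pc E => E'.
    by have := disjointFr (dB _ _ ij) (vB i); rewrite E' vB.
- move=> [i|] [j|] //= Hij.
  + have vi : v i \in (B i :|: B j)%SET by rewrite finset.inE vB.
    split; [exact: drawn_compact| | |].
    * apply: (drawn_connected pc vi); apply: sconnU => //; [exact: adj_sym|exact: tB].
    * by apply/drawnP; left; exists (v i).
    * by apply/drawnP; left; exists (v j) => //; rewrite finset.inE vB orbT.
  + by have [] := GaP i.
  + by have [] := GaP j.
- have cross_free i k l : i != k -> i != l ->
      drawn p c (B k :|: B l)%SET `&` Ga i = set0.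
    by move=> ik il; have [_ _ _ _] := GaP i; apply; exact: notin.
  move=> [i|] [j|] [k|] [l|] //= Hij Hkl; rewrite !inE ?negb_or ?andbT ?andbF //=.
  + move=> /and3P[/and3P[ij ik il] /andP[jk jl] kl].
    by apply: (drawn_disjoint pc); apply: disjointUU; exact: dB.
  + by move=> /andP[/andP[_ ik] jk]; apply: cross_free; rewrite eq_sym.
  + by move=> /andP[/andP[_ il] jl]; apply: cross_free; rewrite eq_sym.
  + by move=> /andP[/andP[ik il] _]; rewrite setIC; apply: cross_free.
  + by move=> /andP[/andP[jk jl] _]; rewrite setIC; apply: cross_free.
Qed.

Lemma parity_transfer (J : finType) (H : rel J) (idx : nat -> J) n
    (r : J -> J -> J -> bool) (h : J -> J -> bool) (edges : seq (nat * nat)) :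
  (forall i j, i != j -> h i j = ~~ h j i) ->
  (forall i j k l, H i j -> H k l -> uniq [:: i; j; k; l] ->
      xorb (xorb (r k i j) (r l i j)) (xorb (r i k l) (r j k l)) =
      xorb (xorb (h k i) (h l i)) (xorb (h k j) (h l j))) ->
  {in gtn n &, injective idx} ->
  all (fun e => [&& (e.1 < n)%N, (e.2 < n)%N & H (idx e.1) (idx e.2)]) edges ->
  exists r' h', (forall i j, i != j -> h' i j = negb (h' j i)) /\
    forall i j k l, ((i, j), (k, l)) \in independent_pairs edges ->
     parity_lhs r' ((i, j), (k, l)) = parity_rhs h' ((i, j), (k, l)).
Proof.
move=> hN rh inj /allP Hall.
exists (fun w i j => r (idx w) (idx i) (idx j)).
(* Outside the range of [idx] the order on numbers takes over, to keep [h'] antisymmetric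
   everywhere. *)
exists (fun i j => if (i < n)%N && (j < n)%N then h (idx i) (idx j) else (i < j)%N).
split=> [i j ij|i j k l].
  rewrite (andbC (j < n)%N); case: ifP => [/andP[il jl]|_].
    by apply: hN; apply: contra ij => /eqP/inj->.
  by case: ltngtP ij.
rewrite mem_filter /= => /andP[/andP[_ U] /allpairsP[[e f] /= [/Hall He /Hall Hf [Ee Ef]]]].
move: He Hf; rewrite -Ee -Ef /= => /and3P[il jl Hij] /and3P[kl ll Hkl].
rewrite il jl kl ll /=; apply: rh => //.
rewrite (_ : [:: _; _; _; _] = map idx [:: i; j; k; l]) //.
rewrite map_inj_in_uniq // => x y; rewrite !inE => xs ys; apply: inj.
  by case/or4P: xs => /eqP->.
by case/or4P: ys => /eqP->.
Qed.

Lemma outerplanar_noK4 : ~ minor K4 (@adj G).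
Proof.
move=> m; have [i|r [h [hN rh]]] := apex_minor m _.
  by exists (if i == ord0 then ord_max else ord0); case: i => [[|[|[|[|]]]]].
(* The apex is vertex 4 of [K5]. *)
pose idx n : option 'I_4 := if (n < 4)%N then Some (inord n) else None.
have [||r' [h' [hN' rh']]] := @parity_transfer _ _ idx 5 r h
  [:: (0, 1); (0, 2); (0, 3); (0, 4); (1, 2); (1, 3); (1, 4); (2, 3); (2, 4); (3, 4)]%N hN rh _ _.
  move=> [|[|[|[|[|]]]]] [|[|[|[|[|]]]]] //= _ _ [] /(congr1 val); rewrite /= !inordK //.
  by rewrite /= /K4 -!val_eqE /= !inordK.
exact: parity_K5 hN' rh'.
Qed.

Lemma outerplanar_noK23 : ~ minor K23 (@adj G).
Proof.
move=> m; have [i|r [h [hN rh]]] := apex_minor m _.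
  by case: i => [b|i]; [exists (inr ord0)|exists (inl true)].
(* The apex is vertex 2: it completes the side of two, so that the sides of [K33] are 0, 1, 2 and 3,
   4, 5. *)
pose idx n : option (bool + 'I_3) := match n with
  | 0 => Some (inl true) | 1 => Some (inl false) | 2 => None
  | n => Some (inr (inord (n - 3))) end.
have [||r' [h' [hN' rh']]] := @parity_transfer _ _ idx 6 r h
  [:: (0, 3); (0, 4); (0, 5); (1, 3); (1, 4); (1, 5); (2, 3); (2, 4); (2, 5)]%N hN rh _ _.
- move=> [|[|[|[|[|[|]]]]]] [|[|[|[|[|[|]]]]]] //= _ _ [] /(congr1 val); rewrite /= !inordK //.
- by [].
exact: parity_K33 hN' rh'.
Qed.

End NoMinor.

(** * Geometric realizations *)

Section Realization.
Variable R : realType.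

Lemma realization_continuous (Z : topologicalType) (T : finType) (K : simplicial_complex T)
    (f : Z -> realization R K) :
  (forall t, continuous (fun z => val (f z) t)) -> continuous f.
Proof.
move=> cf; apply: (@continuous_comp_initial (set_type (realization_set R K)) Z _
  (set_val : _ -> {ptws T -> R})) => z; apply/cvg_sup => t.
move=> A [B [[C oC <-] Cz BA]]; rewrite nbhs_simpl /=.
have : nbhs (val (f z) t) C by apply: (@open_nbhs_nbhs R); split.
move/(cf t z) => H; apply: (@filterS _ (nbhs z) _ ((fun z => val (f z) t) @^-1` C)) => // w Cw.
exact: BA.
Qed.

Lemma bary_continuous (T : finType) (K : simplicial_complex T) t :
  continuous (fun x : realization R K => val x t).
Proof.
move=> x; apply: (@continuous_comp _ _ _ (set_val : realization R K -> {ptws T -> R})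
  (fun g => g t)); first exact: initial_continuous.
exact: (@proj_continuous _ (fun=> R : topologicalType) t).
Qed.

Lemma realizationP (T : finType) (K : simplicial_complex T) (x : realization R K) :
  [/\ forall t, 0 <= val x t, \sum_t val x t = 1 & [set t | val x t != 0]%SET \in faces K].
Proof. by case: x => x /= /set_mem. Qed.

Definition rpoint (T : finType) (K : simplicial_complex T) (x : T -> R)
  (xK : realization_set R K x) : realization R K := exist _ x (mem_set xK).

(** Homotopies are only continuous on the strip over the unit interval; composing with this
    retraction makes them continuous everywhere, which spares the subspace topology from then on. *)
Definition clamp (s : R) := Num.max 0 (Num.min 1 s).

Lemma clamp_continuous : continuous clamp.
Proof.
move=> s; apply: continuous_max; first exact: cst_continuous.
by apply: continuous_min; [exact: cst_continuous|exact: cvg_id].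
Qed.

Lemma clamp_itv s : 0 <= clamp s <= 1.
Proof. by rewrite /clamp le_max lexx /= ge_max ler01 ge_min lexx. Qed.

Lemma clamp_id s : 0 <= s <= 1 -> clamp s = s.
Proof. by case/andP=> s0 s1; rewrite /clamp min_r // max_r. Qed.

Lemma continuous_o (X Y Z : topologicalType) (f : X -> Y) (g : Y -> Z) :
  continuous f -> continuous g -> continuous (fun x => g (f x)).
Proof. by move=> cf cg x; apply: continuous_comp; [exact: cf|exact: cg]. Qed.

Lemma continuous_pair (X Y Z : topologicalType) (f : X -> Y) (g : X -> Z) :
  continuous f -> continuous g -> continuous (fun x => (f x, g x)).
Proof.
move=> cf cg x A [[P Q] [/= Pf Qg] PQ].
apply: (@filterS _ (nbhs x) _ (f @^-1` P `&` g @^-1` Q)) => [y [Py Qy]|]; first exact: PQ.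
by apply: filterI; [exact: cf|exact: cg].
Qed.

Lemma continuous_fst (X Y : topologicalType) : continuous (@fst X Y).
Proof. by move=> z; exact: cvg_fst. Qed.
Lemma continuous_snd (X Y : topologicalType) : continuous (@snd X Y).
Proof. by move=> z; exact: cvg_snd. Qed.

Section Homotopic.
Variables (X Y Z W : topologicalType).

Lemma homotopicP (f g : X -> Y) : homotopic R f g <->
  exists H : X * R -> Y, [/\ continuous H, forall x, H (x, 0) = f x & forall x, H (x, 1) = g x].
Proof.
split=> -[H [cH H0 H1]]; last first.
  by exists H; split=> //; exact: continuous_subspaceT.
pose k (z : X * R) : X * R := (z.1, clamp z.2).
have ck : continuous k.
  apply: continuous_pair; first exact: continuous_fst.
  by apply: continuous_o clamp_continuous; exact: continuous_snd.
exists (H \o k); split=> [z|x|x] /=.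
- move/subspace_continuousP: cH => /(_ (k z)) cH.
  have kz w : (setT `*` `[0, 1]) (k w) by split=> //=; rewrite in_itv /= clamp_itv.
  apply: cvg_trans (cH (kz z)) => A /= HA.
  have : \forall w \near z, (setT `*` `[0, 1]) (k w) -> A (H (k w)) by exact: ck HA.
  by apply: filterS => w; apply.
- by rewrite /k /= clamp_id ?lexx ?ler01.
- by rewrite /k /= clamp_id ?lexx ?ler01.
Qed.

Lemma homotopic_trans (f g h : X -> Y) : homotopic R f g -> homotopic R g h -> homotopic R f h.
Proof.
move=> /homotopicP[F [cF F0 F1]] /homotopicP[G [cG G0 G1]]; apply/homotopicP.
pose A := [set z : X * R | z.2 <= 2^-1]; pose B := [set z : X * R | 2^-1 <= z.2].
have /continuous_closedP cs := @continuous_snd X R.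
have cA : closed A := cs _ (@closed_le R 2^-1).
have cB : closed B := cs _ (@closed_ge R 2^-1).
pose H (z : X * R) := if z.2 <= 2^-1 then F (z.1, 2 * z.2) else G (z.1, 2 * z.2 - 1).
have AB : A `|` B = setT.
  by apply/seteqP; split=> // z _; case: (leP z.2 2^-1) => [|/ltW]; [left|right].
exists H; split=> [|x|x].
- apply/continuous_subspace_setT; rewrite -AB; apply: withinU_continuous => //.
    apply: (@subspace_eq_continuous _ A _ (fun z => F (z.1, 2 * z.2))).
      by move=> z /set_mem; rewrite /from_subspace /A /H /= => ->.
    apply: continuous_subspaceT; apply: continuous_o cF.
    apply: continuous_pair; first exact: continuous_fst.
    by move=> z; apply: cvgM; [exact: cvg_cst|exact: cvg_snd].
  apply: (@subspace_eq_continuous _ B _ (fun z => G (z.1, 2 * z.2 - 1))).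
    move=> z /set_mem; rewrite /from_subspace /B /H /= => z2; case: (leP z.2 2^-1) => // z1.
    have -> : z.2 = 2^-1 by apply/eqP; rewrite eq_le z1 z2.
    by rewrite mulfV ?pnatr_eq0 // subrr G0 F1.
  apply: continuous_subspaceT; apply: continuous_o cG.
  apply: continuous_pair; first exact: continuous_fst.
  move=> z; apply: cvgB; last exact: cvg_cst.
  by apply: cvgM; [exact: cvg_cst|exact: cvg_snd].
- by rewrite /H /= invr_ge0 ler0n mulr0 F0.
- rewrite /H /= leNgt invf_lt1 ?ltr1n ?ltr0n //= mulr1.
  by rewrite (_ : 2 - 1 = 1) ?G1 //; ring.
Qed.

End Homotopic.

Lemma homotopic_sym (X Y : topologicalType) (f g : X -> Y) :
  homotopic R f g -> homotopic R g f.
Proof.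
move=> /homotopicP[F [cF F0 F1]]; apply/homotopicP.
exists (fun z => F (z.1, 1 - z.2)); split=> [|x|x] /=; rewrite ?subr0 ?subrr //.
apply: (continuous_o _ cF); apply: continuous_pair; first exact: continuous_fst.
by move=> z; apply: cvgB; [exact: cvg_cst|exact: cvg_snd].
Qed.

Lemma homotopic_refl (X Y : topologicalType) (f : X -> Y) : continuous f -> homotopic R f f.
Proof.
move=> cf; apply/homotopicP; exists (f \o fst); split=> // z.
by apply: continuous_comp; [exact: cvg_fst|exact: cf].
Qed.

Lemma homotopic_compl (X Y Z : topologicalType) (f g : X -> Y) (h : Y -> Z) :
  continuous h -> homotopic R f g -> homotopic R (h \o f) (h \o g).
Proof.
move=> ch /homotopicP[F [cF F0 F1]]; apply/homotopicP; exists (h \o F); split=> [z|x|x] /=.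
- by apply: continuous_comp; [exact: cF|exact: ch].
- by rewrite F0.
- by rewrite F1.
Qed.

Lemma homotopic_compr (X Y Z : topologicalType) (f g : Y -> Z) (h : X -> Y) :
  continuous h -> homotopic R f g -> homotopic R (f \o h) (g \o h).
Proof.
move=> ch /homotopicP[F [cF F0 F1]]; apply/homotopicP.
exists (fun z => F (h z.1, z.2)); split=> [z|x|x] /=; rewrite ?F0 ?F1 //.
apply: (continuous_o _ cF); apply: continuous_pair; last exact: continuous_snd.
by apply: continuous_o ch; exact: continuous_fst.
Qed.

Lemma homotopy_equivalent_sym (X Y : topologicalType) :
  homotopy_equivalent R X Y -> homotopy_equivalent R Y X.
Proof. by move=> [f [g [cf cg gf fg]]]; exists g, f. Qed.

Lemma homotopy_equivalent_trans (X Y Z : topologicalType) :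
  homotopy_equivalent R X Y -> homotopy_equivalent R Y Z -> homotopy_equivalent R X Z.
Proof.
move=> [f [g [cf cg gf fg]]] [f' [g' [cf' cg' gf' fg']]].
have comp (A B C : topologicalType) (u : A -> B) (v : B -> C) :
    continuous u -> continuous v -> continuous (v \o u).
  by move=> cu cv x; apply: continuous_comp; [exact: cu|exact: cv].
exists (f' \o f), (g \o g'); split; try exact: comp.
- apply: homotopic_trans gf.
  exact: (@homotopic_compl _ _ _ ((g' \o f') \o f) (id \o f) g cg (homotopic_compr cf gf')).
- apply: homotopic_trans fg'.
  exact: (@homotopic_compl _ _ _ ((f \o g) \o g') (id \o g') f' cf' (homotopic_compr cg' fg)).
Qed.

Lemma contractible_equivalent (X Y : topologicalType) :
  homotopy_equivalent R X Y -> contractible R Y -> contractible R X.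
Proof.
move=> [f [g [cf cg gf fg]]] [y0 hy]; exists (g y0).
apply: homotopic_trans (homotopic_sym gf) _.
exact: homotopic_compl cg (homotopic_compr cf hy).
Qed.

Definition support (T : finType) (K : simplicial_complex T) (x : realization R K) : {set T} :=
  [set t | val x t != 0]%SET.

Lemma segment_point (T : finType) (K : simplicial_complex T) (x y : realization R K) (s : R) :
  0 <= s <= 1 -> (support x :|: support y)%SET \in faces K ->
  realization_set R K (fun t => (1 - s) * val x t + s * val y t).
Proof.
move=> /andP[s0 s1] xyK; have [x0 x1 xK] := realizationP x; have [y0 y1 yK] := realizationP y.
split=> [t||].
- by rewrite addr_ge0 // mulr_ge0 // subr_ge0.
- by rewrite big_split /= -!mulr_sumr x1 y1 !mulr1 subrK.
- apply: (facesS _ xyK); apply/fintype.subsetP => t; rewrite !finset.inE.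
  apply: contraR; rewrite negb_or !negbK => /andP[/eqP-> /eqP->].
  by rewrite !mulr0 addr0.
Qed.

Lemma linear_homotopic (Z : topologicalType) (T : finType) (K : simplicial_complex T)
    (f g : Z -> realization R K) : continuous f -> continuous g ->
  (forall z, (support (f z) :|: support (g z))%SET \in faces K) -> homotopic R f g.
Proof.
move=> cf cg fg; apply/homotopicP.
exists (fun zs => rpoint (segment_point (clamp_itv zs.2) (fg zs.1))); split=> [|z|z].
- apply: realization_continuous => t.
  have cc : continuous (fun zs : Z * R => clamp zs.2).
    by apply: continuous_o clamp_continuous; exact: continuous_snd.
  have ct (h : Z -> realization R K) : continuous h -> continuous (fun zs : Z * R => val (h zs.1) t).
    move=> ch; apply: (continuous_o (f := h \o fst)) (@bary_continuous _ K t).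
    by apply: continuous_o ch; exact: continuous_fst.
  move=> zs; apply: cvgD.
    by apply: cvgM; [apply: cvgB; [exact: cvg_cst|exact: cc]|exact: ct].
  by apply: cvgM; [exact: cc|exact: ct].
- apply: val_inj; apply/funext => t /=.
  by rewrite clamp_id ?lexx ?ler01 // subr0 mul1r mul0r addr0.
- apply: val_inj; apply/funext => t /=.
  by rewrite clamp_id ?lexx ?ler01 // subrr mul1r mul0r add0r.
Qed.

Lemma contiguous_equivalent (T U : finType) (K : simplicial_complex T)
    (L : simplicial_complex U) (f : realization R K -> realization R L)
    (g : realization R L -> realization R K) :
  continuous f -> continuous g ->
  (forall x, (support (g (f x)) :|: support x)%SET \in faces K) ->
  (forall y, (support (f (g y)) :|: support y)%SET \in faces L) ->
  homotopy_equivalent R (realization R K) (realization R L).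
Proof.
move=> cf cg gf fg; exists f, g.
have cid (Z : topologicalType) : continuous (@id Z) by move=> z; exact: cvg_id.
have cgf : continuous (g \o f) by exact: continuous_o cf cg.
have cfg : continuous (f \o g) by exact: continuous_o cg cf.
by split=> //; exact: linear_homotopic.
Qed.

End Realization.

(** * Elementary moves are homotopy equivalences *)

Section Flag.
Variable R : realType.

Definition cliques (X : cpx) : {set {set X}} :=
  [set s : {set X} | [forall x in s, forall y in s, crel x y]]%SET.

Lemma cliquesP (X : cpx) (s : {set X}) :
  reflect (forall x y, x \in s -> y \in s -> crel x y) (s \in cliques X).
Proof.
rewrite finset.inE; apply: (iffP forall_inP) => H x.
  by move=> y /H/forall_inP; exact.
by move=> xs; apply/forall_inP => y; exact: H.
Qed.

Lemma cliquesS (X : cpx) (s t : {set X}) : s \subset t -> t \in cliques X -> s \in cliques X.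
Proof.
by move=> st /cliquesP H; apply/cliquesP => x y /(fintype.subsetP st) xt /(fintype.subsetP st); exact: H.
Qed.

Definition flag (X : cpx) := SimplicialComplex (@cliquesS X).

Notation real X := (realization R (flag X)).

Lemma flagP (X : cpx) (x : real X) :
  [/\ forall t, 0 <= val x t, \sum_t val x t = 1 &
    forall s t, val x s != 0 -> val x t != 0 -> crel s t].
Proof.
have [x0 x1 /cliquesP xK] := realizationP x; split=> // s t xs xt.
by apply: xK; rewrite finset.inE.
Qed.

Lemma flag_point (X : cpx) (x : X -> R) : (forall t, 0 <= x t) -> \sum_t x t = 1 ->
  (forall s t, x s != 0 -> x t != 0 -> crel s t) -> realization_set R (flag X) x.
Proof. by move=> x0 x1 xK; split=> //; apply/cliquesP => s t; rewrite !finset.inE; exact: xK. Qed.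

Lemma support_cliques (X : cpx) (x y : real X) :
  (forall s t, (val x s != 0) || (val y s != 0) -> (val x t != 0) || (val y t != 0) -> crel s t) ->
  (support x :|: support y)%SET \in faces (flag X).
Proof. by move=> H; apply/cliquesP => s t; rewrite !finset.inE; exact: H. Qed.

Lemma support_refl (X : cpx) (x y : real X) : val x = val y ->
  (support x :|: support y)%SET \in faces (flag X).
Proof.
move=> E; have [_ _ H] := flagP y.
by apply: support_cliques => s t; rewrite E !orbb; exact: H.
Qed.

Definition push (T U : finType) (f : T -> U) (x : T -> R) (u : U) := \sum_(t | f t == u) x t.

Lemma push_neq0 (T U : finType) (f : T -> U) (x : T -> R) u :
  push f x u != 0 -> exists2 t, u = f t & x t != 0.
Proof.
rewrite /push => n; have [t|H] := pickP (fun t => (f t == u) && (x t != 0)).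
  by case/andP=> /eqP <- xt; exists t.
move: n; rewrite big1 ?eqxx // => t ft; have := H t; rewrite ft /= => /negbFE/eqP //.
Qed.

Lemma push_inj (T U : finType) (f : T -> U) (x : T -> R) t : injective f -> push f x (f t) = x t.
Proof.
by move=> fI; rewrite /push (eq_bigl (pred1 t)) ?big_pred1_eq // => s; rewrite /= (inj_eq fI).
Qed.

Definition simplicial (X Y : cpx) (f : X -> Y) :=
  forall x y, crel x x -> crel y y -> crel x y -> crel (f x) (f y).

Section Push.
Variables (X Y : cpx) (f : X -> Y).
Hypothesis fs : simplicial f.

Lemma push_point (x : real X) : realization_set R (flag Y) (push f (val x)).
Proof.
have [x0 x1 xK] := flagP x; apply: flag_point.
- by move=> u; apply: sumr_ge0.
- by rewrite -[RHS]x1 (partition_big f predT).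
- by move=> u v /push_neq0[s -> xs] /push_neq0[t -> xt]; apply: fs; exact: xK.
Qed.

Definition pushr (x : real X) : real Y := rpoint (push_point x).

Lemma pushr_continuous : continuous pushr.
Proof.
apply: realization_continuous => u.
by apply: continuous_big => [|t _]; [exact: add_continuous|exact: bary_continuous].
Qed.

End Push.

Lemma flag_simplicial (X Y : cpx) (f : X -> Y) (g : Y -> X) : simplicial f -> simplicial g ->
  (forall x y, crel x x -> crel y y -> crel x y -> crel (g (f x)) y) ->
  (forall u v, crel u u -> crel v v -> crel u v -> crel (f (g u)) v) ->
  homotopy_equivalent R (real X) (real Y).
Proof.
have contig (Z W : cpx) (h : Z -> W) (k : W -> Z) (hs : simplicial h) (ks : simplicial k) :
    (forall x y, crel x x -> crel y y -> crel x y -> crel (k (h x)) y) ->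
    forall x, (support (pushr ks (pushr hs x)) :|: support x)%SET \in faces (flag Z).
  move=> H x; have [_ _ xK] := flagP x.
  have [_ _ yK] := flagP (pushr ks (pushr hs x)).
  have kh s : push k (push h (val x)) s != 0 -> exists2 t, s = k (h t) & val x t != 0.
    by move=> /push_neq0[u -> /push_neq0[t -> xt]]; exists t.
  apply: support_cliques => s t /= /orP[ys|xs] /orP[yt|xt].
  - exact: yK.
  - by have [s' -> xs'] := kh _ ys; apply: H; exact: xK.
  - by rewrite crel_sym; have [t' -> xt'] := kh _ yt; apply: H; exact: xK.
  - exact: xK.
move=> fs gs gf fg.
have cf : continuous (pushr fs) by exact: pushr_continuous.
have cg : continuous (pushr gs) by exact: pushr_continuous.
by apply: (contiguous_equivalent cf cg); exact: contig.
Qed.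

Lemma flag_emb (X Y : cpx) (f : X -> Y) : injective f ->
  (forall x y, crel (f x) (f y) = crel x y) ->
  (forall u : Y, crel u u -> exists x, u = f x) -> homotopy_equivalent R (real X) (real Y).
Proof.
move=> fI fc fs.
have simf : simplicial f by move=> x y; rewrite fc.
have pull_out (y : real Y) u : val y u != 0 -> exists t, u = f t.
  by have [_ _ yK] := flagP y => yu; apply: fs; exact: yK.
have pullP (y : real Y) : realization_set R (flag X) (fun t => val y (f t)).
  have [y0 y1 yK] := flagP y; apply: flag_point => //.
  - rewrite -[RHS]y1 [RHS](bigID (mem (f @: [set: X])%SET)) /= [X in _ + X]big1 ?addr0; last first.
      by move=> u; apply: contraNeq => /pull_out[t ->]; apply: imset_f; rewrite finset.in_setT.
    rewrite big_imset /=; last by move=> s t _ _; exact: fI.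
    by apply: eq_bigl => t; rewrite finset.in_setT.
  - by move=> s t ys yt; rewrite -fc; exact: yK.
have cg : continuous (fun y : real Y => rpoint (pullP y)).
  by apply: realization_continuous => t; exact: bary_continuous.
have cf : continuous (pushr simf) by exact: pushr_continuous.
apply: (contiguous_equivalent cf cg) => [x|y]; apply: support_refl; apply/funext => u /=.
  exact: push_inj.
have [[t ->]|nu] := pselect (exists t, u = f t); first exact: push_inj.
rewrite /push big1 => [|t /eqP ft]; last by case: nu; exists t.
by apply/esym/eqP/negPn/negP => /pull_out.
Qed.

(** The retraction takes the smaller of the weights of [u] and [v] away from both and gives it to
    the apex [a], so that afterwards one of them has weight 0. As [a] is joined to the whole link of
    [u v], a point and its image lie in a common face, and straight lines give the homotopy. *)
Lemma flag_shrink1 (T : finType) (c c' : rel T) (cs : symmetric c) (cs' : symmetric c') u v a :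
  subrel c' c -> ~~ c' u v -> (forall x y, c x y -> c' x y || ((x, y) \in [:: (u, v); (v, u)])) ->
  c' a a -> c' a u -> c' a v -> (forall y, c y y -> c u y -> c v y -> c' a y) ->
  homotopy_equivalent R (real (Cpx cs)) (real (Cpx cs')).
Proof.
move=> cc' nuv cE aa au av Ha.
have au' : a != u by apply: contraNneq nuv => <-.
have av' : a != v by apply: contraNneq nuv => <-; rewrite cs'.
pose m (x : T -> R) := Num.min (x u) (x v).
(* A singleton when [u = v]; the factor [#|S|] in [f] keeps the total weight equal to 1 in both
   cases. *)
pose S := [set u; v]%SET.
pose f (x : T -> R) t := x t - m x *+ (t \in S) + m x *+ (if t == a then #|S| else 0).
have aS : a \notin S by rewrite !finset.inE negb_or au'.
have m0 (x : real (Cpx cs)) : 0 <= m (val x).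
  by have [x0 _ _] := flagP x; rewrite /m le_min !x0.
have fS (x : real (Cpx cs)) t : t \in S -> f (val x) t = val x t - m (val x).
  move=> tS; rewrite /f tS; have -> : (t == a) = false by apply: contraNF aS => /eqP<-.
  by rewrite mulr0n addr0 mulr1n.
have fa (x : real (Cpx cs)) : f (val x) a = val x a + m (val x) *+ #|S|.
  by rewrite /f (negPf aS) eqxx mulr0n subr0.
have fo (x : real (Cpx cs)) t : t \notin S -> t != a -> f (val x) t = val x t.
  by move=> tS ta; rewrite /f (negPf tS) (negPf ta) !mulr0n subr0 addr0.
have f0 (x : real (Cpx cs)) : m (val x) = 0 -> f (val x) = val x.
  by move=> E; apply/funext => t; rewrite /f E !mul0rn subr0 addr0.
have mle (x : real (Cpx cs)) t : t \in S -> m (val x) <= val x t.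
  by rewrite !finset.inE => /orP[]/eqP->; rewrite /m ge_min lexx ?orbT.
have supp (x : real (Cpx cs)) t : f (val x) t != 0 ->
    (val x t != 0) || (t == a) && (0 < m (val x)).
  have [->|ta] := eqVneq t a.
    by rewrite fa /= lt0r m0 andbT; case: (eqVneq (m (val x)) 0) => [->|]; rewrite ?mul0rn ?addr0 ?orbF ?orbT.
  have [tS|tS] := boolP (t \in S); last by rewrite fo // => ->.
  rewrite fS // andFb orbF; apply: contra_neq => E.
  by apply/eqP; rewrite subr_eq0 eq_le {1}E m0 mle.
have apex (x : real (Cpx cs)) s : 0 < m (val x) -> val x s != 0 -> c' a s.
  have [_ _ xK] := flagP x; rewrite /m lt_min => /andP[xu xv] xs.
  by apply: Ha; apply: (xK) => //; rewrite gt_eqF.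
have fP (x : real (Cpx cs)) : realization_set R (flag (Cpx cs')) (f (val x)).
  have [x0 x1 xK] := flagP x; apply: flag_point.
  - move=> t; have [tS|tS] := boolP (t \in S); first by rewrite fS // subr_ge0 mle.
    have [->|ta] := eqVneq t a; last by rewrite fo.
    by rewrite fa addr_ge0 // mulrn_wge0.
  - rewrite /f big_split /= sumrB x1 !sumrMnr -[RHS](subrK (m (val x) *+ #|S|)).
    congr (_ - _ *+ _ + _ *+ _).
      by rewrite -sum1_card [RHS]big_mkcond /=; apply: eq_bigr => t _; case: (t \in S).
    by rewrite -big_mkcond big_pred1_eq.
  - move=> s t /[dup] fs /supp s1 /[dup] ft /supp t1.
    case/orP: s1 => [xs|/andP[/eqP-> mx]]; last first.
      by case/orP: t1 => [|/andP[/eqP->]//]; exact: apex.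
    case/orP: t1 => [xt|/andP[/eqP-> mx]]; last by rewrite /= cs'; exact: apex mx xs.
    have /orP[//|] := cE _ _ (xK _ _ xs xt).
    rewrite !inE !xpair_eqE => st; exfalso.
    have [uS vS] : u \in S /\ v \in S by rewrite !finset.inE !eqxx orbT.
    have [fu fv] : f (val x) u != 0 /\ f (val x) v != 0.
      by case/orP: st => /andP[/eqP<- /eqP<-].
    move: fu fv; rewrite !fS // /m; case: leP => _; by rewrite subrr eqxx.
have cf : continuous (fun x : real (Cpx cs) => rpoint (fP x)).
  apply: realization_continuous => t.
  have cm : continuous (fun x : real (Cpx cs) => m (val x)).
    by move=> x; apply: continuous_min; exact: bary_continuous.
  have cMn n : continuous (fun x : real (Cpx cs) => m (val x) *+ n).
    exact: continuous_o cm (@natmul_continuous _ _ n).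
  have cB : continuous (fun x : real (Cpx cs) => val x t - m (val x) *+ (t \in S)).
    have ct : continuous (fun x : real (Cpx cs) => val x t) by exact: bary_continuous.
    move=> x; have := cvgB (ct x) (cMn _ x). exact.
  have cD : continuous (fun x : real (Cpx cs) => val x t - m (val x) *+ (t \in S)
      + m (val x) *+ (if t == a then #|S| else 0)).
    by move=> x; have := cvgD (cB x) (cMn _ x); exact.
  exact: cD.
have gP (x : real (Cpx cs')) : realization_set R (flag (Cpx cs)) (val x).
  have [x0 x1 xK] := flagP x; apply: flag_point => // s t xs xt; apply: cc'; exact: xK.
have cg : continuous (fun x : real (Cpx cs') => rpoint (gP x)).
  by apply: realization_continuous => t; exact: bary_continuous.
apply: (contiguous_equivalent cf cg) => [x|y].
- have [_ _ xK] := flagP x.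
  have H s : f (val x) s != 0 \/ val x s != 0 -> val x s != 0 \/ s = a /\ 0 < m (val x).
    by case=> [/supp/orP[|/andP[/eqP]]|]; auto.
  apply: support_cliques => s t /= /orP/H s1 /orP/H t1.
  case: s1 => [xs|[-> mx]]; last first.
    by apply: cc'; case: t1 => [|[-> _]] //; exact: apex.
  case: t1 => [xt|[-> mx]]; first exact: xK.
  rewrite /= cs; apply: cc'; exact: (apex x).
- apply: support_refl => /=; apply: (f0 (rpoint (gP y))).
  have [y0 _ yK] := flagP y; rewrite /m /=; apply/eqP.
  have : ~~ ((val y u != 0) && (val y v != 0)).
    by apply: contra nuv => /andP[yu yv]; exact: yK.
  rewrite negb_and !negbK => /orP[]/eqP->; [rewrite min_l|rewrite min_r] => //; exact: y0.
Qed.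

Lemma flag_same (T : finType) (c c' : rel T) (cs : symmetric c) (cs' : symmetric c') :
  (forall x, c x x = c' x x) -> (forall x y, c x x -> c y y -> c x y = c' x y) ->
  homotopy_equivalent R (real (Cpx cs)) (real (Cpx cs')).
Proof.
move=> c1 c2; apply: (@flag_simplicial (Cpx cs) (Cpx cs') id id) => //= x y xx yy.
- by rewrite /= -c2.
- by rewrite /= c2 ?c1.
Qed.

(** The edges are removed one at a time, in any order: an apex is joined to the link of its edge
    already in [c'], hence in every intermediate relation. *)
Lemma flag_shrink (T : finType) (c c' : rel T) (cs : symmetric c) (cs' : symmetric c') :
  shrinks c c' -> homotopy_equivalent R (real (Cpx cs)) (real (Cpx cs')).
Proof.
move=> [cc' ap]; pose bad (c : rel T) := [pred e : T * T | c e.1 e.2 && ~~ c' e.1 e.2].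
have [n] := ubnP #|bad c|; elim: n => // n IH in c cs cc' ap *; rewrite ltnS => nc.
have [[u v] /andP[/= cuv nuv]|no] := pickP (bad c); last first.
  have E x y : c x y = c' x y.
    by apply/idP/idP => [cxy|/cc'//]; have := no (x, y); rewrite /= cxy => /negbFE.
  by apply: flag_same.
have [a [aa au av Ha]] := ap u v cuv nuv.
pose d x y := c x y && ((x, y) \notin [:: (u, v); (v, u)]).
have ds : symmetric d.
  move=> x y; rewrite /d cs; congr (_ && ~~ _); rewrite !inE !xpair_eqE orbC.
  by rewrite (andbC (y == v)) (andbC (y == u)).
have c'd : subrel c' d.
  move=> x y cxy; rewrite /d cc' //= !inE !xpair_eqE negb_or.
  by apply/andP; split; apply: contraNN nuv => /andP[/eqP<- /eqP<-] //; rewrite cs'.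
have dc x y : d x y -> c x y by case/andP.
have [aad aud avd] := And3 (c'd _ _ aa) (c'd _ _ au) (c'd _ _ av).
apply: (@homotopy_equivalent_trans _ _ (real (Cpx ds))).
  apply: (@flag_shrink1 _ _ _ cs ds u v a) => //.
  - by rewrite /d mem_head /= andbF.
  - by move=> x y cxy; rewrite /d cxy orNb.
  - by move=> y *; apply: c'd; exact: Ha.
apply: IH => //.
  move=> x y dxy nxy; have [b [bb bx by_ Hb]] := ap x y (dc _ _ dxy) nxy.
  by exists b; split=> // z /dc zz /dc xz /dc yz; exact: Hb.
apply: leq_trans nc; apply: proper_card; apply/properP; split.
  by apply/fintype.subsetP => -[x y] /andP[/= /dc cxy nxy]; apply/andP.
exists (u, v); first by rewrite inE /= cuv nuv.
by rewrite inE /= /d mem_head /= andbF.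
Qed.

Lemma heq_homotopy_equivalent (X Y : cpx) : heq X Y -> homotopy_equivalent R (real X) (real Y).
Proof.
elim=> {X Y} [X Y f fI fc fs|T c c' cs cs' s|T c c' cs cs' c1 c2|X Y _|X Y Z _ H1 _].
- exact: flag_emb fI fc fs.
- exact: flag_shrink.
- exact: flag_same.
- exact: homotopy_equivalent_sym.
- exact: homotopy_equivalent_trans H1.
Qed.

End Flag.

(** * Spheres as cross-polytopes *)

Section Polytope.
Variable R : realType.

Notation real X := (realization R (flag X)).

Lemma compact_sphere n : compact (@sphere R n).
Proof.
apply: bounded_closed_compact.
  exists 1; split; first exact: num_real.
  move=> M M1 x x1; rewrite /Num.norm /= mx_normrE; apply: bigmax_le => [|[i j] _ /=].
    exact: ltW (lt_trans _ M1).
  apply: le_trans (ltW M1); rewrite -(@ler_pXn2r _ 2) ?nnegrE // expr1n real_normK ?num_real //.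
  rewrite (ord1 i) -x1 (bigD1 j) //= lerDl.
  by apply: sumr_ge0 => k _; exact: sqr_ge0.
pose q (x : 'rV[R]_n.+1) := \sum_i x 0 i ^+ 2.
have cq : continuous q.
  apply: continuous_big => [|i _]; first exact: add_continuous.
  exact: (continuous_o (@coord_continuous _ _ _ 0 i) (@exprn_continuous R 2)).
have c1 : closed [set 1 : R] by exact: accessible_closed_set1 (hausdorff_accessible (@Rhausdorff R)) _.
by have /continuous_closedP/(_ _ c1) := cq.
Qed.

Lemma compact_set_type (T : topologicalType) (A : set T) : compact A -> compact [set: A].
Proof.
move=> cA F FF _.
pose G := (fun x : A => val x) @ F.
have FA : G A by apply: (@filterS _ F _ setT) filterT => x _; exact: set_valP.
have [a [Aa Fa]] := cA G _ FA.
exists (SigSub (mem_set Aa)); split=> // B C FB.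
case=> D [[E oE <-] Ea DC].
have FB' : G (val @` B) by apply: (@filterS _ F _ B) FB => x Bx /=; exists x.
have [_ [[x Bx <-] Ex]] := Fa _ _ FB' (open_nbhs_nbhs (conj oE Ea)).
by exists x; split=> //; exact: DC.
Qed.

Lemma hausdorff_realization (T : finType) (K : simplicial_complex T) :
  hausdorff_space (realization R K).
Proof.
move=> x y xy; apply: val_inj; apply/funext => t.
have := @Rhausdorff R; apply => A B xA yB.
have [z [Az Bz]] := xy _ _ (bary_continuous xA) (bary_continuous yB).
by exists (val z t).
Qed.

Lemma homeo_compact (X Y : topologicalType) (f : X -> Y) (g : Y -> X) :
  compact [set: X] -> hausdorff_space Y -> continuous f -> cancel f g -> cancel g f ->
  homotopy_equivalent R X Y.
Proof.
move=> cX hY cf fK gK.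
have cg : continuous g.
  apply/continuous_closedP => A cA.
  rewrite (_ : g @^-1` A = f @` A); last first.
    apply/seteqP; split=> [y Ay|_ [x Ax <-]] /=; last by rewrite fK.
    by exists (g y); rewrite ?gK.
  apply: compact_closed => //; apply: continuous_compact.
    exact: continuous_subspaceT.
  exact: subclosed_compact cA cX _.
have cid (Z : topologicalType) : continuous (@id Z) by move=> z; exact: cvg_id.
exists f, g; split=> //.
  by rewrite (_ : g \o f = id); [exact: homotopic_refl|exact/funext].
by rewrite (_ : f \o g = id); [exact: homotopic_refl|exact/funext].
Qed.

Lemma sphereP n (y : @sphere R n) : \sum_i val y 0 i ^+ 2 = 1.
Proof. exact: set_valP y. Qed.

Definition norm1 n (y : 'rV[R]_n.+1) := \sum_j `|y 0 j|.

Lemma norm1_gt0 n (y : @sphere R n) : 0 < norm1 (val y).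
Proof.
rewrite lt0r sumr_ge0 // andbT; apply/eqP => y0.
have := sphereP y; rewrite big1 => [/eqP|j _]; first by rewrite eq_sym oner_eq0.
move/eqP: y0; rewrite psumr_eq0 // => /allP/(_ j (mem_index_enum _))/=.
by rewrite normr_eq0 => /eqP ->; rewrite expr0n.
Qed.

(** Radial projection of the round sphere onto the cross-polytope: the weights are the positive and
    negative parts of the coordinates, divided by the sum of absolute values. The factor 2 belongs
    to the formula for these parts. *)
Definition polar n (y : @sphere R n) (p : sph n) : R :=
  (`|val y 0 p.1| + (if p.2 then val y 0 p.1 else - val y 0 p.1)) / (2 * norm1 (val y)).

Lemma polar_point n (y : @sphere R n) : realization_set R (flag (sph n)) (polar y).
Proof.
have N0 := norm1_gt0 y.
apply: flag_point => [[j s]||[j s] [j' s']].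
- rewrite /polar divr_ge0 ?mulr_ge0 ?(ltW N0) //=.
  have := ler_norm (val y 0 j); have := ler_norm (- val y 0 j); rewrite normrN.
  by case: s; lra.
- rewrite -(pair_bigA _ (fun j s => polar y (j, s))) /=.
  rewrite (eq_bigr (fun j => `|val y 0 j| / norm1 (val y))).
    by rewrite -mulr_suml divff ?gt_eqF.
  move=> j _; rewrite big_bool /polar /= -mulrDl.
  field; exact: lt0r_neq0.
- rewrite /polar /= /sph_rel /=; have [<-{j'}|//] := eqVneq j j'.
  rewrite orFb !mulf_eq0 !negb_or => /andP[a _] /andP[b _].
  by move: a b; case: s; case: s' => //=; case: (ler0P (val y 0 j)) => _;
    rewrite ?subrr ?addNr ?eqxx.
Qed.

Definition polarr n (y : @sphere R n) : real (sph n) := rpoint (polar_point y).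

Lemma polarr_continuous n : continuous (@polarr n).
Proof.
have cv : continuous (fun y : @sphere R n => val y) by exact: initial_continuous.
have cc j : continuous (fun y : @sphere R n => val y 0 j).
  exact: continuous_o cv (@coord_continuous _ _ _ 0 j).
have ca j : continuous (fun y : @sphere R n => `|val y 0 j|).
  exact: continuous_o (cc j) (@norm_continuous _ R).
apply: realization_continuous => p.
have cn : continuous (fun y : @sphere R n => 2 * norm1 (val y)).
  have c1 : continuous (fun y : @sphere R n => norm1 (val y)).
    by apply: continuous_big => [|j _]; [exact: add_continuous|exact: ca].
  by move=> y; apply: cvgM (cvg_cst _) (c1 y).
have ct : continuous (fun y : @sphere R n => `|val y 0 p.1| + (if p.2 then val y 0 p.1 else - val y 0 p.1)).
  case: p => j [] y /=; [exact: cvgD (ca j y) (cc j y)|exact: cvgD (ca j y) (cvgN (cc j y))].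
move=> y; have N : 2 * norm1 (val y) != 0 by rewrite gt_eqF // mulr_gt0 // norm1_gt0.
exact: cvgM (ct y) (cvgV N (cn y)).
Qed.

Lemma polarB n (y : @sphere R n) j : polar y (j, true) - polar y (j, false) = val y 0 j / norm1 (val y).
Proof.
rewrite /polar /= -mulrBl.
field; exact: lt0r_neq0 (norm1_gt0 y).
Qed.

(** Differences of antipodal weights recover [y] up to a positive factor, which is 1 because both
    points are on the unit sphere. *)
Lemma polarr_inj n : injective (@polarr n).
Proof.
move=> y z yz.
have E : polar y = polar z := congr1 val yz.
have Ny := norm1_gt0 y; have Nz := norm1_gt0 z.
pose l := norm1 (val y) / norm1 (val z).
have yl j : val y 0 j = l * val z 0 j.
  have := polarB y j; rewrite E polarB /l => H.
  by rewrite mulrAC -mulrA H mulrC divfK ?gt_eqF.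
have l1 : l = 1.
  have l0 : 0 < l by exact: divr_gt0.
  apply/eqP; rewrite -(@eqrXn2 _ 2) ?(ltW l0) ?ler01 // expr1n.
  rewrite -(sphereP y) (eq_bigr (fun j => l ^+ 2 * val z 0 j ^+ 2)).
    by rewrite -mulr_sumr sphereP mulr1.
  by move=> j _; rewrite yl exprMn.
by apply: val_inj; apply/rowP => j; rewrite yl l1 mul1r.
Qed.

Lemma polarr_surj n (x : real (sph n)) : exists y, polarr y = x.
Proof.
have [x0 x1 xK] := flagP x.
pose w j := val x (j, true) - val x (j, false).
have wa j : `|w j| = val x (j, true) + val x (j, false).
  have : (val x (j, true) == 0) || (val x (j, false) == 0).
    by apply: contraT; rewrite negb_or => /andP[a b]; have := xK _ _ a b; rewrite /= /sph_rel /= eqxx.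
  by case/orP => /eqP E; rewrite /w E ?sub0r ?subr0 ?add0r ?addr0 ?normrN ger0_norm.
have w1 : \sum_j `|w j| = 1.
  rewrite -x1 (eq_bigr (fun p : 'I_n.+1 * bool => val x (p.1, p.2))) => [|[]//].
  rewrite -(pair_bigA _ (fun j s => val x (j, s))) /=.
  by apply: eq_bigr => j _; rewrite big_bool wa.
pose q := Num.sqrt (\sum_j w j ^+ 2).
have q0 : 0 < q.
  rewrite sqrtr_gt0 lt0r sumr_ge0 ?andbT => [|j _]; last exact: sqr_ge0.
  apply/negP; rewrite psumr_eq0 => [/allP W|i _]; last exact: sqr_ge0.
  move/eqP: w1; rewrite big1 => [|j _]; first by rewrite eq_sym oner_eq0.
  by apply/eqP; rewrite normr_eq0 -sqrf_eq0; exact: (W j (mem_index_enum _)).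
have q2 : q ^+ 2 = \sum_j w j ^+ 2.
  by apply: sqr_sqrtr; apply: sumr_ge0 => j _; exact: sqr_ge0.
have yP : @sphere R n (\row_j (w j / q)).
  rewrite /sphere /= (eq_bigr (fun j => w j ^+ 2 / q ^+ 2)) => [|j _]; last by rewrite mxE exprMn exprVn.
  by rewrite -mulr_suml -q2 divff // sqrf_eq0 gt_eqF.
exists (SigSub (mem_set yP)); apply: val_inj; apply/funext => -[j s] /=.
have qj i : `|(\row_j (w j / q)) 0 i| = `|w i| / q by rewrite mxE normrM (gtr0_norm (_ : 0 < q^-1)) ?invr_gt0.
rewrite /polar /norm1 /= (eq_bigr _ (fun i _ => qj i)) -mulr_suml w1 qj mxE wa /w.
by case: s; [rewrite -[RHS]/(val x (j, true))|rewrite -[RHS]/(val x (j, false))]; field;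
  exact: lt0r_neq0.
Qed.

Lemma polar_base n p : polar (sphere_base R n) p = (p == sph_base n)%:R.
Proof.
have N : norm1 (val (sphere_base R n)) = 1.
  rewrite /norm1 (bigD1 ord0) //= big1 ?addr0 ?mxE ?normr1 // => i i0.
  by rewrite mxE (negPf i0) andbF normr0.
case: p => j s; rewrite /polar N /= mxE /= /sph_base xpair_eqE.
have [_|_] := eqVneq j 0; last by rewrite /= normr0 oppr0 if_same addr0 mul0r.
rewrite /= normr1; case: s => /=; last by rewrite subrr mul0r.
by rewrite mulr1 divff // pnatr_eq0.
Qed.

End Polytope.

(** * Wedges of spheres *)

Section Wedge.
Variables (n0 : nat) (d0 : seq nat).
Let d := n0 :: d0.
Implicit Types i : 'I_(size d0).+1.

Definition spoke i (p : sph (nth 0%N d i)) : flat d := Some (i : 'I_(size d), inord p.1, p.2).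

Definition fuse (u : flat d) : flat d :=
  if u is Some (_, j, s) then if (j == 0 :> nat) && s then None else u else None.

Definition petal i (p : sph (nth 0%N d i)) : flat d := fuse (spoke p).

(** The simplicial wedge on the carrier of [flat d]: the base point of every sphere is replaced by
    the hub and ceases to be a vertex. *)
Definition wedge_rel : rel (flat d) := fun u v =>
  [exists i : 'I_(size d0).+1, [exists p : sph (nth 0%N d i), [exists q : sph (nth 0%N d i),
    [&& crel p q, u == petal p & v == petal q]]]].

Lemma wedge_relP u v :
  reflect (exists (i : 'I_(size d0).+1) (p q : sph (nth 0%N d i)), [/\ crel p q, u = petal p & v = petal q])
    (wedge_rel u v).
Proof.
apply: (iffP existsP) => [[i /existsP[p /existsP[q /and3P[pq /eqP-> /eqP->]]]]|[i [p [q [pq -> ->]]]]].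
  by exists i, p, q.
by exists i; apply/existsP; exists p; apply/existsP; exists q; rewrite pq !eqxx.
Qed.

Lemma wedge_sym : symmetric wedge_rel.
Proof.
move=> u v; apply/wedge_relP/wedge_relP => -[i [p [q [pq -> ->]]]];
  by exists i, q, p; rewrite crel_sym.
Qed.

Definition wedge_cpx := Cpx wedge_sym.

Lemma spoke_val i (p : sph (nth 0%N d i)) : (inord p.1 : 'I_(sumn d).+1) = p.1 :> nat.
Proof. by rewrite inordK ?(leq_trans (ltn_ord p.1)) // ltnS leq_nth_sumn. Qed.

Lemma spoke_inj i : injective (@spoke i).
Proof.
move=> p q pq; have E : val (inord p.1 : 'I_(sumn d).+1) = val (inord q.1 : 'I_(sumn d).+1).
  by case: pq => /(congr1 val).
have {pq} ss : p.2 = q.2 by case: pq.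
move: E ss; rewrite /= !spoke_val; case: p q => [j s] [j' s'] /= E ->.
by congr (_, _); exact: val_inj.
Qed.

Lemma spoke_rel i (p q : sph (nth 0%N d i)) : flat_rel (spoke p) (spoke q) = crel p q.
Proof.
have le (r : sph (nth 0%N d i)) : (r.1 <= nth 0%N d i)%N by rewrite -ltnS; exact: ltn_ord.
rewrite /flat_rel /spoke eqxx !spoke_val !le /= -val_eqE /= !spoke_val //.
Qed.

Lemma spoke_surj (u v : flat d) : u != None -> v != None -> flat_rel u v ->
  exists (i : 'I_(size d0).+1) (p q : sph (nth 0%N d i)), u = spoke p /\ v = spoke q.
Proof.
case: u v => [[[i j] s]|] [[[i' j'] s']|] //= _ _ /and4P[/eqP<- ji ji' _].
exists i, (inord j, s), (inord j', s'); rewrite /spoke /=.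
by split; congr (Some (_, _, _)); apply: val_inj; rewrite /= !inordK // !ltnS leq_nth_sumn.
Qed.

Lemma petal_base i : petal (sph_base (nth 0%N d i)) = None.
Proof. by rewrite /petal /fuse /= inordK. Qed.

Lemma petalE i (p : sph (nth 0%N d i)) :
  petal p = if p == sph_base _ then None else spoke p.
Proof.
have [->|] := eqVneq; first exact: petal_base.
rewrite /petal /fuse /= spoke_val /sph_base; case: p => j s /=.
by rewrite xpair_eqE eqb_id -val_eqE /= => /negbTE ->.
Qed.

Lemma petal_inj i : injective (@petal i).
Proof.
move=> p q; rewrite !petalE; case: eqP => [->|_]; case: eqP => [->|_] //.
exact: spoke_inj.
Qed.

Lemma petal_meet i i' (p : sph (nth 0%N d i)) (q : sph (nth 0%N d i')) :
  i != i' -> petal p = petal q -> p = sph_base _.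
Proof.
move=> ii; rewrite !petalE; case: eqP => // _; case: eqP => // _ E.
have := congr1 (fun u : flat d => if u is Some (k, _, _) then val k else 0%N) E.
by move/val_inj => ii'; rewrite ii' eqxx in ii.
Qed.

Lemma petal_rel i (p q : sph (nth 0%N d i)) : wedge_rel (petal p) (petal q) = crel p q.
Proof.
apply/wedge_relP/idP => [[i' [p' [q' [pq]]]]|pq]; last by exists i, p, q.
have [E|ii] := eqVneq i i'.
  by case: i' / E p' q' pq => p' q' pq /petal_inj -> /petal_inj ->.
by move=> /(petal_meet ii) -> /(petal_meet ii) ->; exact: sph_vertex.
Qed.

Lemma fuse_petal i (p : sph (nth 0%N d i)) : fuse (petal p) = petal p.
Proof. by rewrite petalE; case: eqP => // /eqP pb; have := petalE p; rewrite (negPf pb). Qed.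

(** An intermediate complex in which the hub is also joined to the neighbours of each base point.
    These edges can be removed with the base point as apex, which gives back [flat]; alternatively
    the base points can be folded into the hub, which gives the wedge. *)
Definition cone_rel : rel (flat d) := fun u v => flat_rel u v || wedge_rel u v.

Lemma cone_sym : symmetric cone_rel.
Proof. by move=> u v; rewrite /cone_rel flat_sym wedge_sym. Qed.

Lemma spoke_nbr i (q : sph (nth 0%N d i)) y : q != sph_base _ -> y != None ->
  cone_rel (spoke q) y -> exists s : sph (nth 0%N d i), y = spoke s.
Proof.
move=> qb y0 /orP[|].
  case: y y0 => // -[[i' j] s] _ /and4P[/eqP<- _ ji _]; exists (inord j, s); rewrite /spoke /=.
  by congr (Some (_, _, _)); apply: val_inj; rewrite /= !inordK // ltnS leq_nth_sumn.
have -> : spoke q = petal q by rewrite petalE (negPf qb).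
case/wedge_relP=> i' [p' [q' [pq E y']]]; subst y.
have [ii|ii] := eqVneq i i'; last by rewrite (petal_meet ii E) eqxx in qb.
case: i' / ii p' q' pq E y0 => p' q' pq E; by rewrite petalE; case: ifP => // _ _; exists q'.
Qed.

Lemma shrinks_cone_flat : shrinks cone_rel (@flat_rel d).
Proof.
split=> [u v|u v]; first by rewrite /cone_rel => ->.
move=> /orP[->//|/wedge_relP[i [p [q [pq -> ->]]]]].
pose b := sph_base (nth 0%N d i); pose a : flat d := spoke b.
have apex r : r != b -> crel b r ->
    [/\ flat_rel a (spoke r) & forall y, cone_rel None y -> cone_rel (spoke r) y -> flat_rel a y].
  move=> rb rc; split; first by rewrite spoke_rel.
  move=> y Ny ry; have [->|y0] := eqVneq y None; first by rewrite /= inordK.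
  have [s ys] := spoke_nbr rb y0 ry; rewrite ys spoke_rel.
  have [->|sb] := eqVneq s b; first exact: sph_vertex.
  have sp : spoke s = petal s by rewrite petalE (negPf sb).
  move: Ny; rewrite ys /cone_rel => /orP[|].
    rewrite /= spoke_val => /andP[s1 s2]; case/eqP: sb; rewrite /b /sph_base.
    by case: s s1 s2 {ys sp} => j [] //= /eqP j0 _; congr (_, _); exact: val_inj.
  by rewrite sp -(petal_base i) petal_rel.
have aa : flat_rel a a by rewrite spoke_rel; exact: sph_vertex.
have aN : flat_rel a None by rewrite /= inordK.
rewrite !petalE; case: eqP => [pb|/eqP pb]; case: eqP => [qb|/eqP qb] // nuv.
- have [ar Ha] := apex q qb (eq_ind _ (fun p => crel p q) pq _ pb).
  by exists a; split=> // y _; exact: Ha.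
- have [ar Ha] := apex p pb (eq_ind _ (fun q => crel q p) (etrans (crel_sym _ _) pq) _ qb).
  by exists a; split=> // y _ ? ?; exact: Ha.
- by case/negP: nuv; rewrite spoke_rel.
Qed.

Lemma simplicial_fuse : @simplicial (Cpx cone_sym) wedge_cpx fuse.
Proof.
move=> u v _ _ /orP[|/wedge_relP[i [p [q [pq -> ->]]]]]; last first.
  by rewrite /= !fuse_petal petal_rel.
have NN : wedge_rel None None by rewrite -(petal_base ord0) petal_rel sph_vertex.
case: (eqVneq u None) (eqVneq v None) => [->|u0] [->|v0] //.
- by case: v v0 => // -[[i j] s] _ /= ->.
- by case: u u0 => // -[[i j] s] _ /= ->.
move=> uv; have [i [p [q [E F]]]] := spoke_surj u0 v0 uv.
by rewrite E F /= -/(petal p) -/(petal q) petal_rel -spoke_rel -E -F.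
Qed.

Lemma flat_wedge (R : realType) :
  homotopy_equivalent R (realization R (flag (flat d))) (realization R (flag wedge_cpx)).
Proof.
apply: (@homotopy_equivalent_trans _ _ (realization R (flag (Cpx cone_sym)))).
  apply: homotopy_equivalent_sym; exact: flag_shrink shrinks_cone_flat.
apply: (@flag_simplicial R (Cpx cone_sym) wedge_cpx fuse id simplicial_fuse) => [u v _ _ uv|u v _ _|u v _ _] /=.
- by apply/orP; right.
- move=> uv; have [->//|nf] := eqVneq (fuse u) u.
  have fN : fuse u = None.
    by move: nf; rewrite /fuse; case: (u) => [[[i j] s]|]; [case: ifP => //; rewrite eqxx|].
  move/orP: uv => [uv|/wedge_relP[i [p [q [_ up _]]]]]; last first.
    by move: nf; rewrite up fuse_petal eqxx.
  rewrite fN; have u0 : u != None by apply: contraNneq nf => ->.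
  have [->//|v0] := eqVneq v None.
  have [i [p [q [E F]]]] := spoke_surj u0 v0 uv.
  have pb : p = sph_base _.
    by apply: petal_inj; rewrite petal_base -fN E.
  have [qb|qb] := eqVneq q (sph_base _).
    by rewrite F qb /cone_rel /= inordK.
  have -> : v = petal q by rewrite petalE (negPf qb).
  by apply/orP; right; rewrite -(petal_base i) petal_rel -pb -spoke_rel -E -F.
- by case/wedge_relP=> i [p [q [pq -> ->]]]; rewrite fuse_petal petal_rel.
Qed.

End Wedge.

(** * The topological wedge *)

Section Glue.
Variables (R : realType) (n0 : nat) (d0 : seq nat).
Let d := n0 :: d0.
Let W := realization R (flag (wedge_cpx n0 d0)).
Let deg (i : 'I_(size d0).+1) := nth 0%N d i.

Lemma simplicial_petal i : @simplicial (sph (deg i)) (wedge_cpx n0 d0) (@petal n0 d0 i).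
Proof. by move=> p q _ _; rewrite /= petal_rel. Qed.

Definition petalr i (y : @sphere R (deg i)) : W := pushr (@simplicial_petal i) (polarr y).

Lemma petalr_continuous i : continuous (@petalr i).
Proof. exact: continuous_o (@polarr_continuous R _) (@pushr_continuous R _ _ _ _). Qed.

Lemma petalrE i (y : @sphere R (deg i)) p : val (petalr y) (petal p) = polar y p.
Proof. exact: push_inj (@petal_inj _ _ _). Qed.

Lemma petalr_base i u : val (petalr (sphere_base R (deg i))) u = (u == None)%:R.
Proof.
rewrite /= /push (eq_bigr (fun p => (p == sph_base (deg i))%:R)) => [|p _]; last exact: polar_base.
have [->|u0] := eqVneq u None.
  rewrite (bigD1 (sph_base (deg i))) ?petal_base // big1 => [|p /andP[_ pb]].
    by rewrite eqxx; exact: addr0.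
  by rewrite (negPf pb).
rewrite big1 // => p /eqP pu; case: eqP => // pb.
by rewrite -pu pb petal_base eqxx in u0.
Qed.

Lemma petalr_baseE i j : petalr (sphere_base R (deg i)) = petalr (sphere_base R (deg j)).
Proof. by apply: val_inj; apply/funext => u; rewrite !petalr_base. Qed.

Definition glue : wedge_of_spheres R deg -> W := wedge_fun petalr.

Lemma glue_lift i (y : @sphere R (deg i)) :
  glue (wedge_lift (fun i => sphere_base R (deg i)) y) = petalr y.
Proof. by apply: wedge_lift_funE => *; exact: petalr_baseE. Qed.

Lemma glue_continuous : continuous glue.
Proof.
by apply: wedge_fun_continuous => *; [exact: petalr_continuous|exact: petalr_baseE].
Qed.

Lemma wedge_ofP (z : wedge_of_spheres R deg) :
  exists i (y : @sphere R (deg i)), z = wedge_lift (fun i => sphere_base R (deg i)) y.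
Proof.
have : [set: wedge_of_spheres R deg] z by [].
by rewrite -wedgeTE => -[i _ [y _ <-]]; exists i, y.
Qed.

Lemma petalr_inj i : injective (@petalr i).
Proof.
move=> y z yz; apply: polarr_inj; apply: val_inj; apply/funext => p /=.
by rewrite -!petalrE yz.
Qed.

Lemma petalr_meet i j (y : @sphere R (deg i)) (z : @sphere R (deg j)) :
  i != j -> petalr y = petalr z -> y = sphere_base R (deg i).
Proof.
move=> ij yz; apply: petalr_inj; rewrite yz; apply: val_inj; apply/funext => u.
rewrite petalr_base.
have zero v : v != None -> val (petalr z) v = 0.
  move=> v0; apply/eqP; apply: contraNT v0 => zv.
  have := zv; rewrite -yz => /push_neq0[p vp _]; move: zv => /push_neq0[q vq _].
  by rewrite vp (petal_meet ij (etrans (esym vp) vq)) petal_base.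
have [->|u0] := eqVneq u None; last exact: zero.
have [_ z1 _] := flagP (petalr z).
by rewrite -z1 (bigD1 None) //= big1 ?addr0.
Qed.

Lemma glue_inj : injective glue.
Proof.
move=> z w; have [i [y ->]] := wedge_ofP z; have [j [y' ->]] := wedge_ofP w.
rewrite !glue_lift => E; have [ij|ij] := eqVneq i j.
  by case: j / ij y' E => y' /petalr_inj ->.
rewrite (petalr_meet ij E) (petalr_meet _ (esym E)) 1?eq_sym //.
exact: wedge_liftE.
Qed.

Lemma glue_surj (x : W) : exists z, glue z = x.
Proof.
have [x0 x1 xK] := flagP x.
(* A point of the support other than the hub determines the petal. If there is none, the point is
   the hub, which lies on every petal, and [ord0] is taken. *)
have [i Hi] : exists i, forall u, val x u != 0 -> exists p : sph (deg i), u = petal p.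
  have [[u xu u0]|no] := pselect (exists2 u, val x u != 0 & u != None); last first.
    exists ord0 => u xu; exists (sph_base _); rewrite petal_base.
    by apply: contrapT => /eqP u0; apply: no; exists u.
  have /wedge_relP[i [p [_ [_ up _]]]] := xK _ _ xu xu; exists i => v xv.
  have /wedge_relP[j [q [r [_ uq vr]]]] := xK _ _ xu xv.
  have [ij|ij] := eqVneq i j; first by case: j / ij q r uq vr => q r _ ->; exists r.
  by rewrite up (petal_meet ij (etrans (esym up) uq)) petal_base eqxx in u0.
have yP : realization_set R (flag (sph (deg i))) (fun p => val x (petal p)).
  apply: flag_point => [p||p q xp xq]; first exact: x0.
  - rewrite -[RHS]x1 [RHS](bigID (mem (@petal n0 d0 i @: [set: _])%SET)) /=.
    rewrite [X in _ + X]big1 ?addr0; last first.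
      by move=> u; apply: contraNeq => /Hi[p ->]; apply: imset_f; rewrite finset.in_setT.
    rewrite big_imset /=; last by move=> p q _ _; exact: petal_inj.
    by apply: eq_bigl => p; rewrite finset.in_setT.
  - by rewrite -petal_rel; exact: xK.
have [y Ey] := polarr_surj (rpoint yP).
exists (wedge_lift (fun i => sphere_base R (deg i)) y); rewrite glue_lift.
have E (p : sph (deg i)) : val (petalr y) (petal p) = val x (petal p).
  by rewrite petalrE -[polar y p]/(val (polarr y) p) Ey.
apply: val_inj; apply/funext => u.
have [[p ->]|nu] := pselect (exists p : sph (deg i), u = petal p); first exact: E.
transitivity (0 : R).
  by apply/eqP/negPn/negP => /push_neq0[p up _]; apply: nu; exists p.
by apply/esym/eqP/negPn/negP => /Hi.
Qed.

Lemma wedge_equivalent : homotopy_equivalent R W (wedge_of_spheres R deg).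
Proof.
(* A continuous bijection from a compact space to a Hausdorff one, so continuity of the inverse
   comes for free. *)
have [g gK] := choice glue_surj.
apply: homotopy_equivalent_sym; apply: (@homeo_compact R _ _ glue g) => //.
- by apply: wedge_compact => [|i]; [exact: finite_finset|exact/compact_set_type/compact_sphere].
- exact: hausdorff_realization.
- exact: glue_continuous.
- by move=> z; apply: glue_inj; rewrite gK.
Qed.

End Glue.

Lemma flat_nil_contractible (R : realType) : contractible R (realization R (flag (flat [::]))).
Proof.
have N (u : flat [::]) : u = None by case: u => [[[[i i0] j] s]|].
have hP : realization_set R (flag (flat [::])) (fun u => (u == None)%:R).
  apply: flag_point => [u||u v _ _]; last by rewrite (N u) (N v).
  - exact: ler0n.
  - rewrite (bigD1 None) // big1 => [|u /andP[_ /negPf->] //].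
    by rewrite eqxx; exact: addr0.
exists (rpoint hP); apply: linear_homotopic => [x||x]; [exact: cvg_id|exact: cst_continuous|].
by apply: support_cliques => u v _ _; rewrite (N u) (N v).
Qed.

(** * Back to graphs and their matching complexes *)

Section Matching.
Variable G : sgraph.

Definition edge_set : {set {set G}} := [set s : {set G} | is_edge s]%SET.

Lemma pairs_edge_set : pairs edge_set.
Proof.
move=> e; rewrite finset.inE => /existsP[x /existsP[y /andP[xy /eqP->]]].
rewrite cards2; suff -> : x != y by [].
by apply: contraTneq xy => ->; rewrite adj_irrefl.
Qed.

Lemma madj_edge_set x y : madj edge_set x y = adj x y.
Proof.
apply/andP/idP => [[xy]|xy].
  rewrite finset.inE => /existsP[u /existsP[v /andP[uv /eqP E]]].
  have := finset.set21 x y; have := finset.set22 x y; rewrite E !finset.inE.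
  case/orP=> /eqP yE /orP[]/eqP xE; subst x y; rewrite ?eqxx // in xy *.
  by rewrite adj_sym.
split; first by apply: contraTneq xy => ->; rewrite adj_irrefl.
by rewrite finset.inE; apply/existsP; exists x; apply/existsP; exists y; rewrite xy eqxx.
Qed.

(** Matchings are the cliques of the disjointness relation, and passing from the type of edges to
    all sets of vertices only adds points that are not vertices of the complex. *)
Lemma matching_complex_equivalent (R : realType) :
  homotopy_equivalent R (realization R (matching_complex G)) (realization R (flag (mcpx edge_set))).
Proof.
pose c (e f : edge G) := (e == f) || [disjoint val e & val f]%B.
have cs : symmetric c by move=> e f; rewrite /c eq_sym disjoint_sym.
have cE s : (s \in faces (matching_complex G)) = (s \in faces (flag (Cpx cs))).
  rewrite !finset.inE; apply/forall_inP/forall_inP => H e es; apply/forall_inP => f fs.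
    by have /forall_inP/(_ f fs)/implyP := H e es; rewrite /= /c; case: eqVneq => //= _; exact.
  by apply/implyP => ef; have /forall_inP/(_ f fs) := H e es; rewrite /= /c (negPf ef).
apply: (@homotopy_equivalent_trans _ _ (realization R (flag (Cpx cs)))); last first.
  apply: (@flag_emb R (Cpx cs) (mcpx edge_set) val) => [|e f|s].
  - exact: val_inj.
  - by rewrite /= /mrel !finset.inE !(valP (_ : edge G)).
  - rewrite /= mrel_vertex finset.inE => se; by exists (Sub s se); rewrite SubK.
have fP (x : realization R (matching_complex G)) : realization_set R (flag (Cpx cs)) (val x).
  by have [x0 x1 xK] := realizationP x; split=> //; rewrite -cE.
have gP (x : realization R (flag (Cpx cs))) : realization_set R (matching_complex G) (val x).
  by have [x0 x1 xK] := realizationP x; split=> //; rewrite cE.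
have cf : continuous (fun x => rpoint (fP x)).
  by apply: realization_continuous => e; exact: bary_continuous.
have cg : continuous (fun x => rpoint (gP x)).
  by apply: realization_continuous => e; exact: bary_continuous.
apply: (contiguous_equivalent cf cg) => x.
  by have [_ _] := realizationP x; rewrite /support /= finset.setUid.
by have [_ _] := realizationP x; rewrite /support /= finset.setUid.
Qed.

End Matching.

Local Close Scope ring_scope.
Local Close Scope classical_set_scope.

Theorem theorem2 (R : realType) (G : sgraph)
    (outerplanarG : outerplanar R G) (edgesG : 0 < #|edge G|) :
  contractible R (realization R (matching_complex G)) \/
  exists (k : nat) (d : 'I_k.+1 -> nat),
    homotopy_equivalent R (realization R (matching_complex G))
      (wedge_of_spheres R d).
Proof.
have sub : subrel (madj (edge_set G)) (@adj G) by move=> x y; rewrite madj_edge_set.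
have [no|[d]] : htype (mcpx (edge_set G)).
- apply: htype_outerplanar; first exact: pairs_edge_set.
  + by move/(minor_sub sub)/(outerplanar_noK4 outerplanarG).
  + by move/(minor_sub sub)/(outerplanar_noK23 outerplanarG).
- have [e _] := card_gt0P edgesG.
  by have := no (val e); rewrite /= mrel_vertex finset.inE (valP e).
move=> /(heq_homotopy_equivalent R).
move=> /(homotopy_equivalent_trans (matching_complex_equivalent G R)).
case: d => [|n d] Gd; [left|right].
  exact: contractible_equivalent Gd (flat_nil_contractible R).
exists (size d), (fun i => nth 0 (n :: d) i).
by apply: homotopy_equivalent_trans Gd _; apply: homotopy_equivalent_trans (flat_wedge n d R) _;
  exact: wedge_equivalent.
Qed.
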